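(* Let $1<p\leq q<\infty$. Let $\sigma$ and $\omega$ be locally finite Borel measures on $\mathbb{R}^d$. Let $C$ and $D$ be Banach lattices, and assume that $C$ and $D^*$ each have the dyadic Hardy--Littlewood property. Let $\mathcal{D}$ be a finite collection of dyadic cubes on $\mathbb{R}^d$ and let $\{\lambda_Q:C\to D\}_{Q\in\mathcal{D}}$ be positive operators. Define, for $R\in\mathcal{D}$, $$T_\lambda(f\sigma):=\sum_{Q\in\mathcal{D}}\lambda_Q\Big(\int_Q f\,\mathrm{d}\sigma\Big)1_Q,\qquad T_{\lambda,R}(f\sigma):=\sum_{Q\in\mathcal{D}:\,Q\subseteq R}\lambda_Q\Big(\int_Q f\,\mathrm{d}\sigma\Big)1_Q .$$ Assume that $\sigma$ and $\omega$ satisfy the $A_\infty$ condition with respect to each other, i.e. $[\sigma]_{A_\infty(\omega)}<\infty$ and $[\omega]_{A_\infty(\sigma)}<\infty$. Let $\mathfrak{B}$ be the least constant such that $$\int g\,T_{\lambda,R}(f\sigma)\,\mathrm{d}\omega\leq \mathfrak{B}\,\|f\|_{L^\infty_C(R,\sigma)}\|g\|_{L^\infty_{D^*}(R,\omega)}\,\sigma(R)^{1/p}\omega(R)^{1/q'}$$ for every $R\in\mathcal{D}$, every $f\in L^\infty_C(R,\sigma)$, and every $g\in L^\infty_{D^*}(R,\omega)$. Then $$\mathfrak{B}\leq\|T_\lambda(\,\cdot\,\sigma)\|_{L^p_C(\sigma)\to L^q_D(\omega)}\leq K_{p,q}\,\|\bar M\|_{L^p_C\to L^p_C}\,\|\bar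 M\|_{L^{q'}_{D^*}\to L^{q'}_{D^*}}\Big([\sigma]_{A_\infty(\omega)}^{1/p}+[\omega]_{A_\infty(\sigma)}^{1/q'}\Big)\mathfrak{B},$$ where $K_{p,q}$ is a constant depending only on $p$ and $q$.
   Context: A Banach lattice $(E,|\cdot|_E,\leq)$ is a real Banach space with a compatible lattice order; $E_+=\{e\in E:e\ge 0\}$. Its dual $E^*$ is a Banach lattice under the order $e^*\geq 0$ iff $e^*(e)\geq 0$ for all $e\in E_+$. A linear operator $\lambda:C\to D$ between Banach lattices is positive if $c\ge 0$ implies $\lambda c\ge 0$. $L^p_E(\mu)$ is the Lebesgue--Bochner space with norm $(\int |f|_E^p\,\mathrm{d}\mu)^{1/p}$; $L^p_E$ is the case of Lebesgue measure on $\mathbb{R}^d$. $L^\infty_E(R,\mu)$ is the $E$-valued $L^\infty$ space on $R$ with respect to $\mu$; elements are extended by zero outside $R$. In $\int g\,T_{\lambda,R}(f\sigma)\,\mathrm{d}\omega$ the product is the pointwise duality pairing of $D^*$ and $D$. $q'$ is the conjugate exponent of $q$. For a finite collection $\mathcal{D}'$ of dyadic cubes, the dyadic lattice Hardy--Littlewood maximal operator is $\bar M_{\mathcal{D}'}f:=\sup_{Q\in\mathcal{D}'}\langle f\rangle_Q1_Q$, where $\langle f\rangle_Q=\frac1{|Q|}\int_Q f\,\mathrm{d}x$ and the supremum is taken in the lattice order of $E$. $\|\bar M\|_{L^p_E\to L^p_E}$ denotes $\sup_{\mathcal{D}'}\|\bar M_{\mathcal{D}'}\|_{L^p_E\to L^p_E}$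 over all finite collections $\mathcal{D}'$ of dyadic cubes. $E$ has the dyadic Hardy--Littlewood property if this is finite for some $p\in(1,\infty)$ (it is a known fact that then it is finite for every $p\in(1,\infty)$). The $A_\infty$ characteristic of $\sigma$ with respect to $\omega$ is $$[\sigma]_{A_\infty(\omega)}:=\sup_{R\in\mathcal{D}}\frac1{\sigma(R)}\int M^\omega_R(\sigma)\,\mathrm{d}\omega,\qquad M^\omega_R(\sigma):=\sup_{Q\in\mathcal{D}:\,Q\subseteq R}\frac{\sigma(Q)}{\omega(Q)}1_Q ,$$ and $[\omega]_{A_\infty(\sigma)}$ is defined by exchanging $\sigma$ and $\omega$. Convention: the supremum over $R$ is over $R$ with $\sigma(R)>0$, and cubes $Q$ with $\omega(Q)=0$ are omitted in $M^\omega_R(\sigma)$. *)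

(* Defs.v *)
From HB Require Import structures.
From mathcomp Require Import all_boot all_order all_algebra.
From mathcomp Require Import finmap.
From mathcomp Require Import all_classical all_reals all_analysis.
Set Implicit Arguments.
Unset Strict Implicit.
Unset Printing Implicit Defensive.
Import Order.TTheory GRing.Theory Num.Theory.
Import numFieldNormedType.Exports.
Local Open Scope classical_set_scope.
Local Open Scope ring_scope.

Reserved Notation "x <=v y" (at level 70, y at next level).

(* A Banach lattice.  The order is a field of the structure and not an instance
   of the library's latticeType, because the hierarchy has no join of ordered
   types and normed modules other than the numeric domains.  Infima need no
   field, since inf x y = - sup (- x) (- y). *)
HB.mixin Record isBanachLattice (R : realType) E
    of CompleteNormedModule R E := {
  vle : E -> E -> Prop ;
  vsup : E -> E -> E ;
  vle_refl : forall x, vle x x ;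
  vle_anti : forall x y, vle x y -> vle y x -> x = y ;
  vle_trans : forall x y z, vle x y -> vle y z -> vle x z ;
  vsup_ubl : forall x y, vle x (vsup x y) ;
  vsup_ubr : forall x y, vle y (vsup x y) ;
  vsup_lub : forall x y z, vle x z -> vle y z -> vle (vsup x y) z ;
  vleD2r : forall z x y, vle x y -> vle (x + z) (y + z) ;
  vscale_ge0 : forall (a : R) x, 0 <= a -> vle 0 x -> vle 0 (a *: x) ;
  vnorm_le : forall x y, vle (vsup x (- x)) (vsup y (- y)) -> `|x| <= `|y|
}.

#[short(type="banachLatticeType")]
HB.structure Definition BanachLattice (R : realType) :=
  {E of CompleteNormedModule R E & isBanachLattice R E}.

Notation "x <=v y" := (vle x y) : ring_scope.

Section banach_lattice_theory.
Context {R : realType} {E : banachLatticeType R}.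
Implicit Types x y z : E.

Definition vabs x := vsup x (- x).
Definition vpos x := vsup x 0.

Lemma vle_subr0 x y : 0 <=v y - x -> x <=v y.
Proof. by move=> /(vleD2r x); rewrite add0r subrK. Qed.

Lemma vsubr_ge0 x y : x <=v y -> 0 <=v y - x.
Proof. by move=> /(vleD2r (- x)); rewrite subrr. Qed.

Lemma vleD x y x' y' : x <=v y -> x' <=v y' -> x + x' <=v y + y'.
Proof.
move=> /(vleD2r x') h /(vleD2r y) h'; apply: vle_trans h _.
by rewrite [y + x']addrC [y + y']addrC.
Qed.

Lemma vaddr_ge0 x y : 0 <=v x -> 0 <=v y -> 0 <=v x + y.
Proof. by move=> h h'; rewrite -[0]addr0; exact: vleD. Qed.

Lemma vleN x y : x <=v y -> - y <=v - x.
Proof. by move=> h; apply: vle_subr0; rewrite opprK addrC; exact: vsubr_ge0. Qed.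

Lemma vsupDr x y z : vsup (x + z) (y + z) = vsup x y + z.
Proof.
apply: vle_anti.
  by apply: vsup_lub; apply: vleD2r; [exact: vsup_ubl|exact: vsup_ubr].
rewrite -[X in _ <=v X](subrK z); apply: vleD2r.
apply: vsup_lub.
  by rewrite -[X in X <=v _](addrK z); apply: vleD2r; exact: vsup_ubl.
by rewrite -[X in X <=v _](addrK z); apply: vleD2r; exact: vsup_ubr.
Qed.

Lemma vpos_ge0 x : 0 <=v vpos x. Proof. exact: vsup_ubr. Qed.

Lemma vposBN x : vpos x - vpos (- x) = x.
Proof.
suff -> : vpos (- x) = vpos x - x by rewrite opprB addrC subrK.
rewrite /vpos -vsupDr subrr add0r; apply: vle_anti.
  by apply: vsup_lub; [exact: vsup_ubr|exact: vsup_ubl].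
by apply: vsup_lub; [exact: vsup_ubr|exact: vsup_ubl].
Qed.

Lemma vhalf_ge0 x : 0 <=v x + x -> 0 <=v x.
Proof.
move=> xx; have : 0 <=v 2^-1 *: (x + x) by apply: vscale_ge0; rewrite ?invr_ge0.
by rewrite -mulr2n -(scaler_nat 2 x) scalerA mulVf ?pnatr_eq0// scale1r.
Qed.

Lemma vabs_ge0 x : 0 <=v vabs x.
Proof.
by apply: vhalf_ge0; rewrite -(subrr x); apply: vleD;
  [exact: vsup_ubl|exact: vsup_ubr].
Qed.

Lemma vge0_abs x : 0 <=v x -> vabs x = x.
Proof.
move=> x0; apply: vle_anti; last exact: vsup_ubl.
apply: vsup_lub; first exact: vle_refl.
by apply: (vle_trans _ _ _ _ x0); rewrite -[X in _ <=v X]oppr0; exact: vleN.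
Qed.

Lemma vabs_le x y : x <=v y -> - x <=v y -> vabs x <=v y.
Proof. exact: vsup_lub. Qed.

Lemma vnorm_le_ge0 x y : vabs x <=v y -> `|x| <= `|y|.
Proof.
move=> xy; apply: vnorm_le; rewrite -/(vabs x) -/(vabs y) (@vge0_abs y)//.
exact: vle_trans (vabs_ge0 x) xy.
Qed.

Lemma vnorm_mono x y : 0 <=v x -> x <=v y -> `|x| <= `|y|.
Proof. by move=> x0 xy; apply: vnorm_le_ge0; rewrite vge0_abs. Qed.

Lemma vnorm_abs x : `|vabs x| = `|x|.
Proof.
apply/eqP; rewrite eq_le; apply/andP; split; apply: vnorm_le;
  rewrite -/(vabs (vabs x)) -/(vabs x) (vge0_abs (vabs_ge0 x)); exact: vle_refl.
Qed.

Lemma vpos_le_abs x : vpos x <=v vabs x.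
Proof. by apply: vsup_lub; [exact: vsup_ubl|exact: vabs_ge0]. Qed.

Lemma vabsN x : vabs (- x) = vabs x.
Proof.
by rewrite /vabs opprK; apply: vle_anti; apply: vsup_lub;
  [exact: vsup_ubr|exact: vsup_ubl|exact: vsup_ubr|exact: vsup_ubl].
Qed.

Lemma vnorm_pos x : `|vpos x| <= `|x|.
Proof.
by rewrite -(vnorm_abs x); apply: vnorm_mono; [exact: vpos_ge0|exact: vpos_le_abs].
Qed.

Lemma riesz_decomp x y z : 0 <=v x -> 0 <=v y -> 0 <=v z -> z <=v x + y ->
  exists z1 z2, [/\ z = z1 + z2, 0 <=v z1, z1 <=v x, 0 <=v z2 & z2 <=v y].
Proof.
move=> x0 y0 z0 zxy; exists (z - vpos (z - x)), (vpos (z - x)); split.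
- by rewrite subrK.
- apply: vsubr_ge0; apply: vsup_lub => //.
  by rewrite -[X in _ <=v X]subr0; apply: vleD; [exact: vle_refl|exact: vleN].
- apply: vle_subr0; rewrite opprB addrCA -[x - z]opprB.
  by apply: vsubr_ge0; exact: vsup_ubl.
- exact: vpos_ge0.
- apply: vsup_lub => //.
  by move: zxy => /(vleD2r (- x)); rewrite addrAC subrr add0r.
Qed.

End banach_lattice_theory.

Section dual_space.
Context {R : realType} (E : normedModType R).

Definition functional : {pred E -> R^o} :=
  [pred f : E -> R^o | `[< linear f /\ continuous f >]].

Fact functional_submod_closed : submod_closed functional.
Proof.
split.
  rewrite inE; split; last by move=> x; exact: cvg_cst.
  by move=> a x y; rewrite -[RHS]/(a *: (0 : R^o) + 0) scaler0 addr0.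
move=> a f g; rewrite !inE => -[lf cf] [lg cg]; split.
  move=> b x y; rewrite !fctE lf lg !scalerDr !addrA; congr (_ + _).
  by rewrite -!addrA [a *: f y + _]addrC !addrA !scalerA [a * b]mulrC.
by move=> x; apply: cvgD; [apply: cvgZl_tmp; exact: cf|exact: cg].
Qed.
HB.instance Definition _ := GRing.isSubmodClosed.Build R (E -> R^o) functional
  functional_submod_closed.

Record dual := Dual {
  dual_fun :> E -> R^o ;
  dual_funP : dual_fun \in functional }.

HB.instance Definition _ := [isSub for dual_fun].
HB.instance Definition _ := [Choice of dual by <:].
HB.instance Definition _ := [SubChoice_isSubLmodule of dual by <:].

Implicit Types (f g : dual) (x : E).

Fact dual_linear f : linear f.
Proof. by have := dual_funP f; rewrite inE => -[]. Qed.
HB.instance Definition _ f :=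
  GRing.isLinear.Build R E R^o *:%R (dual_fun f) (dual_linear f).

Lemma dual_continuous f : continuous f.
Proof. by have := dual_funP f; rewrite inE => -[]. Qed.

Lemma dualP f g : f =1 g -> f = g.
Proof. by move=> fg; apply/val_inj/funext. Qed.

Definition dual_norm f : R := sup [set `|f x| | x in [set x : E | `|x| <= 1]].

Lemma dual_bounded f : exists2 M : R, 0 < M & forall x, `|f x| <= M * `|x|.
Proof.
have /linear_bounded_continuous/linear_boundedP := @dual_continuous f.
by move=> /pinfty_ex_gt0[M M0 fM]; exists M.
Qed.

Lemma dual_norm_has_sup f : has_sup [set `|f x| | x in [set x : E | `|x| <= 1]].
Proof.
have [M M0 fM] := dual_bounded f; split.
  by exists `|f 0|, 0 => //=; rewrite normr0 ler01.
exists M => _ [x /= x1 <-]; rewrite (le_trans (fM x))// ler_piMr// ltW//.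
Qed.

Lemma dual_norm_ge0 f : 0 <= dual_norm f.
Proof.
apply: (@le_trans _ _ `|f 0|) => //; apply: sup_upper_bound.
  exact: dual_norm_has_sup.
by exists 0 => //=; rewrite normr0 ler01.
Qed.

Lemma ler_dual_norm f x : `|f x| <= dual_norm f * `|x|.
Proof.
have [->|x0] := eqVneq x 0; first by rewrite linear0 !normr0 mulr0.
have nx0 : 0 < `|x| by rewrite normr_gt0.
have -> : f x = `|x| * f (`|x|^-1 *: x).
  by rewrite linearZ /= -[RHS]/(`|x| * (`|x|^-1 * f x)) mulrA divff ?gt_eqF// mul1r.
rewrite normrM normr_id mulrC ler_wpM2r//; apply: sup_upper_bound.
  exact: dual_norm_has_sup.
exists (`|x|^-1 *: x) => //=.
by rewrite normrZ ger0_norm ?invr_ge0// mulVf ?gt_eqF.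
Qed.

Lemma dual_norm_le f (c : R) :
  0 <= c -> (forall x, `|f x| <= c * `|x|) -> dual_norm f <= c.
Proof.
move=> c0 fc; apply: ge_sup; first by case: (dual_norm_has_sup f).
by move=> _ [x /= x1 <-]; rewrite (le_trans (fc x))// ler_piMr.
Qed.

Fact dual_normD f g : dual_norm (f + g) <= dual_norm f + dual_norm g.
Proof.
apply: dual_norm_le; first by rewrite addr_ge0 ?dual_norm_ge0.
by move=> x; rewrite mulrDl (le_trans (ler_normD _ _))// lerD ?ler_dual_norm.
Qed.

Fact dual_normZ (a : R) f : dual_norm (a *: f) = `|a| * dual_norm f.
Proof.
have le b h : dual_norm (b *: h) <= `|b| * dual_norm h.
  apply: dual_norm_le => [|x]; first by rewrite mulr_ge0 ?dual_norm_ge0.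
  by rewrite -[(b *: h) x]/(b * h x) normrM -mulrA ler_wpM2l ?ler_dual_norm.
have [->|a0] := eqVneq a 0.
  apply/eqP; rewrite eq_le le; rewrite normr0 mul0r dual_norm_ge0//.
apply/eqP; rewrite eq_le le/=.
rewrite -[in leLHS](scale1r f) -(mulVf a0) -scalerA.
rewrite (le_trans (ler_wpM2l _ (le _ _)))// mulrA normfV mulfV ?normr_eq0//.
by rewrite mul1r.
Qed.

Fact dual_norm_eq0 f : dual_norm f = 0 -> f = 0.
Proof.
move=> f0; apply: dualP => x; apply/eqP; rewrite -normr_le0.
by rewrite (le_trans (ler_dual_norm f x))// f0 mul0r.
Qed.

HB.instance Definition _ :=
  Lmodule_isNormed.Build R dual dual_normD dual_normZ dual_norm_eq0.

Lemma ler_dual f x : `|f x| <= `|f| * `|x|. Proof. exact: ler_dual_norm. Qed.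

Lemma ler_norm_dual f (c : R) :
  0 <= c -> (forall x, `|f x| <= c * `|x|) -> `|f| <= c.
Proof. exact: dual_norm_le. Qed.

Lemma linear_bounded_functional (f : E -> R^o) (c : R) : linear f ->
  (forall x, `|f x| <= c * `|x|) -> f \in functional.
Proof.
move=> lf fc; rewrite inE; split => //.
pose L := GRing.isLinear.Build R E R^o *:%R f lf.
pose F : {linear E -> R^o} := HB.pack f L.
apply: (@bounded_linear_continuous R E R^o F); apply/linear_boundedP.
near=> r => x; rewrite (le_trans (fc x))// ler_wpM2r//.
Unshelve. all: by end_near. Qed.

Fact dual_complete (F : set_system dual) : ProperFilter F -> cauchy F -> cvg F.
Proof.
move=> FF /cauchy_ballP Fc.
have Fx x : cvg ((fun f : dual => (f x : R^o)) @ F).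
  apply: cauchy_cvg; apply/cauchy_ballP => e e0.
  have d0 : 0 < e / (`|x| + 1) by rewrite divr_gt0// ltr_wpDl.
  have H := Fc _ d0; rewrite near_map2; move: H; apply: filterS => -[f g] /=.
  rewrite -!ball_normE /= => fg.
  rewrite -[f x - g x]/((f - g) x) (le_lt_trans (ler_dual _ _))//.
  rewrite (@le_lt_trans _ _ (`|f - g| * (`|x| + 1)))//.
    by rewrite ler_wpM2l// lerDl.
  by rewrite -ltr_pdivlMr// ltr_wpDl.
pose l x : R^o := lim ((fun f : dual => (f x : R^o)) @ F).
have lP x : (fun f : dual => (f x : R^o)) @ F --> l x by exact: Fx.
have ll : linear l.
  move=> a x y; apply: cvg_lim => //.
  rewrite (_ : (fun f : dual => _) = (fun f => a *: (f x : R^o) + (f y : R^o))).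
    by apply: cvgD => //; apply: cvgZl_tmp.
  by apply/funext => f; rewrite linearP.
have lb e f : (\forall g \near F, `|f - g| <= e) ->
    forall x, `|f x - l x| <= e * `|x|.
  move=> Ff x.
  have h : (fun g : dual => `|(f x : R^o) - g x|) @ F --> `|f x - l x|.
    by apply: cvg_norm; apply: cvgB => //; exact: cvg_cst.
  apply: (cvgr_to_le h); near=> g.
  rewrite -[f x - g x]/((f - g) x) (le_trans (ler_dual _ _))// ler_wpM2r//.
  by near: g.
have Fe e : 0 < e -> \forall f \near F, \forall g \near F, `|f - g| <= e.
  move=> /Fc; rewrite !near_simpl => /nearP_dep; apply: filterS => f.
  by apply: filterS => g; rewrite -ball_normE => /ltW.
have lf : l \in functional.
  near F => f.
  apply: (@linear_bounded_functional l (1 + `|f|)) => // x.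
  rewrite -[l x](subrK (f x)) (le_trans (ler_normD _ _))// mulrDl.
  rewrite lerD ?ler_dual// distrC; apply: lb; near: f; exact: Fe.
apply/cvg_ex; exists (Dual lf); apply/cvgrPdist_le => e e0.
near=> f; rewrite distrC; apply: ler_norm_dual; first exact: ltW.
by move=> x; apply: (lb e f); near: f; exact: Fe.
Unshelve. all: by end_near. Qed.

HB.instance Definition _ := Uniform_isComplete.Build dual dual_complete.

End dual_space.

Section dual_banach_lattice.
Context {R : realType} (E : banachLatticeType R).
Implicit Types (f g h : dual E) (x y z : E).

Definition dual_le f g := forall x, 0 <=v x -> f x <= g x.

Fact dual_le_refl f : dual_le f f. Proof. by []. Qed.

Fact dual_le_trans f g h : dual_le f g -> dual_le g h -> dual_le f h.
Proof. by move=> fg gh x x0; rewrite (le_trans (fg x x0))// gh. Qed.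

Fact dual_le_anti f g : dual_le f g -> dual_le g f -> f = g.
Proof.
move=> fg gf; apply: dualP => x.
have e y : 0 <=v y -> f y = g y by move=> y0; apply/le_anti; rewrite fg ?gf.
by rewrite -(vposBN x) !raddfB /= !e//; exact: vpos_ge0.
Qed.

Fact dual_leD2r h f g : dual_le f g -> dual_le (f + h) (g + h).
Proof. by move=> fg x x0; rewrite lerD2r fg. Qed.

Fact dual_scale_ge0 (a : R) f : 0 <= a -> dual_le 0 f -> dual_le 0 (a *: f).
Proof. by move=> a0 f0 x x0; rewrite mulr_ge0//; exact: f0. Qed.

(* The Riesz-Kantorovich formula for the positive part of a functional. *)
Definition rk_cone f x : R :=
  sup [set f y | y in [set y : E | 0 <=v y /\ y <=v x]].

Lemma rk_has_sup f x : 0 <=v x ->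
  has_sup [set f y | y in [set y : E | 0 <=v y /\ y <=v x]].
Proof.
move=> x0; split; first by exists (f 0), 0 => //; split=> //; exact: vle_refl.
exists (`|f| * `|x|) => _ [y [y0 yx] <-].
rewrite (le_trans (ler_norm _))// (le_trans (ler_dual _ _))//.
by rewrite ler_wpM2l// vnorm_mono.
Qed.

Lemma rk_ub f x y : 0 <=v y -> y <=v x -> f y <= rk_cone f x.
Proof.
move=> y0 yx; apply: sup_upper_bound; last by exists y.
by apply: rk_has_sup; exact: vle_trans y0 yx.
Qed.

Lemma rk_lub f x (c : R) : 0 <=v x ->
  (forall y, 0 <=v y -> y <=v x -> f y <= c) -> rk_cone f x <= c.
Proof.
move=> x0 fc; apply: ge_sup; first by case: (rk_has_sup f x0).
by move=> _ [y [y0 yx] <-]; exact: fc.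
Qed.

Lemma rk_ge0 f x : 0 <=v x -> 0 <= rk_cone f x.
Proof. by move=> x0; rewrite -(linear0 f) rk_ub//; exact: vle_refl. Qed.

Lemma rkD f x y : 0 <=v x -> 0 <=v y ->
  rk_cone f (x + y) = rk_cone f x + rk_cone f y.
Proof.
move=> x0 y0; apply/eqP; rewrite eq_le; apply/andP; split.
  apply: rk_lub => [|z z0 zxy]; first exact: vaddr_ge0.
  have [z1 [z2 [-> z10 z1x z20 z2y]]] := riesz_decomp x0 y0 z0 zxy.
  by rewrite raddfD lerD// rk_ub.
rewrite -lerBrDr; apply: rk_lub => // z z0 zx.
rewrite lerBrDr addrC -lerBrDr; apply: rk_lub => // t t0 ty.
rewrite lerBrDr -raddfD; apply: rk_ub; first exact: vaddr_ge0.
by rewrite addrC; exact: vleD.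
Qed.

Lemma rkZ f (a : R) x : 0 <= a -> 0 <=v x ->
  rk_cone f (a *: x) = a * rk_cone f x.
Proof.
have le (b : R) y : 0 < b -> 0 <=v y -> b * rk_cone f y <= rk_cone f (b *: y).
  move=> b0 y0; rewrite mulrC -ler_pdivlMr//; apply: rk_lub => // z z0 zy.
  rewrite ler_pdivlMr// mulrC -[b * f z]/(b *: (f z : R^o)) -linearZ.
  apply: rk_ub; first by apply: vscale_ge0 => //; exact: ltW.
  apply: vle_subr0; rewrite -scalerBr; apply: vscale_ge0; first exact: ltW.
  exact: vsubr_ge0.
rewrite le_eqVlt => /predU1P[<- x0|a0 x0].
  rewrite scale0r mul0r; apply/eqP; rewrite eq_le rk_ge0; last exact: vle_refl.
  rewrite andbT; apply: rk_lub; first exact: vle_refl.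
  by move=> y y0 y0'; rewrite (vle_anti _ _ y0' y0) linear0.
apply/eqP; rewrite eq_le le// andbT.
have ax0 : 0 <=v a *: x by apply: vscale_ge0 => //; exact: ltW.
have := le a^-1 (a *: x); rewrite scalerA mulVf ?gt_eqF// scale1r.
by rewrite invr_gt0 => /(_ a0 ax0); rewrite ler_pdivrMl.
Qed.

Definition rk_fun f x : R^o := rk_cone f (vpos x) - rk_cone f (vpos (- x)).

Lemma rk_funB f x y : 0 <=v x -> 0 <=v y ->
  rk_fun f (x - y) = rk_cone f x - rk_cone f y.
Proof.
move=> x0 y0; have e : vpos (x - y) + y = x + vpos (- (x - y)).
  have /eqP := vposBN (x - y); rewrite subr_eq => /eqP ->.
  by rewrite addrAC subrK.
have := congr1 (rk_cone f) e; rewrite !rkD//; do ?exact: vpos_ge0.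
move=> {}e; apply/eqP; rewrite /rk_fun subr_eq addrAC eq_sym subr_eq.
by rewrite e.
Qed.

Lemma rk_funE f x : 0 <=v x -> rk_fun f x = rk_cone f x.
Proof.
move=> x0; rewrite -[x in LHS]subr0 rk_funB//; last exact: vle_refl.
have /(_ 0 x) := @rkZ f; rewrite scale0r mul0r => -> //.
by rewrite subr0.
Qed.

Fact rk_linear f : linear (rk_fun f).
Proof.
have rkN x : rk_fun f (- x) = - rk_fun f x by rewrite /rk_fun opprK opprB.
have rkfD x y : rk_fun f (x + y) = rk_fun f x + rk_fun f y.
  rewrite -{1}(vposBN x) -{1}(vposBN y) addrACA -opprD rk_funB; first last.
  - by apply: vaddr_ge0; exact: vpos_ge0.
  - by apply: vaddr_ge0; exact: vpos_ge0.
  by rewrite !rkD; do ?exact: vpos_ge0; rewrite opprD addrACA.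
have rkfZ (a : R) x : 0 <= a -> rk_fun f (a *: x) = a * rk_fun f x.
  move=> a0; rewrite -{1}(vposBN x) scalerBr rk_funB; first last.
  - by apply: vscale_ge0 => //; exact: vpos_ge0.
  - by apply: vscale_ge0 => //; exact: vpos_ge0.
  by rewrite !rkZ//; do ?exact: vpos_ge0; rewrite -mulrBr.
move=> a x y; rewrite rkfD; congr (_ + _).
have [a0|/ltW a0] := leP 0 a; first exact: rkfZ.
by rewrite -[a]opprK scaleNr rkN rkfZ ?oppr_ge0// scaleNr.
Qed.

Fact rk_bounded f x : `|rk_fun f x| <= (`|f| + `|f|) * `|x|.
Proof.
have le z : 0 <=v z -> `|rk_cone f z| <= `|f| * `|z|.
  move=> z0; rewrite ger0_norm ?rk_ge0//; apply: rk_lub => // y y0 yz.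
  rewrite (le_trans (ler_norm _))// (le_trans (ler_dual _ _))//.
  by rewrite ler_wpM2l// vnorm_mono.
rewrite (le_trans (ler_normB _ _))// mulrDl lerD//.
  by rewrite (le_trans (le _ (vpos_ge0 _)))// ler_wpM2l// vnorm_pos.
rewrite (le_trans (le _ (vpos_ge0 _)))// ler_wpM2l//.
by rewrite -[leRHS]normrN vnorm_pos.
Qed.

Definition dual_pos f : dual E :=
  Dual (linear_bounded_functional (rk_linear f) (rk_bounded f)).

Lemma dual_posE f x : 0 <=v x -> dual_pos f x = rk_cone f x.
Proof. exact: rk_funE. Qed.

Definition dual_sup f g : dual E := g + dual_pos (f - g).

Lemma dual_supE f g x : 0 <=v x -> dual_sup f g x = g x + rk_cone (f - g) x.
Proof. by move=> x0; rewrite -dual_posE. Qed.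

Fact dual_sup_ubl f g : dual_le f (dual_sup f g).
Proof.
move=> x x0; rewrite dual_supE// -lerBlDl -[f x - g x]/((f - g) x) rk_ub//.
exact: vle_refl.
Qed.

Fact dual_sup_ubr f g : dual_le g (dual_sup f g).
Proof. by move=> x x0; rewrite dual_supE// lerDl rk_ge0. Qed.

Fact dual_sup_lub f g h : dual_le f h -> dual_le g h -> dual_le (dual_sup f g) h.
Proof.
move=> fh gh x x0; rewrite dual_supE// -lerBrDl; apply: rk_lub => // y y0 yx.
rewrite -[(f - g) y]/(f y - g y) (@le_trans _ _ (h y - g y)) ?lerD2r ?fh//.
have /gh k : 0 <=v x - y by exact: vsubr_ge0.
by rewrite lerBrDr addrC -lerBrDr opprB addrA addrAC -lerBlDr -!raddfB.
Qed.

Lemma dual_le_abs f x : `|f x| <= dual_sup f (- f) (vabs x).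
Proof.
set F := dual_sup f (- f).
suff le z : f z <= F (vabs z).
  by rewrite ler_norml le andbT lerNl -raddfN -(vabsN x) le.
have h1 : f (vabs z + z) <= F (vabs z + z).
  apply: dual_sup_ubl; rewrite -[z in _ + z]opprK; apply: vsubr_ge0.
  exact: vsup_ubr.
have h2 : - f (vabs z - z) <= F (vabs z - z).
  by apply: (@dual_sup_ubr f (- f)); apply: vsubr_ge0; exact: vsup_ubl.
have aux (a b c d : R) : a + b <= c + d -> - (a - b) <= c - d -> b <= c.
  move=> h h'; have := lerD h h'; rewrite opprB [a + b]addrC addrACA.
  by rewrite [X in _ <= X]addrACA !subrr !addr0 -!mulr2n lerMn2r.
apply: (aux (f (vabs z)) _ _ (F z)).
  by rewrite -!raddfD.
by rewrite -!raddfB.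
Qed.

Lemma dual_abs_le g z : 0 <=v z -> dual_sup g (- g) z <= `|g| * `|z|.
Proof.
move=> z0; rewrite dual_supE// -lerBrDl; apply: rk_lub => // y y0 yz.
rewrite opprK lerBrDl -[(g + g) y]/(g y + g y) -[(- g) z]/(- g z).
rewrite -raddfN -!raddfD (le_trans (ler_norm _))// (le_trans (ler_dual _ _))//.
rewrite ler_wpM2l//; apply: vnorm_le_ge0; apply: vabs_le.
  apply: vle_subr0; rewrite opprD opprK addrA -mulr2n opprD.
  rewrite -[z *+ 2](mulr2n z) addrACA; apply: vaddr_ge0; exact: vsubr_ge0.
apply: vle_subr0; rewrite opprK addrA subrr add0r; exact: vaddr_ge0.
Qed.

Fact dual_norm_mono f g :
  dual_le (dual_sup f (- f)) (dual_sup g (- g)) -> `|f| <= `|g|.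
Proof.
move=> fg; apply: ler_norm_dual => // x.
rewrite (le_trans (dual_le_abs f x))// (le_trans (fg _ (vabs_ge0 x)))//.
by rewrite (le_trans (dual_abs_le g (vabs_ge0 x)))// vnorm_abs.
Qed.

HB.instance Definition _ := isBanachLattice.Build R (dual E)
  dual_le_refl dual_le_anti dual_le_trans dual_sup_ubl dual_sup_ubr
  dual_sup_lub dual_leD2r dual_scale_ge0 dual_norm_mono.

End dual_banach_lattice.

(* R^d is d.-tuple R with the product sigma-algebra of the library, which is the
   Borel sigma-algebra. *)
Section lebesgue_measure_Rd.
Context {R : realType}.
Local Open Scope ereal_scope.

Let tcons d (u : measurableTypeR R * d.-tuple R) : d.+1.-tuple R :=
  [tuple of u.1 :: u.2].

Let measurable_tcons d : measurable_fun [set: _] (@tcons d).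
Proof. by apply: measurable_cons; [exact: measurable_fst|exact: measurable_snd]. Qed.

Definition lebesgue_cons d (mu : {sigma_finite_measure set (d.-tuple R) -> \bar R})
    : set (d.+1.-tuple R) -> \bar R :=
  pushforward (lebesgue_measure \x mu) (@tcons d).

Let lebesgue_cons0 d mu : @lebesgue_cons d mu set0 = 0.
Proof. by rewrite /lebesgue_cons /pushforward preimage_set0 measure0. Qed.

Let lebesgue_cons_ge0 d mu A : 0 <= @lebesgue_cons d mu A.
Proof. by rewrite /lebesgue_cons /pushforward; exact: measure_ge0. Qed.

Let lebesgue_cons_additive d mu : semi_sigma_additive (@lebesgue_cons d mu).
Proof.
move=> F mF tF mUF; rewrite /lebesgue_cons /pushforward preimage_bigcup.
have mpre A : measurable A -> measurable (@tcons d @^-1` A).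
  by move=> mA; rewrite -[X in measurable X]setTI; exact: measurable_tcons.
apply: measure_semi_sigma_additive.
- by move=> n; exact: mpre.
- apply/trivIsetP => /= i j _ _ ij; rewrite -preimage_setI.
  by move/trivIsetP : tF => /(_ _ _ _ _ ij) ->//; rewrite preimage_set0.
- by rewrite -preimage_bigcup; exact: mpre.
Qed.

HB.instance Definition _ d mu := isMeasure.Build _ _ _ (@lebesgue_cons d mu)
  (lebesgue_cons0 mu) (lebesgue_cons_ge0 mu) (@lebesgue_cons_additive d mu).

Fact lebesgue_cons_sigma_finite d
    (mu : {sigma_finite_measure set (d.-tuple R) -> \bar R}) :
  sigma_finite setT (lebesgue_cons mu).
Proof.
have /sigma_finiteP[F [TF ndF Foo]] := sigma_finiteT (@lebesgue_measure R).
have /sigma_finiteP[G [TG ndG Goo]] := sigma_finiteT mu.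
pose u (x : d.+1.-tuple R) : measurableTypeR R * d.-tuple R :=
  (thead x, [tuple of behead x]).
have Ku : cancel (@tcons d) u.
  by move=> [x t]; rewrite /u /tcons/= theadE; congr pair; apply/val_inj.
have measurable_u : measurable_fun [set: _] u.
  by apply/measurable_fun_pairP; split;
    [exact: (@measurable_tnth _ R d.+1 ord0)|exact: (@measurable_behead _ R d)].
exists (fun n => u @^-1` (F n `*` G n)).
  rewrite -preimage_bigcup (_ : \bigcup_n (F n `*` G n) = setT) ?preimage_setT//.
  rewrite -subTset => -[x y] _.
  have [n _ Fnx] : (\bigcup_n F n) x by rewrite -TF.
  have [k _ Gky] : (\bigcup_n G n) y by rewrite -TG.
  exists (maxn n k) => //; split.
  - by move: x Fnx; exact/subsetPset/ndF/leq_maxl.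
  - by move: y Gky; exact/subsetPset/ndG/leq_maxr.
move=> n; have [mF Fn] := Foo n; have [mG Gn] := Goo n; split.
  by rewrite -[X in measurable X]setTI; apply: measurable_u => //; exact: measurableX.
rewrite /lebesgue_cons /pushforward -comp_preimage.
rewrite (_ : u \o _ = id) ?preimage_id; last by rewrite funeqE => x /=; rewrite Ku.
by rewrite product_measure1E// lte_mul_pinfty// ge0_fin_numE.
Qed.

HB.instance Definition _ d (mu : {sigma_finite_measure set (d.-tuple R) -> \bar R}) :=
  Measure_isSigmaFinite.Build _ _ _ (lebesgue_cons mu)
    (lebesgue_cons_sigma_finite mu).

Fixpoint lebesgue_Rd d : {sigma_finite_measure set (d.-tuple R) -> \bar R} :=
  match d with
  | 0%N => \d_([tuple] : 0.-tuple R)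
  | d'.+1 => lebesgue_cons (lebesgue_Rd d')
  end.

End lebesgue_measure_Rd.
Arguments lebesgue_Rd {R} d.

Section bochner.
Context {disp} {T : measurableType disp} {R : realType} {E : normedModType R}.
Variable mu : {measure set T -> \bar R}.
Implicit Types f s : T -> E.

Definition simple_fun s :=
  finite_set (range s) /\ forall y, measurable (s @^-1` [set y]).

Definition simple_integral s : E :=
  \sum_(y \in range s) fine (mu (s @^-1` [set y])) *: y.

(* Pointwise everywhere rather than almost everywhere limits of simple
   functions: every class of the Lebesgue-Bochner space L^p_E(mu) has such a
   representative. *)
Definition strongly_measurable f :=
  exists s_ : nat -> T -> E,
    (forall n, simple_fun (s_ n)) /\ (forall x, s_ n x @[n --> \oo] --> f x).

Definition is_bochner_integral f (I : E) :=
  strongly_measurable f /\ exists s_ : nat -> T -> E,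
    [/\ forall n, simple_fun (s_ n),
        forall n, (mu (s_ n @^-1` [set~ (0%R : E)]) < +oo)%E,
        (\int[mu]_x (`|f x - s_ n x|)%:E)%E @[n --> \oo] --> 0%E &
        simple_integral (s_ n) @[n --> \oo] --> I].

(* 0 if f is not Bochner integrable *)
Definition bochner_integral f : E := xget 0 [set I | is_bochner_integral f I].

Definition bochner_integral_on (A : set T) f : E :=
  bochner_integral (fun x => (\1_A x : R) *: f x).

(* The norm of L^p_E(mu); p = +oo is the essential supremum. *)
Definition bnorm (p : \bar R) f : \bar R := Lnorm mu p (fun x => (`|f x|)%:E).

Definition Lp (p : \bar R) f := strongly_measurable f /\ (bnorm p f < +oo)%E.

(* L^oo_E(A, mu), extended by zero outside A *)
Definition Linfty_on (A : set T) f := Lp +oo%E f /\ forall x, ~ A x -> f x = 0.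

End bochner.

(* The supremum over the unit ball; A need not be linear, only positively
   homogeneous. *)
Definition opnorm disp1 disp2 (T1 : measurableType disp1)
    (T2 : measurableType disp2) (R : realType) (E F : normedModType R)
    (mu : {measure set T1 -> \bar R}) (nu : {measure set T2 -> \bar R})
    (p q : \bar R) (A : (T1 -> E) -> T2 -> F) : \bar R :=
  ereal_sup [set bnorm nu q (A f) |
             f in [set f : T1 -> E | Lp mu p f /\ (bnorm mu p f <= 1)%E]].

(* The sup-norm balls are the open cubes. *)
Definition locally_finite (R : realType) d
    (mu : {measure set (d.-tuple R) -> \bar R}) :=
  forall x : d.-tuple R, exists2 r : R, 0 < r &
    (mu [set y : d.-tuple R | forall i, (`|tnth y i - tnth x i| < r)%R] < +oo)%E.

(* (k, m) encodes the cube 2^k (m + [0, 1)^d).  For d > 0 the encoding is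
   injective. *)
Definition dcube (d : nat) := (int * d.-tuple int)%type.

Definition cube {R : realType} {d} (Q : dcube d) : set (d.-tuple R) :=
  [set x | forall i, (tnth Q.2 i)%:~R * 2 ^ Q.1 <= tnth x i
                     < (tnth Q.2 i + 1)%:~R * 2 ^ Q.1].

Section hardy_littlewood.
Context {R : realType} (d : nat) (E : banachLatticeType R).

(* The lattice supremum of a nonempty finite family; 0 for the empty one. *)
Definition lsup (s : seq E) : E := if s is x :: s' then foldr vsup x s' else 0.

Definition cube_average (f : d.-tuple R -> E) (Q : dcube d) : E :=
  (fine (lebesgue_Rd d (cube Q)))^-1 *:
    bochner_integral_on (lebesgue_Rd d) (cube Q) f.

Definition HLmax (DD : {fset dcube d}) (f : d.-tuple R -> E) (x : d.-tuple R)
    : E :=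
  lsup [seq (\1_(cube Q) x : R) *: cube_average f Q | Q <- DD].

Definition HLnorm (p : R) : \bar R :=
  ereal_sup [set opnorm (lebesgue_Rd d) (lebesgue_Rd d) p%:E p%:E (HLmax DD) |
             DD in [set: {fset dcube d}]].

Definition HL_property := exists2 p : R, 1 < p & (HLnorm p < +oo)%E.

End hardy_littlewood.

Section testing.
Context {R : realType} {d : nat}.
Variables (DD : {fset dcube d}) (sigma omega : {measure set (d.-tuple R) -> \bar R}).
Local Open Scope ereal_scope.

Definition subcube (Q R0 : dcube d) : bool :=
  `[< @cube R d Q `<=` @cube R d R0 >].

Definition Ainf_max (R0 : dcube d) (x : d.-tuple R) : \bar R :=
  \big[maxe/0]_(Q <- DD | subcube Q R0 && (0 < omega (cube Q)))
    (sigma (cube Q) / omega (cube Q) * (\1_(cube Q) x)%:E).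

Definition Ainf_char : \bar R :=
  \big[maxe/0]_(R0 <- DD | 0 < sigma (cube R0))
    ((sigma (cube R0))^-1 * \int[omega]_x Ainf_max R0 x).

Context {C D : banachLatticeType R}.
Variable lam : dcube d -> {linear C -> D}.

Definition T_op (f : d.-tuple R -> C) (x : d.-tuple R) : D :=
  (\sum_(Q <- DD)
     (\1_(cube Q) x : R) *: lam Q (bochner_integral_on sigma (cube Q) f))%R.

Definition T_loc (R0 : dcube d) (f : d.-tuple R -> C) (x : d.-tuple R) : D :=
  (\sum_(Q <- DD | subcube Q R0)
     (\1_(cube Q) x : R) *: lam Q (bochner_integral_on sigma (cube Q) f))%R.

Definition testing_bound (p q' c : R) :=
  forall R0, R0 \in DD ->
  forall (f : d.-tuple R -> C) (g : d.-tuple R -> dual D),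
    Linfty_on sigma (cube R0) f -> Linfty_on omega (cube R0) g ->
    \int[omega]_x (g x (T_loc R0 f x))%:E <=
      c%:E * bnorm sigma +oo f * bnorm omega +oo g *
      sigma (cube R0) `^ p^-1 * omega (cube R0) `^ q'^-1.

(* Negative constants are excluded; they could be admissible only in degenerate
   cases, such as sigma and omega vanishing on all cubes. *)
Definition testing_const (p q' : R) : \bar R :=
  ereal_inf [set c%:E | c in [set c : R | (0 <= c)%R /\ testing_bound p q' c]].

End testing.

(* Main.v *)
Require Import Defs.
From mathcomp Require Import all_boot all_order all_algebra.
From mathcomp Require Import finmap.
From mathcomp Require Import all_classical all_reals all_analysis.
From mathcomp Require Import measurable_realfun ess_sup_inf ring lra.
Import Order.TTheory GRing.Theory Num.Theory.
Import numFieldNormedType.Exports.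
Set Implicit Arguments.
Unset Strict Implicit.
Unset Printing Implicit Defensive.
Local Open Scope classical_set_scope.
Local Open Scope ring_scope.

(** Lower bound.  Pointwise |T_loc f| <= |T (vabs f)|, and the test functions are
    bounded, so Hölder on a single cube turns the testing form into the operator
    norm ([lower_bound]).

    Upper bound.  By duality ([duality]) it suffices to bound

      sum_Q <∫_Q g dω, λ_Q ∫_Q f dσ>

    over the cubes charged by both measures, for f, g >= 0 in the unit balls of
    L^p_C(σ) and L^q'_D*(ω).  Select principal cubes of f: below a principal cube
    F a cube Q becomes principal as soon as the average of |f| exceeds four times
    its value on F, or the lattice supremum of the averages of f over the cubes
    between Q and F exceeds 64 M times the average of |f| on F in norm, M being the
    Hardy-Littlewood constant.  Do the same for g.  Sort the cubes Q by the
    smallest principal cubes F, G of f, g that contain them; F and G are nested.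
    If G is contained in F, then F is determined by G.  The lattice suprema
    sup <f>_Q 1_Q and sup <g>_Q 1_Q over the cubes Q of one group are bounded by
    multiples of the averages of |f| on F and |g| on G by the choice of principal
    cubes, and as test functions on G they dominate f and g in all integrals that
    occur in the group ([test_local]).  So a group costs

      <|f|>_F <|g|>_G σ(G)^(1/p) ω(G)^(1/q').

    Principal cubes are sparse ([sparse]): at least half of each one is not covered
    by smaller ones.  Hence the powers of the averages sum up by Doob's maximal
    inequality ([carleson]), and for fixed F the measures σ(G) add up to at most a
    multiple of [σ]_{A_∞(ω)} σ(F) ([Ainf_sum]).  Since 1/p + 1/q' >= 1, Hölder
    for sums concludes ([half_sum]).  The case of F contained in G is symmetric.

    The Hardy-Littlewood property enters only through sparseness, where it has to
    be moved from the Lebesgue measure to an arbitrary measure ([weak_type]).  Let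
    U(u, v) be the largest probability that u ∨ sup has norm above a level, over
    all finite dyadic martingales in the positive part of the unit ball that start
    at v ([bellman]).  Such a martingale is a function of the first coordinate on
    R^d and its running supremum is a dyadic maximal function, so U(0, v) obeys the
    weak type bound ([bellman_HL]).  Joining two martingales below a common root
    gives concavity of U at midpoints, and as 0 <= U <= 1 this self-improves to all
    weights ([bellman_concave]).  With arbitrary weights, U controls the maximal
    function of a laminar family of sets for every finite measure ([tree_lemma]).

    Infinite factors on the right-hand side are harmless unless another factor
    vanishes; then the testing constant is zero, one of the spaces is trivial or no
    cube is charged by both measures, and the operator vanishes almost everywhere
    ([degenerate_bound]).  The Bochner integral is handled by testing against
    functionals, which the Hahn-Banach theorem supplies. *)

(** * Order and norm in Banach lattices *)

Section lattice.
Context {R : realType} {E : banachLatticeType R}.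
Implicit Types x y z : E.

Lemma vsup_mono x x' y y' : x <=v x' -> y <=v y' -> vsup x y <=v vsup x' y'.
Proof.
by move=> xx yy; apply: vsup_lub; [apply: vle_trans xx (vsup_ubl _ _)|
  apply: vle_trans yy (vsup_ubr _ _)].
Qed.

Lemma vsup_ler x y : x <=v y -> vsup x y = y.
Proof.
move=> xy; apply: vle_anti; last exact: vsup_ubr.
by apply: vsup_lub => //; exact: vle_refl.
Qed.

Lemma vscale_mono (a : R) x y : 0 <= a -> x <=v y -> a *: x <=v a *: y.
Proof.
move=> a0 xy; apply: vle_subr0; rewrite -scalerBr; apply: vscale_ge0 => //.
exact: vsubr_ge0.
Qed.

Lemma vle_abs x : x <=v vabs x. Proof. exact: vsup_ubl. Qed.

Lemma vsum_ge0 (I : Type) (s : seq I) (P : pred I) (F : I -> E) :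
  (forall i, P i -> 0 <=v F i) -> 0 <=v \sum_(i <- s | P i) F i.
Proof.
move=> F0; elim/big_rec : _ => [|i x Pi x0]; first exact: vle_refl.
by apply: vaddr_ge0 => //; exact: F0.
Qed.

Lemma vsum_mono (I : Type) (s : seq I) (P : pred I) (F G : I -> E) :
  (forall i, P i -> F i <=v G i) ->
  \sum_(i <- s | P i) F i <=v \sum_(i <- s | P i) G i.
Proof.
move=> FG; elim/big_rec2 : _ => [|i y x Pi yx]; first exact: vle_refl.
by apply: vleD => //; exact: FG.
Qed.

Lemma vabsD x y : vabs (x + y) <=v vabs x + vabs y.
Proof.
apply: vabs_le; first by apply: vleD; exact: vle_abs.
by rewrite opprD; apply: vleD; exact: vsup_ubr.
Qed.

Lemma vabs_sum (I : Type) (s : seq I) (P : pred I) (F : I -> E) :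
  vabs (\sum_(i <- s | P i) F i) <=v \sum_(i <- s | P i) vabs (F i).
Proof.
elim/big_rec2 : _ => [|i y x Pi yx].
  by rewrite vge0_abs; exact: vle_refl.
apply: vle_trans (vabsD _ _) _; apply: vleD => //; exact: vle_refl.
Qed.

Lemma vabsZ (a : R) x : 0 <= a -> vabs (a *: x) = a *: vabs x.
Proof.
have le (b : R) y : 0 <= b -> vabs (b *: y) <=v b *: vabs y.
  move=> b0; apply: vabs_le; first by apply: vscale_mono => //; exact: vle_abs.
  by rewrite -scalerN; apply: vscale_mono => //; exact: vsup_ubr.
rewrite le_eqVlt => /predU1P[<-|a0].
  by rewrite !scale0r vge0_abs//; exact: vle_refl.
apply: vle_anti; first exact/le/ltW.
have := @le a^-1 (a *: x); rewrite scalerA mulVf ?gt_eqF// scale1r.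
rewrite invr_ge0 (ltW a0) => /(_ isT) /(vscale_mono (ltW a0)).
by rewrite scalerA divff ?gt_eqF// scale1r.
Qed.

Lemma vabs_lip x y : `|vabs x - vabs y| <= `|x - y|.
Proof.
rewrite -(vnorm_abs (x - y)); apply: vnorm_le_ge0.
have le (s t : E) : vabs s - vabs t <=v vabs (s - t).
  apply: vle_subr0; rewrite opprB addrA; apply: vsubr_ge0.
  by have := vabsD (s - t) t; rewrite subrK.
by apply: vabs_le => //; rewrite opprB -(vabsN (x - y)) opprB; exact: le.
Qed.

Lemma vbig_lub (I : eqType) (s : seq I) (P : pred I) (F : I -> E) z : 0 <=v z ->
  (forall i, i \in s -> P i -> F i <=v z) -> \big[vsup/0]_(i <- s | P i) F i <=v z.
Proof.
move=> z0 Fz; rewrite big_seq_cond; elim/big_rec : _ => // i x /andP[si Pi] xz.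
by apply: vsup_lub => //; exact: Fz.
Qed.

Lemma vbig_ge0 (I : eqType) (s : seq I) (P : pred I) (F : I -> E) :
  0 <=v \big[vsup/0]_(i <- s | P i) F i.
Proof.
elim/big_rec : _ => [|i x Pi x0]; first exact: vle_refl.
by apply: vle_trans x0 (vsup_ubr _ _).
Qed.

Lemma vbig_ub (I : eqType) (s : seq I) (P : pred I) (F : I -> E) i :
  i \in s -> P i -> F i <=v \big[vsup/0]_(i <- s | P i) F i.
Proof.
elim: s => // j s IH; rewrite inE big_cons => /orP[/eqP <- Pi|si Pi].
  by rewrite Pi; exact: vsup_ubl.
case: ifP => // _; [apply: vle_trans (IH _ _) (vsup_ubr _ _)|exact: IH] => //.
Qed.

Lemma lsup_ub (I : eqType) (s : seq I) (F : I -> E) i :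
  i \in s -> F i <=v lsup [seq F i | i <- s].
Proof.
case: s => // j s; rewrite /lsup /= inE.
elim: s => [|k s IH] /=; first by rewrite orbF => /eqP->; exact: vle_refl.
rewrite inE => /or3P[/eqP ij|/eqP ->|si].
- by apply: vle_trans (vsup_ubr _ _); apply: IH; rewrite ij eqxx.
- exact: vsup_ubl.
- by apply: vle_trans (vsup_ubr _ _); apply: IH; rewrite si orbT.
Qed.

End lattice.

(** * Positive and norming functionals *)

Section hahn_banach.
Context {R : realType} (E : lmodType R).
Variable p : E -> R.
Hypothesis pD : forall x y, p (x + y) <= p x + p y.
Hypothesis pZ : forall (a : R) x, 0 <= a -> p (a *: x) = a * p x.
Variables (x0 : E) (c0 : R).
Hypothesis c0p : forall t : R, t * c0 <= p (t *: x0).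

(* A linear functional on a subspace is represented by its graph, a set of pairs,
   so that extensions are ordered by inclusion and Zorn's lemma applies to unions. *)
Let seed : set (E * R) := [set xr | exists t : R, xr = (t *: x0, t * c0)].

Let good (G : set (E * R)) := [/\
  forall a xr ys, G xr -> G ys -> G (a *: xr.1 + ys.1, a * xr.2 + ys.2) &
  forall xr, G xr -> xr.2 <= p xr.1].

(* The seed is adjoined because the union of an empty chain is empty. *)
Let goods (G : set (E * R)) := good (seed `|` G).

Let p0 : p 0 = 0.
Proof. by rewrite -[0 in LHS](scale0r 0) pZ// mul0r. Qed.

Let seed_good : good seed.
Proof.
split; last by move=> _ [t ->] /=.
move=> a _ _ [t ->] [s ->]; exists (a * t + s) => /=.
by rewrite scalerDl mulrDl scalerA mulrA.
Qed.

Let maxgood : exists G, [/\ seed `<=` G, good G &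
  forall H, G `<=` H -> good H -> H `<=` G].
Proof.
have [F FP Ftot|G [gG Gmax]] := @Zorn_bigcup _ goods.
  split.
    have key X Y xr ys a : F X -> F Y -> (seed `|` X) xr -> (seed `|` Y) ys ->
        (seed `|` \bigcup_(X in F) X) (a *: xr.1 + ys.1, a * xr.2 + ys.2).
      move=> FX FY Xxr Yys.
      have [Z [FZ XZ YZ]] : exists Z, [/\ F Z, X `<=` Z & Y `<=` Z].
        by have [XY|YX] := Ftot _ _ FX FY; [exists Y; split|exists X; split].
      have [h _] := FP _ FZ.
      have [] := h a xr ys (setUS XZ Xxr) (setUS YZ Yys).
        by left.
      by move=> ?; right; exists Z.
    move=> a xr ys [sxr|[X FX Xxr]] [sys|[Y FY Yys]].
    - by left; apply: (proj1 seed_good).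
    - by apply: (@key Y Y) => //; [left|right].
    - by apply: (@key X X) => //; [right|left].
    - by apply: (@key X Y) => //; right.
  move=> xr [|[X FX Xxr]]; first exact: (proj2 seed_good).
  by have [_] := FP _ FX; apply; right.
exists (seed `|` G); split => //.
move=> H GH gH x Hx; right; apply: contrapT => nGx.
apply: (Gmax H); last first.
  by rewrite /goods (_ : seed `|` H = H)//; apply/setUidPr => ? ?; apply: GH; left.
by split; [move=> ? ?; apply: GH; right|move=> /(_ _ Hx)].
Qed.

Lemma hahn_banach : exists f : E -> R,
  [/\ linear (f : E -> R^o), forall x, f x <= p x & f x0 = c0].
Proof.
have [G [sG [Gl Gp] Gmax]] := maxgood.
have G0 : G (0, 0) by apply: sG; exists 0; rewrite scale0r mul0r.
have GZ a x r : G (x, r) -> G (a *: x, a * r).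
  by move=> /(Gl a) /(_ G0) /=; rewrite !addr0.
have GD x r y s : G (x, r) -> G (y, s) -> G (x + y, r + s).
  by move=> /(Gl 1) /[apply] /=; rewrite scale1r mul1r.
have uniq x r s : G (x, r) -> G (x, s) -> r = s.
  have le r' s' : G (x, r') -> G (x, s') -> r' <= s'.
    move=> h /(GZ (-1)) /(GD _ _ _ _ h) /Gp /=.
    by rewrite scaleN1r subrr p0 mulN1r subr_le0.
  by move=> h1 h2; apply/eqP; rewrite eq_le !le.
have dom x : exists r, G (x, r).
  apply: contrapT => nx.
  (* A value c at x is admissible when it lies between all r - p (y - x) and all
     p (z + x) - s; the supremum of the former does. *)
  pose S := [set s : R | exists y r, G (y, r) /\ s = r - p (y - x)].
  have ub y r z s : G (y, r) -> G (z, s) -> r - p (y - x) <= p (z + x) - s.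
    move=> h1 h2; rewrite lerBlDr addrAC lerBrDr.
    apply: le_trans (Gp _ (GD _ _ _ _ h1 h2)) _ => /=.
    have -> : y + z = (z + x) + (y - x) by rewrite addrCA addrAC !addrA subrK addrC.
    exact: pD.
  pose c := sup S.
  have hS : has_sup S.
    split; first by exists (0 - p (0 - x)), 0, 0.
    by exists (p (0 + x) - 0) => _ [y [r [h ->]]]; exact: ub.
  have c1 y r : G (y, r) -> r - c <= p (y - x).
    move=> h; rewrite lerBlDr -lerBlDl; apply: sup_upper_bound => //.
    by exists y, r.
  have c2 y r : G (y, r) -> r + c <= p (y + x).
    move=> h; rewrite -lerBrDl; apply: ge_sup; first by case: hS.
    by move=> _ [z [s [h' ->]]]; exact: ub.
  pose H := [set ys | exists z s (t : R), G (z, s) /\ ys = (z + t *: x, s + t * c)].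
  have GH : G `<=` H.
    by move=> [y s] h; exists y, s, 0; rewrite scale0r mul0r !addr0.
  apply: nx; exists c; apply: (Gmax H) => //; last first.
    by exists 0, 0, 1; rewrite scale1r mul1r !add0r.
  split.
    move=> a _ _ [z [s [t [h ->]]]] [z' [s' [t' [h' ->]]]] /=.
    exists (a *: z + z'), (a * s + s'), (a * t + t'); split.
      by have := Gl a _ _ h h'.
    congr pair; first by rewrite scalerDr scalerDl scalerA addrACA.
    by rewrite mulrDr mulrDl mulrA addrACA.
  move=> _ [z [s [t [h ->]]]] /=.
  have [t0|t0|->] := ltgtP t 0; last by rewrite scale0r mul0r !addr0; exact: Gp h.
    have nt : 0 < - t by rewrite oppr_gt0.
    have -> : z + t *: x = (- t) *: ((- t)^-1 *: z - x).
      by rewrite scalerBr scalerA divff ?gt_eqF// scale1r scaleNr opprK.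
    rewrite pZ; last exact: ltW.
    have /(ler_wpM2l (ltW nt)) := c1 _ _ (GZ (- t)^-1 _ _ h).
    apply: le_trans.
    by rewrite mulrBr mulrA divff ?gt_eqF// mul1r mulNr opprK.
  have -> : z + t *: x = t *: (t^-1 *: z + x).
    by rewrite scalerDr scalerA divff ?gt_eqF// scale1r.
  rewrite pZ; last exact: ltW.
  have /(ler_wpM2l (ltW t0)) := c2 _ _ (GZ t^-1 _ _ h).
  apply: le_trans.
  by rewrite mulrDr mulrA divff ?gt_eqF// mul1r.
have [f fG] := choice dom.
exists f; split.
- move=> a x y; apply: (uniq _ _ _ (fG _)).
  exact: (Gl a _ _ (fG x) (fG y)).
- by move=> x; exact: (Gp _ (fG x)).
- apply: (uniq _ _ _ (fG _)); apply: sG; exists 1.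
  by rewrite scale1r mul1r.
Qed.

End hahn_banach.

Section functionals.
Context {R : realType}.

(** Hahn-Banach starting from the multiples of [x].  Both the norm and the norm of
    the positive part are functions [p] of this kind. *)
Lemma sublinear_functional {E : normedModType R} (p : E -> R) (x : E) :
  (forall y z, p (y + z) <= p y + p z) ->
  (forall (a : R) y, 0 <= a -> p (a *: y) = a * p y) ->
  (forall y, 0 <= p y <= `|y|) ->
  exists f : dual E, [/\ forall y, f y <= p y, `|f| <= 1 & f x = p x].
Proof.
move=> pD pZ pn; have [|f [fl fp fx]] := hahn_banach pD pZ (x0 := x) (c0 := p x).
  move=> t; have [t0|t0] := leP 0 t; first by rewrite pZ.
  have /andP[p0 _] := pn x; have /andP[pt _] := pn (t *: x).
  by apply: le_trans pt; rewrite mulr_le0_ge0// ltW.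
have fN y : f (- y) = - f y.
  have f00 : f 0 = 0.
    have := fl (-1) 0 0; rewrite scaler0 addr0 => ->.
    by rewrite [(-1) *: _]mulN1r addNr.
  by have := fl (-1) y 0; rewrite scaleN1r addr0 f00 addr0 => ->; exact: mulN1r.
have fb y : `|f y| <= 1 * `|y|.
  have le z : f z <= `|z| by apply: le_trans (fp z) _; case/andP: (pn z).
  by rewrite mul1r ler_norml le andbT lerNl -fN -normrN le.
exists (Dual (@linear_bounded_functional _ _ f 1 fl fb)); split => //.
exact: ler_norm_dual.
Qed.

Section order.
Context {E : banachLatticeType R}.
Implicit Types (x y : E).

Let q x := `|vpos x|.

Let qD x y : q (x + y) <= q x + q y.
Proof.
apply: le_trans (ler_normD _ _); apply: vnorm_mono; first exact: vpos_ge0.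
apply: vsup_lub; last by apply: vaddr_ge0; exact: vpos_ge0.
by apply: vleD; exact: vsup_ubl.
Qed.

Lemma vposZ (a : R) x : 0 <= a -> vpos (a *: x) = a *: vpos x.
Proof.
have le (b : R) y : 0 <= b -> vpos (b *: y) <=v b *: vpos y.
  move=> b0; apply: vsup_lub; first by apply: vscale_mono => //; exact: vsup_ubl.
  by apply: vscale_ge0 => //; exact: vpos_ge0.
rewrite le_eqVlt => /predU1P[<-|a0].
  by rewrite !scale0r; apply: vsup_ler; exact: vle_refl.
apply: vle_anti; first exact/le/ltW.
have := @le a^-1 (a *: x); rewrite scalerA mulVf ?gt_eqF// scale1r.
rewrite invr_ge0 (ltW a0) => /(_ isT) /(vscale_mono (ltW a0)).
by rewrite scalerA divff ?gt_eqF// scale1r.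
Qed.

Let qZ (a : R) x : 0 <= a -> q (a *: x) = a * q x.
Proof. by move=> a0; rewrite /q vposZ// normrZ ger0_norm. Qed.

Let q0 x : 0 <=v x -> q (- x) = 0.
Proof.
move=> x0; rewrite /q /vpos vsup_ler ?normr0//.
by rewrite -[X in _ <=v X]oppr0; exact: vleN.
Qed.

(** The norm of the positive part is sublinear and vanishes on the negative cone, so
    every functional that it dominates is positive. *)
Lemma positive_functional x : exists f : dual E,
  [/\ 0 <=v f, `|f| <= 1 & f x = `|vpos x|].
Proof.
have [|f [fq f1 fx]] := @sublinear_functional E q x qD qZ.
  by move=> y; rewrite normr_ge0 vnorm_pos.
exists f; split => // y y0.
by rewrite -[leRHS]opprK lerNr oppr0 -raddfN -(q0 y0); exact: fq.
Qed.

Lemma norming_functional x : exists f : dual E, `|f| <= 1 /\ f x = `|x|.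
Proof.
have [||//|f [_ f1 fx]] := @sublinear_functional E (fun x => `|x|) x.
- exact: ler_normD.
- by move=> a y a0; rewrite normrZ ger0_norm.
- by move=> y; rewrite normr_ge0 lexx.
by exists f.
Qed.

Lemma dual_eq x y : (forall f : dual E, f x = f y) -> x = y.
Proof.
move=> fxy; apply/eqP; rewrite -subr_eq0 -normr_eq0.
have [f [_ <-]] := norming_functional (x - y).
by rewrite raddfB /= fxy subrr.
Qed.

(** The functional that norms the positive part of [x - y] detects a failure of the
    order. *)
Lemma dual_vle x y : (forall f : dual E, 0 <=v f -> f x <= f y) -> x <=v y.
Proof.
move=> fxy; apply: vle_subr0.
have [f [f0 _ fx]] := positive_functional (x - y).
have : f (x - y) <= 0 by rewrite raddfB /= subr_le0 fxy.
rewrite fx normr_le0 => /eqP p0.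
have -> : y - x = vpos (y - x); last exact: vpos_ge0.
by rewrite -[LHS]vposBN opprB p0 subr0.
Qed.

Lemma dual_norm_bound x (c : R) :
  (forall f : dual E, `|f| <= 1 -> f x <= c) -> `|x| <= c.
Proof. by move=> fc; have [f [f1 <-]] := norming_functional x; exact: fc. Qed.

Lemma dual_ge0 (f : dual E) x : 0 <=v f -> 0 <=v x -> 0 <= f x.
Proof. by move=> f0 x0; exact: f0. Qed.

Lemma dual_mono (f g : dual E) x y : 0 <=v f -> f <=v g -> 0 <=v x -> x <=v y ->
  f x <= g y.
Proof.
move=> f0 fg x0 xy; apply: (@le_trans _ _ (f y)).
  by rewrite -subr_ge0 -raddfB; apply: f0; exact: vsubr_ge0.
by apply: fg; exact: vle_trans x0 xy.
Qed.

End order.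

End functionals.

(** * Simple and strongly measurable functions *)

Section simple.
Context {disp} {T : measurableType disp} {R : realType}.

Lemma simple_preimage {E : normedModType R} (s : T -> E) (B : set E) :
  simple_fun s -> measurable (s @^-1` B).
Proof.
move=> [fs ms].
have -> : s @^-1` B = \bigcup_(y in range s `&` B) s @^-1` [set y].
  by apply/seteqP; split => [x Bx|x [y [_ By] /= ->]//]; exists (s x) => //; split.
by apply: fin_bigcup_measurable => //; exact: finite_setIl.
Qed.

Lemma simple_fun_comp {E F : normedModType R} (h : E -> F) (s : T -> E) :
  simple_fun s -> simple_fun (h \o s).
Proof.
move=> ss; split.
  have -> : range (h \o s) = h @` range s by rewrite image_comp.
  by apply: finite_image; exact: ss.1.
by move=> y; rewrite comp_preimage; exact: simple_preimage.
Qed.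

Lemma simple_fun_comp2 {E F G : normedModType R} (h : E -> F -> G) (s : T -> E)
  (t : T -> F) : simple_fun s -> simple_fun t ->
  simple_fun (fun x => h (s x) (t x)).
Proof.
move=> ss st; split.
  apply: (@sub_finite_set _ _ [set h u.1 u.2 | u in range s `*` range t]).
    by move=> _ [x _ <-]; exists (s x, t x) => //; split; exists x.
  by apply: finite_image; apply: finite_setX; [exact: ss.1|exact: st.1].
move=> y.
have -> : (fun x => h (s x) (t x)) @^-1` [set y] =
    \bigcup_(z in range s) (s @^-1` [set z] `&` t @^-1` (h z @^-1` [set y])).
  apply/seteqP; split => [x hx|x [z _ [<-]]//].
  by exists (s x) => //; split.
apply: fin_bigcup_measurable; first exact: ss.1.
by move=> z _; apply: measurableI; [exact: ss.2|exact: simple_preimage].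
Qed.

Lemma simple_fun_cst {E : normedModType R} (c : E) : simple_fun (fun _ : T => c).
Proof.
split; first by apply: (@sub_finite_set _ _ [set c]) => // _ [x _ <-].
move=> y; have [->|cy] := eqVneq c y.
  by rewrite (_ : _ @^-1` _ = setT)//; apply/seteqP; split.
rewrite (_ : _ @^-1` _ = set0)//; apply/seteqP; split=> // x /= cy'.
by move: cy; rewrite cy' eqxx.
Qed.

Lemma simple_fun_indic (A : set T) : measurable A ->
  simple_fun (\1_A : T -> R^o).
Proof.
move=> mA; split.
  apply: (@sub_finite_set _ _ [set 0; 1]) => // _ [x _ <-].
  by rewrite indicE; case: (x \in A) => /=; [right|left].
by move=> y; rewrite -[X in measurable X]setTI; exact: measurable_indic.
Qed.

Lemma simple_fun_restr {E : normedModType R} (A : set T) (s : T -> E) :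
  measurable A -> simple_fun s -> simple_fun (fun x => (\1_A x : R) *: s x).
Proof.
move=> mA ss.
exact: (@simple_fun_comp2 R^o E E (fun a v => a *: v) _ _ (simple_fun_indic mA)).
Qed.

Lemma simple_fun_big {E : normedModType R} (op : E -> E -> E) (idx : E) (I : Type)
  (r : seq I) (s : I -> T -> E) : (forall i, simple_fun (s i)) ->
  simple_fun (fun x => \big[op/idx]_(i <- r) s i x).
Proof.
move=> ss; elim: r => [|j r IH] //=.
  by under eq_fun do rewrite big_nil; exact: simple_fun_cst.
under eq_fun do rewrite big_cons; exact: (@simple_fun_comp2 E E E op).
Qed.

Lemma simple_fun_sum {E : normedModType R} (I : Type) (r : seq I) (P : pred I)
  (s : I -> T -> E) : (forall i, simple_fun (s i)) ->
  simple_fun (fun x => \sum_(i <- r | P i) s i x).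
Proof. by move=> ss; under eq_fun do rewrite -big_filter; exact: simple_fun_big. Qed.

Lemma simple_fun_bounded {E : normedModType R} (s : T -> E) : simple_fun s ->
  exists2 M : R, 0 < M & forall x, `|s x| <= M.
Proof.
move=> [fs _]; pose M := \sum_(y <- fset_set (range s)) `|y|.
exists (M + 1); first by rewrite ltr_wpDl// sumr_ge0.
move=> x; rewrite (@le_trans _ _ M)// ?lerDl// /M.
have xs : s x \in fset_set (range s) by rewrite in_fset_set// inE; exists x.
by rewrite (big_rem (s x))//= lerDl sumr_ge0.
Qed.

Lemma measurable_simple {E : normedModType R} (s : T -> E) (h : E -> R) :
  simple_fun s -> measurable_fun setT (h \o s).
Proof. by move=> ss _ B mB; rewrite setTI comp_preimage; exact: simple_preimage. Qed.

End simple.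

Section strongly_measurable.
Context {disp} {T : measurableType disp} {R : realType}.

Lemma simple_smeas {E : normedModType R} (s : T -> E) :
  simple_fun s -> strongly_measurable s.
Proof. by move=> ss; exists (fun=> s); split => // x; exact: cvg_cst. Qed.

Lemma smeas_comp {E F : normedModType R} (h : E -> F) (f : T -> E) :
  continuous h -> strongly_measurable f -> strongly_measurable (h \o f).
Proof.
move=> ch [s [ss sf]]; exists (fun n => h \o s n); split.
  by move=> n; exact: simple_fun_comp.
by move=> x; apply: (@continuous_cvg _ _ _ _ _ (fun n => s n x) h (f x)) => //; exact: ch.
Qed.

Lemma smeas_restr {E : normedModType R} (A : set T) (f : T -> E) : measurable A ->
  strongly_measurable f -> strongly_measurable (fun x => (\1_A x : R) *: f x).
Proof.
move=> mA [s [ss sf]]; exists (fun n x => (\1_A x : R) *: s n x); split.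
  by move=> n; exact: simple_fun_restr.
by move=> x; apply: cvgZl_tmp; exact: sf.
Qed.

Lemma smeasB {E : normedModType R} (f g : T -> E) :
  strongly_measurable f -> strongly_measurable g ->
  strongly_measurable (fun x => f x - g x).
Proof.
move=> [s [ss sf]] [t [st tg]]; exists (fun n x => s n x - t n x); split.
  by move=> n; exact: (@simple_fun_comp2 _ _ _ E E E (fun a v => a - v)).
by move=> x; apply: cvgB; [exact: sf|exact: tg].
Qed.

Lemma smeasZ {E : normedModType R} (a : R) (f : T -> E) :
  strongly_measurable f -> strongly_measurable (fun x => a *: f x).
Proof. by apply: (smeas_comp (h := fun v => a *: v)) => v; apply: cvgZl_tmp; exact: cvg_id. Qed.

Lemma measurable_smeas {E : normedModType R} (f : T -> E) (h : E -> R^o) :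
  continuous h -> strongly_measurable f -> measurable_fun setT (fun x => h (f x) : R).
Proof.
move=> ch [s [ss sf]]; apply/measurable_EFinP.
apply: (emeasurable_fun_cvg (fun n x => (h (s n x))%:E)) => [n|x _].
  by apply/measurable_EFinP; exact: (@measurable_simple _ _ _ _ (s n) h).
apply: cvg_EFin; first by near=> n.
by apply: (@continuous_cvg _ _ _ _ _ (fun n => s n x) h (f x)) => //; exact: ch.
Unshelve. all: by end_near. Qed.

Lemma measurable_norm_smeas {E : normedModType R} (f : T -> E) :
  strongly_measurable f -> measurable_fun setT (fun x => `|f x|).
Proof. by apply: measurable_smeas => x; exact: norm_continuous. Qed.

End strongly_measurable.

(** * The Bochner integral *)

Section bochner_theory.
Context {disp} {T : measurableType disp} {R : realType} {E : banachLatticeType R}.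
Variable mu : {measure set T -> \bar R}.
Implicit Types (f s : T -> E) (phi : dual E).

Let mphi f phi : strongly_measurable f -> measurable_fun setT (fun x => phi (f x) : R).
Proof. by apply: measurable_smeas => x; exact: dual_continuous. Qed.

Lemma integrable_dual f phi A : measurable A -> strongly_measurable f ->
  (\int[mu]_(x in A) `|f x|%:E < +oo)%E ->
  mu.-integrable A (EFin \o (fun x => phi (f x) : R)).
Proof.
move=> mA sf foo; apply: (@le_integrable _ _ _ mu A mA _
  (fun x => (`|phi| * `|f x|)%:E)).
- by apply/measurable_EFinP; apply: measurable_funTS; exact: mphi.
- move=> x _; rewrite /= lee_fin (ger0_norm (mulr_ge0 _ _))//; exact: ler_dual.
under eq_fun do rewrite EFinM; apply: integrableZl => //.
apply/integrableP; split.
  by apply/measurable_EFinP; apply: measurable_funTS; exact: measurable_norm_smeas.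
by under eq_integral do rewrite /= normr_id.
Qed.

Lemma integrable_norm_simple s : simple_fun s ->
  (mu (s @^-1` [set~ 0%R]) < +oo)%E ->
  mu.-integrable setT (fun x => `|s x|%:E).
Proof.
move=> ss soo; have [M M0 sM] := simple_fun_bounded ss.
have ms : measurable (s @^-1` [set~ 0%R]) by exact: simple_preimage.
apply: (@le_integrable _ _ _ mu _ measurableT _
    (fun x => (M * \1_(s @^-1` [set~ 0%R]) x)%:E)).
- by apply/measurable_EFinP; exact: (@measurable_simple _ _ _ _ s (fun v => `|v|)).
- move=> x _; rewrite /= lee_fin normr_id ger0_norm; last exact: mulr_ge0 (ltW M0) _.
  rewrite indicE; case: (boolP (x \in _)) => [_|]; first by rewrite mulr1.
  by rewrite notin_setE /= => /contrapT ->; rewrite normr0 mulr0.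
under eq_fun do rewrite EFinM; apply: integrableZl => //.
apply/integrableP; split; first by apply/measurable_EFinP.
under eq_integral do rewrite gee0_abs ?lee_fin//.
by rewrite integral_indic// setIT.
Qed.

Lemma dual_simple_integral s phi : simple_fun s ->
  (mu (s @^-1` [set~ 0%R]) < +oo)%E ->
  phi (simple_integral mu s) = \int[mu]_x phi (s x).
Proof.
move=> ss soo; have [fs ms] := ss.
rewrite /simple_integral fsbig_finite// raddf_sum /=.
have fin y : y != 0 -> (mu (s @^-1` [set y]) < +oo)%E.
  move=> y0; apply: le_lt_trans soo; apply: le_measure; rewrite ?inE.
  - exact: ms.
  - exact: simple_preimage.
  - by move=> x /= ->; exact/eqP.
pose F y x := (phi y * \1_(s @^-1` [set y]) x)%:E.
have Fi y : mu.-integrable setT (F y).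
  rewrite /F; have [->|y0] := eqVneq y 0.
    rewrite linear0; under eq_fun do rewrite mul0r; exact: integrable0.
  under eq_fun do rewrite EFinM; apply: integrableZl => //.
  apply/integrableP; split.
    by apply/measurable_EFinP; exact: measurable_indic.
  under eq_integral do rewrite gee0_abs ?lee_fin//.
  by rewrite integral_indic// setIT; exact: fin.
have -> : \int[mu]_x phi (s x) =
    fine (\int[mu]_x \sum_(y <- fset_set (range s)) F y x)%E.
  congr fine; apply: eq_integral => x _.
  have xs : s x \in fset_set (range s) by rewrite in_fset_set// inE; exists x.
  rewrite (big_rem (s x))//= big1_seq ?adde0.
    by rewrite /F indicE mem_set// mulr1.
  move=> y /=; rewrite (mem_rem_uniq _ (fset_uniq _)) inE => /andP[yx _].
  rewrite /F indicE memNset ?mulr0// => /= e; by rewrite e eqxx in yx.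
rewrite integral_sum// -sum_fine; last by move=> y _; exact: integrable_fin_num.
apply: eq_bigr => y _; rewrite linearZ /= /F.
have [->|y0] := eqVneq y 0.
  rewrite linear0 scaler0; under eq_integral do rewrite mul0r.
  by rewrite integral0.
under eq_integral do rewrite EFinM.
rewrite integralZl//; last first.
  apply/integrableP; split.
    by apply/measurable_EFinP; exact: measurable_indic.
  under eq_integral do rewrite gee0_abs ?lee_fin//.
  by rewrite integral_indic// setIT; exact: fin.
rewrite integral_indic// setIT fineM//; last by rewrite ge0_fin_numE// fin.
by rewrite mulrC.
Qed.

Lemma is_bochner_finite f I : is_bochner_integral mu f I ->
  (\int[mu]_x `|f x|%:E < +oo)%E.
Proof.
move=> [sf [s [ss soo sf0 _]]].
have [n Hn] : exists n, (\int[mu]_x `|f x - s n x|%:E)%E \is a fin_num.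
  move/fine_cvgP : sf0 => [+ _].
  by move=> [N _ H]; exists N; exact: H N (leqnn _).
have mB : measurable_fun setT (fun x => `|f x - s n x|%:E).
  by apply/measurable_EFinP/measurable_norm_smeas/smeasB => //; exact: simple_smeas.
have si := integrable_norm_simple (ss n) (soo n).
apply: (@le_lt_trans _ _ (\int[mu]_x (`|f x - s n x|%:E + `|s n x|%:E))%E).
  apply: ge0_le_integral => //.
  - by apply/measurable_EFinP; exact: measurable_norm_smeas.
  - by apply: emeasurable_funD => //; exact: measurable_int si.
  - by move=> x _; rewrite -EFinD lee_fin -{1}(subrK (s n x) (f x)) ler_normD.
rewrite ge0_integralD//; last exact: measurable_int si.
by rewrite lte_add_pinfty//; [rewrite ltey_eq Hn|exact: integrable_lty].
Qed.

Lemma is_bochner_dual f I phi : is_bochner_integral mu f I ->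
  phi I = \int[mu]_x phi (f x).
Proof.
move=> fI; have foo := is_bochner_finite fI.
move: fI => [sf [s [ss soo sf0 sI]]].
have h1 : phi (simple_integral mu (s n)) @[n --> \oo] --> phi I.
  by apply: (@continuous_cvg _ _ _ _ _ (fun n => simple_integral mu (s n)) phi I) => //;
    exact: dual_continuous.
suff h2 : (phi (simple_integral mu (s n)) : R^o) @[n --> \oo] --> (\int[mu]_x phi (f x) : R^o).
  by rewrite -(cvg_lim (@Rhausdorff R) h1) (cvg_lim (@Rhausdorff R) h2).
have nB n : measurable_fun setT (fun x => `|f x - s n x|).
  by apply: measurable_norm_smeas; apply: smeasB => //; exact: simple_smeas.
have si n := integrable_norm_simple (ss n) (soo n).
have pi n : mu.-integrable setT (EFin \o (fun x => phi (s n x) : R)).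
  by apply: integrable_dual => //; [exact: simple_smeas|exact: integrable_lty].
have fi : mu.-integrable setT (EFin \o (fun x => phi (f x) : R)).
  exact: integrable_dual.
move/fine_cvgP : sf0 => [fin0 sf0].
have h3 : (`|phi| * fine (\int[mu]_x `|f x - s n x|%:E)%E) @[n --> \oo] --> (0 : R).
  by rewrite -[X in _ --> X](mulr0 `|phi|); apply: cvgMl_tmp.
apply/cvgrPdist_le => e e0.
move/cvgrPdist_le : h3 => /(_ _ e0); apply: filterS2 fin0 => n fn.
rewrite sub0r normrN => h; rewrite dual_simple_integral//.
rewrite -RintegralB//; apply: le_trans (le_normr_Rintegral _ _) _ => //.
  by apply: (integrableB measurableT fi (pi n)).
rewrite (le_trans _ (le_trans (ler_norm _) h))//.
have fni : mu.-integrable setT (EFin \o (fun x => `|f x - s n x|)).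
  apply/integrableP; split; first exact/measurable_EFinP.
  by under eq_integral do rewrite /= normr_id; rewrite ltey_eq fn.
rewrite -RintegralZl//; apply: le_Rintegral => //.
- apply: integrable_norm; exact: (integrableB measurableT fi (pi n)).
- exact: (integrableZl measurableT `|phi| fni).
- move=> x _; rewrite -raddfB; exact: ler_dual.
Qed.

(** Cut the approximating simple functions off where their norm exceeds twice that
    of [f].  They still converge, now dominatedly, and their integrals form a
    Cauchy sequence by testing against functionals. *)
Lemma bochner_exists f : strongly_measurable f ->
  (\int[mu]_x `|f x|%:E < +oo)%E -> exists I, is_bochner_integral mu f I.
Proof.
move=> sf foo; have [s [ss sf0]] := sf.
pose A n := [set x | `|s n x| <= 2 * `|f x|].
have mA n : measurable (A n).
  have := @measurable_lee _ T R setT measurableT (fun x => (`|s n x|)%:E)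
    (fun x => (2 * `|f x|)%:E); rewrite setTI; apply.
    by apply/measurable_EFinP/measurable_norm_smeas; exact: simple_smeas.
  by apply/measurable_EFinP/measurable_funM => //; exact: measurable_norm_smeas.
pose t n x := (\1_(A n) x : R) *: s n x.
have st n : simple_fun (t n) by exact: simple_fun_restr.
have tle n x : `|t n x| <= 2 * `|f x|.
  rewrite /t indicE; case: (boolP (x \in A n)); first by rewrite inE scale1r.
  by rewrite scale0r normr0 mulr_ge0.
have tf x : t n x @[n --> \oo] --> f x.
  have [fx0|fx0] := eqVneq (f x) 0.
    rewrite fx0 (_ : (fun n => t n x) = cst 0); first exact: cvg_cst.
    apply/funext => n /=; apply/eqP; rewrite -normr_le0 (le_trans (tle n x))//.
    by rewrite fx0 normr0 mulr0.
  apply: cvg_trans (sf0 x); apply: near_eq_cvg.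
  have nf : 0 < `|f x| by rewrite normr_gt0.
  have /cvgrPdist_lt/(_ _ nf) := sf0 x; apply: filterS => n h.
  rewrite /t indicE mem_set ?scale1r// /A /=.
  rewrite -(subrK (f x) (s n x)) (le_trans (ler_normD _ _))// distrC.
  by rewrite mulr_natl mulr2n lerD2r ltW.
have mf : measurable_fun setT (fun x => `|f x|) by exact: measurable_norm_smeas.
have fi : mu.-integrable setT (EFin \o (fun x => `|f x|)).
  apply/integrableP; split; first exact/measurable_EFinP.
  by under eq_integral do rewrite /= normr_id.
have too n : (mu (t n @^-1` [set~ 0%R]) < +oo)%E.
  (* The nonzero values of a simple function are bounded away from 0, so Chebyshev
     bounds the measure of the support. *)
  have [m m0 mt] : exists2 m : R, 0 < m & forall x, t n x != 0 -> m <= `|t n x|.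
    have [fr _] := st n.
    have : forall r : seq E, exists2 m : R, 0 < m & forall y, y \in r ->
        y != 0 -> m <= `|y|.
      elim => [|y r [m m0 IH]].
        by exists 1.
      have [->|y0] := eqVneq y 0.
        by exists m => // z; rewrite inE => /predU1P[->|zr]; [rewrite eqxx|exact: IH].
      exists (Num.min m `|y|); first by rewrite lt_min m0 normr_gt0.
      move=> z; rewrite inE ge_min => /predU1P[->|zr z0]; first by rewrite lexx orbT.
      by rewrite IH.
    move=> /(_ (fset_set (range (t n)))) [m m0 mr]; exists m => // x; apply: mr.
    by rewrite in_fset_set// inE; exists x.
  have mt0 : measurable (t n @^-1` [set~ 0%R]) by exact: simple_preimage.
  rewrite -(setIT (t n @^-1` [set~ 0%R])) -integral_indic//.
  apply: (@le_lt_trans _ _ (\int[mu]_x (2 / m * `|f x|)%:E)%E).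
    apply: ge0_le_integral => //.
    - by apply/measurable_EFinP; exact: measurable_indic.
    - by apply/measurable_EFinP; exact: measurable_funM.
    - move=> x _; rewrite lee_fin indicE; case: (boolP (x \in _)) => [|_]; last first.
        by rewrite !mulr_ge0// invr_ge0 ltW.
      rewrite inE /= => /eqP /mt h; rewrite mulrAC ler_pdivlMr// mul1r.
      exact: le_trans h (tle n x).
  under eq_integral do rewrite EFinM.
  rewrite integralZl//; apply: lte_mul_pinfty => //.
  by rewrite lee_fin divr_ge0// ltW.
have [] := @dominated_convergence _ T R mu setT measurableT
  (fun n x => (`|f x - t n x|)%:E) (cst 0%E) (fun x => (3 * `|f x|)%:E).
- move=> n; apply/measurable_EFinP/measurable_norm_smeas/smeasB => //.
  exact: simple_smeas.
- by [].
- apply: aeW => x _; apply: cvg_EFin; first by near=> n.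
  rewrite -(normr0 E) -(subrr (f x)).
  by apply: cvg_norm; apply: cvgB => //; exact: cvg_cst.
- by under eq_fun do rewrite EFinM; apply: integrableZl.
- apply: aeW => x n _; rewrite /= lee_fin normr_id.
  rewrite (le_trans (ler_normB _ _))// mulrS mulrDl mul1r lerD2l//.
move=> _ _ cv0.
have {}cv0 : (\int[mu]_x (`|f x - t n x|)%:E)%E @[n --> \oo] --> 0%E.
  by move: cv0; rewrite integral0.
have ti n : mu.-integrable setT (fun x => (`|t n x|)%:E) by exact: integrable_norm_simple.
suff /cvg_ex[I SI] : cvg (simple_integral mu (t n) @[n --> \oo]).
  by exists I; split => //; exists t; split.
have fti n : mu.-integrable setT (EFin \o (fun x => `|f x - t n x|)).
  have h := integrableD measurableT fi (ti n).
  apply: le_integrable h => //.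
    apply/measurable_EFinP/measurable_norm_smeas/smeasB => //; exact: simple_smeas.
  move=> x _; rewrite /= lee_fin normr_id ger0_norm ?addr_ge0//.
  by rewrite (le_trans (ler_normB _ _)).
have SIle n m : `|simple_integral mu (t n) - simple_integral mu (t m)| <=
    \int[mu]_x `|f x - t n x| + \int[mu]_x `|f x - t m x|.
  apply: dual_norm_bound => phi phi1.
  have pi k : mu.-integrable setT (EFin \o (fun x => phi (t k x) : R)).
    by apply: integrable_dual => //; [exact: simple_smeas|exact: integrable_lty].
  rewrite raddfB /= !dual_simple_integral// -RintegralB// -RintegralD//.
  apply: le_Rintegral => //.
  - exact: (integrableB measurableT (pi n) (pi m)).
  - exact: (integrableD measurableT (fti n) (fti m)).
  - move=> x _; rewrite -raddfB (le_trans (ler_norm _))// (le_trans (ler_dual _ _))//.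
    rewrite -[leRHS]mul1r ler_pM//.
    have -> : t n x - t m x = (f x - t m x) - (f x - t n x).
      by rewrite opprB [RHS]addrC addrA subrK.
    by rewrite (le_trans (ler_normB _ _))// addrC.
apply: cauchy_cvg; apply/cauchy_ballP => e e0.
have e2 : 0 < e / 2 by rewrite divr_gt0.
move/fine_cvgP : cv0 => [_ /cvgrPdist_lt/(_ _ e2)] [N _ HN].
have {}HN n : (N <= n)%N -> \int[mu]_x `|f x - t n x| < e / 2.
  by move=> /HN /=; rewrite sub0r normrN; apply: le_lt_trans; exact: ler_norm.
rewrite near_map2; exists ([set n | (N <= n)%N], [set n | (N <= n)%N]).
  by split; exists N.
move=> [n m] [/= Nn Nm]; rewrite -ball_normE /=.
rewrite (le_lt_trans (SIle n m))// [ltRHS](splitr e) ltrD//; exact: HN.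
Unshelve. all: by end_near. Qed.

End bochner_theory.

Section bochner_on.
Context {disp} {T : measurableType disp} {R : realType} {E : banachLatticeType R}.
Variable mu : {measure set T -> \bar R}.
Implicit Types (f g : T -> E) (phi : dual E) (A B : set T).

(** Bochner integrability on [A]; the restriction to [A] is kept in the domain of
    the integral, so that one function serves for all cubes. *)
Definition bint A f :=
  strongly_measurable f /\ (\int[mu]_(x in A) `|f x|%:E < +oo)%E.

Lemma bint_dual A f phi : measurable A -> bint A f ->
  mu.-integrable A (EFin \o (fun x => phi (f x) : R)).
Proof. by move=> mA [sf foo]; exact: integrable_dual. Qed.

Lemma bint_norm A f : measurable A -> bint A f ->
  mu.-integrable A (EFin \o (fun x => `|f x|)).
Proof.
move=> mA [sf foo]; apply/integrableP; split.
  by apply/measurable_EFinP/measurable_funTS; exact: measurable_norm_smeas.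
by under eq_integral do rewrite /= normr_id.
Qed.

Lemma bint_sub A B f : measurable A -> measurable B -> A `<=` B -> bint B f ->
  bint A f.
Proof.
move=> mA mB AB [sf foo]; split => //; apply: le_lt_trans foo.
apply: ge0_subset_integral => //.
by apply/measurable_EFinP/measurable_funTS; exact: measurable_norm_smeas.
Qed.

(** This reduces all further properties of the integral to the scalar case, since
    functionals separate points, detect the order and compute the norm. *)
Lemma bochner_dual A f phi : measurable A -> bint A f ->
  phi (bochner_integral_on mu A f) = \int[mu]_(x in A) phi (f x).
Proof.
move=> mA [sf foo].
have [|I hI] := @bochner_exists _ _ _ _ mu _ (smeas_restr mA sf).
  move: foo; rewrite [X in (X < _)%E -> _]integral_mkcond.
  apply: le_lt_trans; rewrite le_eqVlt; apply/orP; left; apply/eqP.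
  apply: eq_integral => x _; rewrite patchE indicE.
  by case: (x \in A); rewrite ?scale1r ?scale0r ?normr0.
have := @xgetPex _ 0 [set I | is_bochner_integral mu (fun x => (\1_A x : R) *: f x) I].
move=> /(_ (ex_intro _ I hI)) /(is_bochner_dual phi).
rewrite /bochner_integral_on /bochner_integral => ->.
rewrite [RHS]Rintegral_mkcond; apply: eq_Rintegral => x _.
rewrite patchE indicE; case: (x \in A); first by rewrite scale1r.
by rewrite scale0r linear0.
Qed.

Lemma bochner_norm A f : measurable A -> bint A f ->
  `|bochner_integral_on mu A f| <= \int[mu]_(x in A) `|f x|.
Proof.
move=> mA fi; apply: dual_norm_bound => phi phi1; rewrite bochner_dual//.
apply: le_Rintegral => //; [exact: bint_dual|exact: bint_norm|move=> x _].
rewrite (le_trans (ler_norm _))// (le_trans (ler_dual _ _))//.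
by rewrite -[leRHS]mul1r ler_pM.
Qed.

Lemma bochner_mono A f g : measurable A -> bint A f -> bint A g ->
  (forall x, A x -> f x <=v g x) ->
  bochner_integral_on mu A f <=v bochner_integral_on mu A g.
Proof.
move=> mA fi gi fg; apply: dual_vle => phi phi0.
rewrite [leLHS](bochner_dual phi mA fi) [leRHS](bochner_dual phi mA gi).
apply: le_Rintegral => //; [exact: bint_dual|exact: bint_dual|move=> x Ax].
by rewrite -subr_ge0 -raddfB; apply: phi0; apply: vsubr_ge0; exact: fg.
Qed.

Lemma bochner_cst A f (c : E) : measurable A -> (mu A < +oo)%E ->
  strongly_measurable f -> (forall x, A x -> f x = c) ->
  bint A f /\ bochner_integral_on mu A f = fine (mu A) *: c.
Proof.
move=> mA Aoo sf fc.
have fi : bint A f.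
  split => //; rewrite (eq_integral (fun=> `|c|%:E)).
    by rewrite integral_cst// lte_mul_pinfty.
  by move=> x; rewrite inE => /fc ->.
split => //; apply: dual_eq => phi; rewrite bochner_dual// linearZ /=.
rewrite (@eq_Rintegral _ _ _ mu A (fun=> phi c)).
  by rewrite Rintegral_cst// mulrC.
by move=> x; rewrite inE => /fc ->.
Qed.

Lemma bochner_ge0 A f : measurable A -> bint A f ->
  (forall x, A x -> 0 <=v f x) -> 0 <=v bochner_integral_on mu A f.
Proof.
move=> mA fi f0; apply: dual_vle => phi phi0; rewrite bochner_dual// linear0.
apply: Rintegral_ge0 => x Ax; exact: phi0 (f0 _ Ax).
Qed.

Lemma bochner_setD A B f : measurable A -> measurable B -> A `<=` B -> bint B f ->
  bochner_integral_on mu B f =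
  bochner_integral_on mu A f + bochner_integral_on mu (B `\` A) f.
Proof.
move=> mA mB AB fi; have mD : measurable (B `\` A) by exact: measurableD.
have fA : bint A f by exact: bint_sub fi.
have fD : bint (B `\` A) f by apply: bint_sub fi => //; exact: subDsetl.
apply: dual_eq => phi; rewrite [LHS](bochner_dual phi mB fi) raddfD /=.
rewrite [X in _ = X + _](bochner_dual phi mA fA).
rewrite [X in _ = _ + X](bochner_dual phi mD fD).
have AD : A `|` (B `\` A) = B by rewrite setDUK.
rewrite -{1}AD Rintegral_setU//; first by rewrite AD; exact: bint_dual.
by apply/disj_set2P; rewrite setDE setICA setICr setI0.
Qed.

Lemma bochnerZ A (a : R) f : measurable A -> bint A f ->
  bint A (fun x => a *: f x) /\
  bochner_integral_on mu A (fun x => a *: f x) = a *: bochner_integral_on mu A f.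
Proof.
move=> mA fi; have afi : bint A (fun x => a *: f x).
  split; first exact: smeasZ fi.1.
  under eq_integral do rewrite normrZ EFinM.
  rewrite integralZl//; last exact: bint_norm.
  by rewrite lte_mul_pinfty//; exact: fi.2.
split => //; apply: dual_eq => phi; rewrite [LHS](bochner_dual phi mA afi) linearZ /=.
rewrite [X in _ = _ *: X](bochner_dual phi mA fi).
have -> : \int[mu]_(x in A) phi (a *: f x) = \int[mu]_(x in A) (a * phi (f x)).
  by apply: eq_Rintegral => x _; rewrite linearZ.
by rewrite RintegralZl//; exact: bint_dual.
Qed.

End bochner_on.

(** * Dyadic cubes *)

Section cubes.
Context {R : realType} {d : nat}.
Implicit Types (Q : dcube d) (x : d.-tuple R).
Local Notation cube := (@cube R d).

Let two_gt0 (k : int) : (0 : R) < 2 ^ k. Proof. exact: exprz_gt0. Qed.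

Lemma measurable_box (a b : 'I_d -> R) :
  measurable [set x : d.-tuple R | forall i, a i <= tnth x i < b i].
Proof.
have -> : [set x : d.-tuple R | forall i, a i <= tnth x i < b i] =
    \bigcap_(i in [set: 'I_d]) ((fun x : d.-tuple R => tnth x i) @^-1` `[a i, b i[%classic).
  by apply/seteqP; split => [x h i _|x h i]; [|have := h i I]; rewrite /= in_itv /=.
apply: fin_bigcap_measurable => // i _; rewrite -[X in measurable X]setTI.
exact: measurable_tnth.
Qed.

Lemma measurable_cube Q : measurable (cube Q).
Proof. exact: measurable_box. Qed.

Definition corner Q : d.-tuple R := [tuple (tnth Q.2 i)%:~R * 2 ^ Q.1 | i < d].

Lemma corner_in Q : cube Q (corner Q).
Proof.
by move=> i; rewrite tnth_mktuple lexx /= ltr_pM2r// ltr_int ltzD1.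
Qed.

(** In units of the smaller side length all end points are integers, so strict
    inequalities between them leave room for the whole smaller cube. *)
Lemma cube_laminar Q Q' x : Q.1 <= Q'.1 -> cube Q x -> cube Q' x ->
  cube Q `<=` cube Q'.
Proof.
move=> kk Qx Q'x y Qy i.
have /andP[] := Qx i; have /andP[] := Q'x i; have /andP[] := Qy i.
set m := tnth Q.2 i; set m' := tnth Q'.2 i.
have -> : (2 : R) ^ Q'.1 = (2 ^ `|Q'.1 - Q.1|)%:R * 2 ^ Q.1.
  have -> : (2 : R) ^ Q'.1 = 2 ^ ((Q'.1 - Q.1) + Q.1) by rewrite subrK.
  rewrite expfzDr ?pnatr_eq0//; congr (_ * _).
  by rewrite -{1}(@gez0_abs (Q'.1 - Q.1)) ?subr_ge0// natrX.
set N := (2 ^ _)%N; rewrite !mulrA => y1 y2 x3 x4 x1 x2.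
have lt1 : m' * N%:Z < m + 1.
  by rewrite -(ltr_int R) intrM -(ltr_pM2r (two_gt0 Q.1)) (le_lt_trans x3).
have lt2 : m < (m' + 1) * N%:Z.
  by rewrite -(ltr_int R) intrM -(ltr_pM2r (two_gt0 Q.1)) (le_lt_trans x1).
rewrite ltzD1 in lt1; rewrite -lezD1 in lt2.
rewrite (le_trans _ y1) ?(lt_le_trans y2)// ler_pM2r//.
  by rewrite -[N%:R]/(N%:Z%:~R) -intrM ler_int.
by rewrite -[N%:R]/(N%:Z%:~R) -intrM ler_int.
Qed.

(* In dimension 0 all cubes coincide, so the scale is not determined by the set. *)
Hypothesis d_gt0 : (0 < d)%N.

Lemma cube_sub_scale Q Q' : cube Q `<=` cube Q' -> Q.1 <= Q'.1.
Proof.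
move=> QQ'; rewrite leNgt; apply/negP => lt.
have i0 : 'I_d by exact: Ordinal d_gt0.
(* If Q were larger, it would contain two points at the distance of the side of Q'. *)
pose y : d.-tuple R := [tuple (tnth Q.2 i)%:~R * 2 ^ Q.1 + 2 ^ Q'.1 | i < d].
have Qy : cube Q y.
  move=> i; rewrite tnth_mktuple lerDl ltW//= intrD mulrDl mul1r ltrD2l.
  by rewrite ltr_eXz2l// ltr1n.
have /andP[h1 _] := QQ' _ (corner_in Q) i0.
have /andP[_ h2] := QQ' _ Qy i0.
move: h1 h2; rewrite !tnth_mktuple intrD [(_ + _) * _]mulrDl mul1r ltrD2r.
by move=> /le_lt_trans /[apply]; rewrite ltxx.
Qed.

Lemma cube_inj Q Q' : cube Q `<=` cube Q' -> cube Q' `<=` cube Q -> Q = Q'.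
Proof.
move=> s1 s2; have k : Q.1 = Q'.1.
  by apply/eqP; rewrite eq_le !cube_sub_scale.
case: Q Q' => [k1 m] [k2 m'] /= in s1 s2 k *; subst k2; congr pair.
apply: eq_from_tnth => i; apply/eqP; rewrite eq_le.
have /andP[h1 _] := s1 _ (corner_in (k1, m)) i.
have /andP[h2 _] := s2 _ (corner_in (k1, m')) i.
move: h1 h2; rewrite !tnth_mktuple/= !ler_pM2r// !ler_int => -> ->//.
Qed.

End cubes.

Section locally_finite_cube.
Context {R : realType} {d : nat}.

(** The closure of a cube is compact, hence covered by finitely many of the small
    cubes of finite measure that exist by hypothesis. *)
Lemma locally_finite_cube (mu : {measure set (d.-tuple R) -> \bar R}) (Q : dcube d) :
  locally_finite mu -> (mu (cube Q) < +oo)%E.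
Proof.
move=> lf.
have /choice[r rP] : forall x : d.-tuple R, exists r : R, 0 < r /\
    (mu [set y : d.-tuple R | forall i, (`|tnth y i - tnth x i| < r)%R] < +oo)%E.
  by move=> x; have [r ? ?] := lf x; exists r.
pose tup (v : 'rV[R]_d) : d.-tuple R := [tuple v ord0 i | i < d].
pose vec (x : d.-tuple R) : 'rV[R]_d := \row_i tnth x i.
pose nb x := [set y : d.-tuple R | forall i, (`|tnth y i - tnth x i| < r x)%R].
have mnb x : measurable (nb x).
  have -> : nb x = \bigcap_(i in [set: 'I_d]) ((fun y : d.-tuple R => tnth y i)
      @^-1` `](tnth x i - r x), (tnth x i + r x)[%classic).
    apply/seteqP; split => [y h i _|y h i]; [have := h i|have := h i I].
      by rewrite /= in_itv /= ltr_distl.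
    by rewrite /= in_itv /= ltr_distl.
  apply: fin_bigcap_measurable => // i _; rewrite -[X in measurable X]setTI.
  exact: measurable_tnth.
pose A i : set R := `[(tnth Q.2 i)%:~R * 2 ^ Q.1, (tnth Q.2 i + 1)%:~R * 2 ^ Q.1]%classic.
have : compact [set v : 'rV[R]_d | forall i, A i (v ord0 i)].
  by apply: rV_compact => i; exact: segment_compact.
rewrite compact_cover => /(_ 'rV[R]_d setT (fun v => (ball v (r (tup v)))°)).
case=> [v _|v _|D _ cov]; first exact: open_interior.
  exists v => //; rewrite /interior; apply: nbhsx_ballx; exact: (rP _).1.
apply: (@le_lt_trans _ _ (mu (\big[setU/set0]_(v <- D) nb (tup v)))).
  apply: le_measure; rewrite ?inE; [exact: measurable_cube|exact: bigsetU_measurable|].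
  move=> x Qx; have [|v vD] := cov (vec x).
    move=> i; rewrite /A mxE /= in_itv /=; have /andP[-> /ltW ->] := Qx i.
    by [].
  move/interior_subset => xv; rewrite -bigcup_fset; exists v => // i.
  move: xv => [_ /(_ ord0 i)]; rewrite -ball_normE /= !mxE /= tnth_mktuple distrC; exact.
elim: (enum_fset D) => [|v s IH]; first by rewrite big_nil measure0.
rewrite big_cons.
apply: (@le_lt_trans _ _ (mu (nb (tup v)) + mu (\big[setU/set0]_(v <- s) nb (tup v)))%E).
  by apply: measureU2 => //; exact: bigsetU_measurable.
by rewrite lte_add_pinfty//; exact: (rP _).2.
Qed.

End locally_finite_cube.

(** * The Hardy-Littlewood bound on dyadic blocks of integers *)

Section lebesgue_box.
Context {R : realType}.

Definition box {d} (a b : 'I_d -> R) : set (d.-tuple R) :=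
  [set x | forall i, a i <= tnth x i < b i].

Lemma lebesgue_box d (a b : 'I_d -> R) : (forall i, a i <= b i) ->
  lebesgue_Rd d (box a b) = (\prod_i (b i - a i))%:E.
Proof.
elim: d a b => [|d IH] a b ab.
  rewrite big_ord0 /= diracE mem_set//; by case.
rewrite big_ord_recl EFinM /= /lebesgue_cons /pushforward.
set S := _ @^-1` _.
have -> : S = `[a ord0, b ord0[%classic `*`
    box (fun i => a (lift ord0 i)) (fun i => b (lift ord0 i)).
  apply/seteqP; split => [[x t] /= h|[x t] /= [h1 h2] i].
    split => [|i]; first by have := h ord0; rewrite /= in_itv.
    by have := h (lift ord0 i); rewrite tnthS.
  case: (unliftP ord0 i) => [j|] ->; last by move: h1; rewrite /= in_itv.
  by rewrite tnthS; exact: h2.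
rewrite product_measure1E//; last exact: measurable_box.
congr (_ * _)%E; last by rewrite IH.
transitivity (@lebesgue_measure R `[a ord0, b ord0[%classic) => //.
rewrite lebesgue_measure_itv /= lte_fin.
have [|ba] := ltP (a ord0) (b ord0); first by rewrite EFinB.
by have -> : b ord0 = a ord0; [apply/eqP; rewrite eq_le ba ab|rewrite subrr].
Qed.

End lebesgue_box.

Section sum_indic.
Context {disp} {T : measurableType disp} {R : realType} {E : banachLatticeType R}.
Variable mu : {measure set T -> \bar R}.

Lemma sum_indicE (n : nat) (B : 'I_n -> set T) (v : 'I_n -> E) x i : B i x ->
  (forall j, B j x -> j = i) -> \sum_j (\1_(B j) x : R) *: v j = v i.
Proof.
move=> Bi Bj; rewrite (bigD1 i)//= indicE mem_set// scale1r big1 ?addr0//.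
move=> j ji; rewrite indicE memNset ?scale0r// => /Bj e.
by rewrite e eqxx in ji.
Qed.

Lemma bochner_sum_indic (n : nat) (B : 'I_n -> set T) (v : 'I_n -> E) A f :
  measurable A -> strongly_measurable f ->
  (forall i, measurable (B i)) -> (forall i, (mu (B i) < +oo)%E) ->
  (forall i, B i `<=` A) ->
  (forall x, A x -> f x = \sum_j (\1_(B j) x : R) *: v j) ->
  bint mu A f /\
  bochner_integral_on mu A f = \sum_j fine (mu (B j)) *: v j.
Proof.
move=> mA sf mB Boo BA fE.
have iB j : mu.-integrable A (fun x => (\1_(B j) x)%:E).
  apply/integrableP; split.
    by apply/measurable_EFinP; exact: measurable_indic.
  under eq_integral do rewrite gee0_abs ?lee_fin//.
  rewrite integral_indic//; apply: le_lt_trans (Boo j); apply: le_measure.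
  - by rewrite inE; exact: measurableI.
  - by rewrite inE.
  - exact: subIsetl.
have iBv j (c : R) : mu.-integrable A (fun x => (c * \1_(B j) x)%:E).
  by under eq_fun do rewrite EFinM; exact: integrableZl.
have fi : bint mu A f.
  split => //; apply: (@le_lt_trans _ _
      (\int[mu]_(x in A) (\sum_j (`|v j| * \1_(B j) x)%:E)%E)%E).
    apply: ge0_le_integral => //.
    - by apply/measurable_EFinP/measurable_funTS; exact: measurable_norm_smeas.
    - by apply: (measurable_int mu); apply: integrable_sum => // j _; exact: iBv.
    - move=> x Ax; rewrite sumEFin lee_fin fE// (le_trans (ler_norm_sum _ _ _))//.
      by apply: ler_sum => j _; rewrite normrZ mulrC ger0_norm.
  by apply: integrable_lty => //; apply: integrable_sum => // j _; exact: iBv.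
split => //; apply: dual_eq => phi; rewrite [LHS](bochner_dual phi mA fi).
rewrite raddf_sum /=.
have -> : \int[mu]_(x in A) phi (f x) =
    fine (\int[mu]_(x in A) \sum_j (phi (v j) * \1_(B j) x)%:E)%E.
  congr fine; apply: eq_integral => x; rewrite inE => /fE ->.
  rewrite sumEFin raddf_sum /=; congr EFin; apply: eq_bigr => j _.
  by rewrite linearZ /= mulrC.
rewrite integral_sum// -sum_fine; last by move=> j _; exact: integrable_fin_num.
apply: eq_bigr => j _; rewrite linearZ /=.
under eq_integral do rewrite EFinM.
rewrite integralZl// integral_indic// setIidl; last exact: BA.
by rewrite fineM//; [rewrite mulrC|rewrite ge0_fin_numE].
Qed.

End sum_indic.

Section bnorm_power.
Context {disp} {T : measurableType disp} {R : realType} {E : normedModType R}.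
Variable mu : {measure set T -> \bar R}.

Lemma bnormE (p : R) (f : T -> E) :
  bnorm mu p%:E f = ((\int[mu]_x (`|f x| `^ p)%:E) `^ p^-1)%E.
Proof.
rewrite /bnorm Lnorm.unlock.
by under eq_integral => x _ do rewrite /= normr_id.
Qed.

(** Moving the exponent to the other side replaces norms by integrals, for which
    monotone and additive arguments are available. *)
Lemma bnorm_leP (p c : R) (f : T -> E) : 0 < p -> 0 <= c ->
  (bnorm mu p%:E f <= c%:E)%E = (\int[mu]_x (`|f x| `^ p)%:E <= (c `^ p)%:E)%E.
Proof.
move=> p0 c0; rewrite bnormE; set I := integral _ _ _.
have I0 : (0 <= I)%E by apply: integral_ge0 => x _; rewrite lee_fin powR_ge0.
have pV : 0 <= p^-1 by rewrite invr_ge0 ltW.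
apply/idP/idP => h.
  have -> : I = ((I `^ p^-1) `^ p)%E by rewrite -poweRrM mulVf ?gt_eqF// poweRe1.
  rewrite -poweR_EFin; apply: gt0_ler_poweR => //; first exact: ltW.
    by rewrite in_itv /= poweR_ge0 leey.
  by rewrite in_itv /= lee_fin c0 leey.
have -> : c%:E = ((c `^ p)%:E `^ p^-1)%E.
  by rewrite poweR_EFin -powRrM mulfV ?gt_eqF// powRr1.
apply: gt0_ler_poweR => //; first by rewrite in_itv /= I0 leey.
by rewrite in_itv /= lee_fin powR_ge0 leey.
Qed.

End bnorm_power.

Section simple_lattice.
Context {disp} {T : measurableType disp} {R : realType} {E : banachLatticeType R}.

Lemma simple_fun_lsup (I : Type) (r : seq I) (s : I -> T -> E) :
  (forall i, simple_fun (s i)) ->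
  simple_fun (fun x => lsup [seq s i x | i <- r]).
Proof.
move=> ss; case: r => [|i r] /=; first exact: simple_fun_cst.
elim: r => [|j r IH] //=.
exact: (@simple_fun_comp2 _ _ _ E E E vsup).
Qed.

End simple_lattice.

Section HL_discrete.
Context {R : realType} {d' : nat} {E : banachLatticeType R}.
Local Notation d := d'.+1.
Local Notation mu := (@lebesgue_Rd R d).
Variables (p M lam : R) (p_gt0 : 0 < p) (M_ge0 : 0 <= M) (lam_gt0 : 0 < lam).
Hypothesis HLM : (HLnorm d E p <= M%:E)%E.

Definition block_average i (h : nat -> E) : E := ((2 ^ i)%:R : R)^-1 *: \sum_(s < 2 ^ i) h s.

Variables (n : nat) (h X : nat -> E).
Hypothesis h_ge0 : forall t, 0 <=v h t.
Hypothesis h_le1 : forall t, `|h t| <= 1.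
(* X t lies below every positive upper bound of the averages of h over the dyadic blocks
   that contain t. *)
Hypothesis XP : forall t, (t < 2 ^ n)%N -> forall Y, 0 <=v Y ->
  (forall i, (i <= n)%N -> block_average i (fun s => h (s + t %/ 2 ^ i * 2 ^ i)%N) <=v Y) ->
  X t <=v Y.
Hypothesis X_ge0 : forall t, 0 <=v X t.

Let N : R := (2 ^ n)%:R.
Let N_gt0 : 0 < N. Proof. by rewrite ltr0n expn_gt0. Qed.
Let c : R := (N ^+ d) `^ (- p^-1).
Let c_gt0 : 0 < c. Proof. by rewrite powR_gt0// exprn_gt0. Qed.
Let cp : c `^ p * N ^+ d = 1.
Proof.
rewrite -powRrM mulNr mulVf ?gt_eqF// powRN powRr1 ?exprn_ge0 ?ltW//.
by rewrite mulVf// gt_eqF// exprn_gt0.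
Qed.

(* The slab of t consists of the points of the box whose first coordinate has
   integer part t. *)
Let slab_a (t : nat) (i : 'I_d) : R := if i == ord0 then t%:R else 0.
Let slab_b (t : nat) (i : 'I_d) : R := if i == ord0 then t.+1%:R else N.
Let slab t := box (slab_a t) (slab_b t).

Let mslab t : measurable (slab t). Proof. exact: measurable_box. Qed.

Let slab_measure t : mu (slab t) = (N ^+ d')%:E.
Proof.
rewrite lebesgue_box => [|i]; last first.
  by rewrite /slab_a /slab_b; case: ifP => _; rewrite ?ler_nat// ltW.
rewrite big_ord_recl /slab_a /slab_b /= -natrB// subSnn mul1r.
by under eq_bigr do rewrite subr0; rewrite prodr_const card_ord.
Qed.

Let slab_integral (a : R) t : 0 <= a ->
  (\int[mu]_x (a * \1_(slab t) x)%:E)%E = (a * N ^+ d')%:E.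
Proof.
move=> a0; transitivity (\int[mu]_x (a%:E * (\1_(slab t) x)%:E))%E.
  by apply: eq_integral => x _; rewrite EFinM.
rewrite ge0_integralZl//; last by apply/measurable_EFinP.
by rewrite integral_indic// setIT EFinM; congr (_ * _)%E; exact: slab_measure.
Qed.

Let slab_uniq t t' x : slab t x -> slab t' x -> t = t'.
Proof.
move=> /(_ ord0) /andP[a1 a2] /(_ ord0) /andP[b1 b2].
apply/eqP; rewrite eqn_leq; apply/andP; split; rewrite -ltnS -(ltr_nat R).
  exact: le_lt_trans a1 b2.
exact: le_lt_trans b1 a2.
Qed.

Let f (x : d.-tuple R) : E := \sum_(t < 2 ^ n) (\1_(slab t) x : R) *: (c *: h t).

Let fE t x : (t < 2 ^ n)%N -> slab t x -> f x = c *: h t.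
Proof.
move=> tn tx; rewrite /f.
apply: (@sum_indicE _ _ _ _ _ (fun t : 'I_(2 ^ n) => slab t) _ x (Ordinal tn)) => //.
by move=> j jx; apply/val_inj; exact: slab_uniq jx tx.
Qed.

Let f_simple : simple_fun f.
Proof.
apply: simple_fun_sum => t; apply: simple_fun_restr => //.
exact: simple_fun_cst.
Qed.

Let f_norm : (bnorm mu p%:E f <= 1)%E.
Proof.
rewrite bnorm_leP// powR1.
apply: (@le_trans _ _ (\int[mu]_x (\sum_(t < 2 ^ n) (c `^ p * \1_(slab t) x)%:E)%E)%E).
  apply: ge0_le_integral => //.
  - apply/measurable_EFinP.
    exact: (@measurable_simple _ _ _ _ f (fun v => `|v| `^ p)).
  - apply: emeasurable_sum => t; apply/measurable_EFinP/measurable_funM => //.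
  - move=> x _; rewrite sumEFin lee_fin.
    have [[t [tn tx]]|nx] := pselect (exists t, (t < 2 ^ n)%N /\ slab t x).
      rewrite (fE tn tx) normrZ (bigD1 (Ordinal tn))//= indicE mem_set// mulr1.
      rewrite ler_wpDr ?sumr_ge0// => [i _|]; first by rewrite mulr_ge0 ?powR_ge0.
      apply: ge0_ler_powR; rewrite ?nnegrE ?mulr_ge0//; [exact: ltW|exact: ltW|].
      by rewrite gtr0_norm// ler_piMr//; exact: ltW.
    rewrite /f big1 => [|t _]; last first.
      by rewrite indicE memNset ?scale0r// => tx; apply: nx; exists t.
    by rewrite normr0 powR0 ?gt_eqF// sumr_ge0// => i _; rewrite mulr_ge0 ?powR_ge0.
rewrite ge0_integral_sum//; first last.
- by move=> t x _; rewrite lee_fin mulr_ge0 ?powR_ge0.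
- by move=> t; apply/measurable_EFinP/measurable_funM.
rewrite (eq_bigr (fun _ => (c `^ p * N ^+ d')%:E)); last first.
  by move=> t _; apply: slab_integral; exact: powR_ge0.
rewrite sumEFin lee_fin sumr_const card_ord -mulr_natr -mulrA.
by rewrite -[(2 ^ n)%:R]/N -exprSr cp.
Qed.

Let Q i (m : {ffun 'I_d -> 'I_(2 ^ n)}) : dcube d :=
  (Posz i, [tuple Posz (m j) | j < d]).

Let Qn (i : 'I_n.+1) m := Q i m.

Let DD : {fset dcube d} :=
  [fset Qn i m | i in 'I_n.+1, m in {ffun 'I_d -> 'I_(2 ^ n)}]%fset.

Let cubeE i m : cube (Q i m) = @box R d (fun j => (m j * 2 ^ i)%:R)
  (fun j => ((m j).+1 * 2 ^ i)%:R).
Proof.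
apply/seteqP; split => x xQ j; have := xQ j; rewrite tnth_mktuple /= !natrM natrX.
  by rewrite -[Posz _ + 1]/(Posz (m j + 1)) addn1.
by rewrite -[Posz _ + 1]/(Posz (m j + 1)) addn1.
Qed.

Let cube_measure i m : mu (cube (Q i m)) = (((2 ^ i)%:R : R) ^+ d)%:E.
Proof.
rewrite cubeE lebesgue_box => [|j]; last by rewrite ler_nat leq_mul2r leqnSn orbT.
under eq_bigr do rewrite -natrB ?leq_mul2r ?leqnSn ?orbT// -mulnBl subSnn mul1n.
by rewrite prodr_const card_ord.
Qed.

Let cube_avg i (m : {ffun 'I_d -> 'I_(2 ^ n)}) : (i <= n)%N -> (forall j, ((m j).+1 * 2 ^ i <= 2 ^ n)%N) ->
  cube_average f (Q i m) = c *: block_average i (fun s => h (s + m ord0 * 2 ^ i)%N).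
Proof.
move=> ni mn; rewrite /cube_average.
pose B (s : 'I_(2 ^ i)) := @box R d
  (fun j => if j == ord0 then (s + m ord0 * 2 ^ i)%:R else (m j * 2 ^ i)%:R)
  (fun j => if j == ord0 then (s + m ord0 * 2 ^ i).+1%:R else ((m j).+1 * 2 ^ i)%:R).
have Bmeas s : mu (B s) = (((2 ^ i)%:R : R) ^+ d')%:E.
  rewrite lebesgue_box => [|j]; last first.
    by case: ifP => _; rewrite ler_nat ?leqnSn// leq_mul2r leqnSn orbT.
  rewrite big_ord_recl /= -natrB// subSnn mul1r.
  under eq_bigr do rewrite -natrB ?leq_mul2r ?leqnSn ?orbT// -mulnBl subSnn mul1n.
  by rewrite prodr_const card_ord.
have sn (s : 'I_(2 ^ i)) : (s + m ord0 * 2 ^ i < 2 ^ n)%N.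
  by apply: leq_trans (mn ord0); rewrite mulSn ltn_add2r.
have BQ s : B s `<=` cube (Q i m).
  rewrite cubeE => x xB j; have /andP[] := xB j; case: eqP => [->|_ -> ->//] x1 x2.
  apply/andP; split; first by apply: le_trans x1; rewrite ler_nat leq_addl.
  by apply: lt_le_trans x2 _; rewrite ler_nat mulSn ltn_add2r.
have Bslab s : B s `<=` slab (s + m ord0 * 2 ^ i)%N.
  move=> x xB j; have /andP[] := xB j; rewrite /slab_a /slab_b; case: eqP => [_ -> ->//|_ x1 x2].
  apply/andP; split; first by apply: le_trans x1; rewrite ler0n.
  by apply: lt_le_trans x2 _; rewrite ler_nat.
have QB x : cube (Q i m) x -> exists s, B s x.
  rewrite cubeE => xQ; have /andP[x1 x2] := xQ ord0.
  have x0 : 0 <= tnth x ord0 by apply: le_trans x1; rewrite ler0n.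
  have /andP[t1 t2] := truncn_itv x0; set t := Num.truncn _ in t1 t2.
  have mt : (m ord0 * 2 ^ i <= t)%N.
    by rewrite -ltnS -(ltr_nat R); exact: le_lt_trans x1 t2.
  have tm : (t - m ord0 * 2 ^ i < 2 ^ i)%N.
    rewrite ltn_subLR// addnC -mulSn -(ltr_nat R); exact: le_lt_trans t1 x2.
  exists (Ordinal tm) => j /=; case: eqP => [->|_]; last exact: xQ.
  by rewrite subnK// t1.
have Boo s : (mu (B s) < +oo)%E by rewrite Bmeas ltry.
have [|_ ->] := @bochner_sum_indic _ _ R E mu _ B
    (fun s => c *: h (s + m ord0 * 2 ^ i)%N) (cube (Q i m)) f
    (measurable_cube _) (simple_smeas f_simple) (fun s => measurable_box _ _)
    Boo BQ _.
  move=> x /QB [s sx].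
  rewrite (fE (sn s) (Bslab _ _ sx)); apply/esym.
  apply: (@sum_indicE _ _ _ _ _ B (fun s => c *: h (s + m ord0 * 2 ^ i)%N) x s) => //.
  move=> j jx; apply/val_inj; have := slab_uniq (Bslab _ _ jx) (Bslab _ _ sx).
  by move=> /eqP; rewrite eqn_add2r => /eqP.
have -> : \sum_j fine (mu (B j)) *: (c *: h (j + m ord0 * 2 ^ i)%N) =
    \sum_(j < 2 ^ i) (((2 ^ i)%:R : R) ^+ d') *: (c *: h (j + m ord0 * 2 ^ i)%N).
  by apply: eq_bigr => s _; congr (_ *: _); rewrite -[RHS]/(fine (_%:E)); congr fine.
rewrite cube_measure /block_average.
rewrite -!scaler_sumr !scalerA; congr (_ *: _).
rewrite mulrA [RHS]mulrC; congr (_ * _).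
by rewrite /= exprS invfM -mulrA mulVf ?mulr1// expf_neq0// pnatr_eq0 expn_eq0.
Qed.

Let HLmax_ge t x : (t < 2 ^ n)%N -> slab t x -> c *: X t <=v HLmax DD f x.
Proof.
move=> tn tx.
have x_ge0 j : 0 <= tnth x j.
  by have /andP[+ _] := tx j; rewrite /slab_a; case: ifP => // _; apply: le_trans; exact: ler0n.
have x_lt j : tnth x j < N.
  have /andP[_] := tx j; rewrite /slab_b; case: ifP => // _ h1.
  by apply: lt_le_trans h1 _; rewrite ler_nat.
have trlt j : (Num.truncn (tnth x j) < 2 ^ n)%N.
  have /andP[h1 _] := truncn_itv (x_ge0 j).
  by rewrite -(ltr_nat R); exact: le_lt_trans h1 (x_lt j).
have tr0 : Num.truncn (tnth x ord0) = t.
  have /andP[h1 h2] := truncn_itv (x_ge0 ord0).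
  have /andP[] := tx ord0; rewrite /slab_a /slab_b eqxx => h3 h4.
  apply/eqP; rewrite eqn_leq; apply/andP; split; rewrite -ltnS -(ltr_nat R).
    exact: le_lt_trans h1 h4.
  exact: le_lt_trans h3 h2.
have mlt i j : (Num.truncn (tnth x j) %/ 2 ^ i < 2 ^ n)%N.
  exact: leq_ltn_trans (leq_div _ _) (trlt j).
pose m i : {ffun 'I_d -> 'I_(2 ^ n)} := [ffun j => Ordinal (mlt i j)].
have Qx i : cube (Q i (m i)) x.
  rewrite cubeE => j; rewrite ffunE /=; have /andP[h1 h2] := truncn_itv (x_ge0 j).
  apply/andP; split; first by apply: le_trans h1; rewrite ler_nat leq_divM.
  apply: lt_le_trans h2 _; rewrite ler_nat.
  by rewrite ltn_ceil// expn_gt0.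
have key i : (i <= n)%N ->
    c *: block_average i (fun s => h (s + t %/ 2 ^ i * 2 ^ i)%N) <=v HLmax DD f x.
  move=> ni; have QDD : Q i (m i) \in DD.
    by apply/imfset2P; exists (inord i) => //; exists (m i) => //; rewrite /Qn inordK.
  have := @lsup_ub R E _ DD (fun Q => (\1_(cube Q) x : R) *: cube_average f Q) _ QDD.
  rewrite -/(HLmax DD f x) indicE mem_set// scale1r cube_avg//.
    by rewrite ffunE /= tr0.
  move=> j; rewrite ffunE /= -{1}(subnK ni) expnD leq_pmul2r ?expn_gt0//.
  by rewrite ltn_divLR ?expn_gt0// -expnD subnK.
have -> : HLmax DD f x = c *: (c^-1 *: HLmax DD f x).
  by rewrite scalerA divff ?scale1r// gt_eqF.
apply: vscale_mono; first exact: ltW.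
have ci : 0 <= c^-1 by rewrite invr_ge0 ltW.
apply: XP => //.
  apply: vscale_ge0 => //; apply: vle_trans (key 0%N _) => //.
  apply: vscale_ge0; first exact: ltW.
  by apply: vscale_ge0; [rewrite invr_ge0|apply: vsum_ge0].
move=> i ni; have := vscale_mono ci (key i ni).
by rewrite scalerA mulVf ?scale1r// gt_eqF.
Qed.

(** Apply the Hardy-Littlewood bound to the function f(x) = c h(floor x_1) on the box
    [0, 2^n)^d with the cubes 2^i (m + [0, 1)^d), i <= n.  The average of f over
    such a cube inside the box is c times a block average of [h], and c makes the norm of f
    at most 1.  The function [X] stands for the supremum of the block averages. *)
Lemma HL_discrete :
  lam `^ p * (#|[set t : 'I_(2 ^ n) | lam < `|X t|]%SET|)%:R <= M `^ p * (2 ^ n)%:R.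
Proof.
set bad := [set t | _]%SET.
have HLs : simple_fun (HLmax DD f).
  apply: simple_fun_lsup => q; apply: simple_fun_restr; first exact: measurable_cube.
  exact: simple_fun_cst.
have h1 : (bnorm mu p%:E (HLmax DD f) <= M%:E)%E.
  apply: le_trans HLM; apply: (@le_trans _ _ (opnorm mu mu p%:E p%:E (HLmax DD))).
    apply: ereal_sup_ubound; exists f => //; split => //.
    split; first exact: simple_smeas.
    by apply: le_lt_trans f_norm _; rewrite ltry.
  by apply: ereal_sup_ubound; exists DD.
have h2 : (\int[mu]_x (`|HLmax DD f x| `^ p)%:E <= (M `^ p)%:E)%E.
  by rewrite -bnorm_leP.
pose a (t : 'I_(2 ^ n)) : R := if t \in bad then (c * lam) `^ p else 0.
have a_ge0 t : 0 <= a t by rewrite /a; case: ifP => // _; exact: powR_ge0.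
have h3 : (\int[mu]_x (\sum_t (a t * \1_(slab t) x)%:E)%E <=
    \int[mu]_x (`|HLmax DD f x| `^ p)%:E)%E.
  apply: ge0_le_integral => //.
  - by move=> x _; rewrite sume_ge0// => t _; rewrite lee_fin mulr_ge0.
  - by apply: emeasurable_sum => t; apply/measurable_EFinP/measurable_funM.
  - apply/measurable_EFinP.
    exact: (@measurable_simple _ _ _ _ (HLmax DD f) (fun v => `|v| `^ p)).
  - move=> x _; rewrite sumEFin lee_fin.
    have [[t tx]|nx] := pselect (exists t : 'I_(2 ^ n), slab t x).
      rewrite (bigD1 t)//= indicE mem_set// mulr1 big1 ?addr0; last first.
        move=> s st; rewrite indicE memNset ?mulr0// => sx.
        by move/negP : st; apply; apply/eqP/val_inj; exact: slab_uniq sx tx.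
      rewrite /a; case: ifP => [tbad|_]; last exact: powR_ge0.
      apply: ge0_ler_powR; rewrite ?nnegrE//; first exact: ltW.
        by rewrite mulr_ge0//; exact: ltW.
      apply: (@le_trans _ _ (c * `|X t|)).
        by rewrite ler_pM2l//; move: tbad; rewrite inE; exact: ltW.
      have -> : c * `|X t| = `|c *: X t| by rewrite normrZ gtr0_norm.
      apply: vnorm_mono; last exact: HLmax_ge.
      by apply: vscale_ge0 => //; exact: ltW.
    rewrite big1 ?powR_ge0// => t _.
    by rewrite indicE memNset ?mulr0// => tx; apply: nx; exists t.
have := le_trans h3 h2; rewrite ge0_integral_sum//; first last.
- by move=> t x _; rewrite lee_fin mulr_ge0.
- by move=> t; apply/measurable_EFinP/measurable_funM.
rewrite (eq_bigr (fun t => (a t * N ^+ d')%:E)); last first.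
  by move=> t _; exact: slab_integral.
rewrite sumEFin lee_fin -mulr_suml -big_mkcond sumr_const.
rewrite powRM; [|exact: ltW|exact: ltW].
move=> h4; have := ler_wpM2l (ltW N_gt0) h4.
rewrite [leLHS](_ : _ = c `^ p * N ^+ d * (lam `^ p * #|bad|%:R)); last first.
  by rewrite exprS -mulr_natr; ring.
by rewrite cp mul1r (mulrC N).
Qed.

End HL_discrete.

(** * A Bellman function for dyadic martingales in a Banach lattice *)

Lemma sum_nat_double (V : zmodType) (F : nat -> V) N :
  \sum_(0 <= i < N + N) F i =
  \sum_(0 <= i < N) F i + \sum_(0 <= i < N) F (i + N)%N.
Proof.
rewrite (@big_cat_nat _ _ _ N)//= ?leq_addr//; congr (_ + _).
by rewrite -[X in \sum_(X <= _ < _) _](add0n N) big_addn addnK.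
Qed.

Section bellman.
Context {R : realType} {E : banachLatticeType R}.
Variable lam : R.
Implicit Types (u v : E).

(** A finite dyadic martingale: the value at an inner node is the mean of the values
    of its children, so only the leaves carry data. *)
Inductive btree := Leaf of E | Node of btree & btree.

Fixpoint bval t := match t with
  | Leaf v => v
  | Node l r => 2^-1 *: (bval l + bval r)
  end.

Definition ball_ok v := 0 <=v v /\ `|v| <= 1.

Fixpoint bok t := match t with
  | Leaf v => ball_ok v
  | Node l r => bok l /\ bok r
  end.

(** The probability that [u] joined with the values met along a random branch, the
    root excluded, has norm above [lam].  Excluding the root makes the function
    recursive: the children start from [u] joined with their own value. *)
Fixpoint bprob u t : R := match t with
  | Leaf _ => (lam < `|u|)%R%:R
  | Node l r => 2^-1 * (bprob (vsup u (bval l)) l + bprob (vsup u (bval r)) r)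
  end.

Fixpoint bdepth t : nat := match t with
  | Leaf _ => 0%N
  | Node l r => (maxn (bdepth l) (bdepth r)).+1
  end.

(** The tree read as a step function on 2^n intervals of equal length; a leaf above
    depth n is repeated. *)
Fixpoint bleaf t n k : E := match t, n with
  | Leaf v, _ => v
  | Node l r, n'.+1 =>
      if (k < 2 ^ n')%N then bleaf l n' k else bleaf r n' (k - 2 ^ n')%N
  | Node _ _, 0%N => 0
  end.

(** The supremum of [u] and the values along the branch that ends over the k-th of
    the 2^n intervals. *)
Fixpoint brun u t n k : E := match t, n with
  | Leaf _, _ => u
  | Node l r, n'.+1 =>
      if (k < 2 ^ n')%N then brun (vsup u (bval l)) l n' k
      else brun (vsup u (bval r)) r n' (k - 2 ^ n')%N
  | Node _ _, 0%N => u
  end.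

Lemma block_averageE i (h : nat -> E) :
  block_average i h = ((2 ^ i)%:R : R)^-1 *: \sum_(0 <= s < 2 ^ i) h s.
Proof. by rewrite /block_average big_mkord. Qed.

Lemma avg_bleaf t n : (bdepth t <= n)%N -> block_average n (bleaf t n) = bval t.
Proof.
elim: t n => [v|l IHl r IHr] n /=.
  rewrite /block_average (eq_bigr (fun=> v)) => [_|i _]; last by case: n i.
  rewrite sumr_const card_ord -(scaler_nat _ v) scalerA mulVf ?scale1r//.
case: n => // n; rewrite ltnS geq_max => /andP[ln rn].
rewrite block_averageE expnS mul2n -addnn sum_nat_double -(IHl n)// -(IHr n)// !block_averageE.
rewrite -scalerDr scalerA; congr (_ *: (_ + _)).
- by rewrite -invfM addnn -mul2n natrM.
- by apply: eq_big_nat => k /andP[_ kn]; rewrite kn.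
- by apply: eq_big_nat => k /andP[_ kn]; rewrite ltnNge leq_addl /= addnK.
Qed.

(** The value of each node is the average of the leaves below it, hence a block
    average of the step function. *)
Lemma brun_lub t n u k Y : (bdepth t <= n)%N -> (k < 2 ^ n)%N -> u <=v Y ->
  (forall i, (i <= n)%N ->
     block_average i (fun s => bleaf t n (s + k %/ 2 ^ i * 2 ^ i)%N) <=v Y) ->
  brun u t n k <=v Y.
Proof.
elim: t n u k => [v|l IHl r IHr] n u k //=.
case: n => // n; rewrite ltnS geq_max => /andP[ln rn] kn uY H.
have blk i s : (i <= n)%N -> (s < 2 ^ i)%N -> (k < 2 ^ n)%N ->
    (s + k %/ 2 ^ i * 2 ^ i < 2 ^ n)%N.
  move=> ni si k1; rewrite -(subnK ni) expnD.
  apply: (@leq_trans ((k %/ 2 ^ i).+1 * 2 ^ i)); first by rewrite mulSn ltn_add2r.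
  by rewrite leq_mul2r ltn_divLR ?expn_gt0// -expnD subnK// k1 orbT.
case: ifP => k1.
  have H' i : (i <= n)%N ->
      block_average i (fun s => bleaf l n (s + k %/ 2 ^ i * 2 ^ i)%N) <=v Y.
    move=> ni; have := H i (leqW ni); congr (_ <=v _); rewrite !block_averageE.
    by congr (_ *: _); apply: eq_big_nat => s /andP[_ si]; rewrite blk.
  apply: IHl => //; apply: vsup_lub => //; rewrite -(avg_bleaf ln).
  have := H' n (leqnn n); rewrite divn_small// mul0n.
  by congr (_ <=v _); congr block_average; apply/funext => s; rewrite addn0.
have k2 : (2 ^ n <= k)%N by rewrite leqNgt k1.
have k3 : (k - 2 ^ n < 2 ^ n)%N by rewrite ltn_subLR// addnn -mul2n -expnS.
have H' i : (i <= n)%N ->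
    block_average i (fun s => bleaf r n (s + (k - 2 ^ n) %/ 2 ^ i * 2 ^ i)%N) <=v Y.
  move=> ni; have := H i (leqW ni); congr (_ <=v _); rewrite !block_averageE.
  congr (_ *: _); apply: eq_big_nat => s /andP[_ si].
  have e : (k %/ 2 ^ i * 2 ^ i = (k - 2 ^ n) %/ 2 ^ i * 2 ^ i + 2 ^ n)%N.
    have e0 : (2 ^ n = 2 ^ (n - i) * 2 ^ i)%N by rewrite -expnD subnK.
    have ek : k = (2 ^ (n - i) * 2 ^ i + (k - 2 ^ n))%N by rewrite -e0 subnKC.
    by rewrite {1}ek divnMDl ?expn_gt0// mulnDl -e0 addnC.
  by rewrite e addnA ltnNge leq_addl /= addnK.
apply: IHr => //; apply: vsup_lub => //; rewrite -(avg_bleaf rn).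
have := H' n (leqnn n); rewrite divn_small// mul0n.
by congr (_ <=v _); congr block_average; apply/funext => s; rewrite addn0.
Qed.

Lemma brun_ge0 t n u k : 0 <=v u -> 0 <=v brun u t n k.
Proof.
elim: t n u k => [v|l IHl r IHr] [|n] u k u0 //=.
by case: ifP => _; [apply: IHl|apply: IHr]; apply: vle_trans u0 (vsup_ubl _ _).
Qed.

Lemma bleaf_ok t n k : bok t -> ball_ok (bleaf t n k).
Proof.
have ok0 : ball_ok 0 by split; [exact: vle_refl|rewrite normr0].
elim: t n k => [v|l IHl r IHr] [|n] k //= [okl okr].
by case: ifP => _; [apply: IHl|apply: IHr].
Qed.

Lemma brun_count t n u : (bdepth t <= n)%N ->
  \sum_(0 <= k < 2 ^ n) ((lam < `|brun u t n k|)%R%:R : R) =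
  (2 ^ n)%:R * bprob u t.
Proof.
elim: t n u => [v|l IHl r IHr] n u /=.
  rewrite (eq_bigr (fun=> (lam < `|u|)%R%:R)) => [|i _]; last by case: n.
  by rewrite sumr_const_nat subn0 mulr_natl.
case: n => // n; rewrite ltnS geq_max => /andP[ln rn].
rewrite expnS mul2n -addnn sum_nat_double.
rewrite (eq_big_nat _ _ (F2 := fun k =>
    ((lam < `|brun (vsup u (bval l)) l n k|)%R%:R : R))); last first.
  by move=> k /andP[_ kn]; rewrite kn.
rewrite [X in _ + X](eq_big_nat _ _ (F2 := fun k =>
    ((lam < `|brun (vsup u (bval r)) r n k|)%R%:R : R))); last first.
  by move=> k /andP[_ kn]; rewrite ltnNge leq_addl /= addnK.
by rewrite IHl// IHr// natrD -mulrDr; field.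
Qed.

Lemma bprob_itv u t : 0 <= bprob u t <= 1.
Proof.
elim: t u => [v|l IHl r IHr] u /=; first by case: (_ < _); rewrite ?lexx ?ler01.
have /andP[l0 l1] := IHl (vsup u (bval l)).
have /andP[r0 r1] := IHr (vsup u (bval r)).
apply/andP; split; first by rewrite mulr_ge0// addr_ge0.
by rewrite ler_pdivrMl// mulr1 lerD.
Qed.

Lemma bprob_mono u u' t : 0 <=v u -> u <=v u' -> bprob u t <= bprob u' t.
Proof.
elim: t u u' => [v|l IHl r IHr] u u' u0 uu' /=.
  rewrite ler_nat; case: (ltP lam `|u|) => //= h.
  by rewrite (lt_le_trans h)// vnorm_mono.
rewrite ler_pM2l// lerD//; [apply: IHl|apply: IHr].
- exact: vle_trans u0 (vsup_ubl _ _).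
- by apply: vsup_mono => //; exact: vle_refl.
- exact: vle_trans u0 (vsup_ubl _ _).
- by apply: vsup_mono => //; exact: vle_refl.
Qed.

Lemma ball_okM (th : R) a b : 0 <= th <= 1 -> ball_ok a -> ball_ok b ->
  ball_ok (th *: a + (1 - th) *: b).
Proof.
move=> /andP[t0 t1] [a0 a1] [b0 b1]; have t2 : 0 <= 1 - th by rewrite subr_ge0.
split; first by apply: vaddr_ge0; apply: vscale_ge0.
rewrite (le_trans (ler_normD _ _))// !normrZ !ger0_norm//.
rewrite [leRHS](_ : 1 = th * 1 + (1 - th) * 1); last by rewrite !mulr1 subrKC.
by rewrite lerD// ler_wpM2l.
Qed.

(** The Bellman function of the maximal inequality: the largest probability that the
    running supremum, started from [u], exceeds [lam] for a martingale with mean [v]. *)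
Definition bellman u v : R :=
  sup [set bprob u t | t in [set t | bok t /\ bval t = v]].

Lemma bellman_has_sup u v : ball_ok v ->
  has_sup [set bprob u t | t in [set t | bok t /\ bval t = v]].
Proof.
move=> okv; split; first by exists (bprob u (Leaf v)), (Leaf v).
by exists 1 => _ [t _ <-]; have /andP[] := bprob_itv u t.
Qed.

Lemma bellman_ub u t : bok t -> bprob u t <= bellman u (bval t).
Proof.
move=> okt; apply: sup_upper_bound; last by exists t.
split; first by exists (bprob u t), t.
by exists 1 => _ [t' _ <-]; have /andP[] := bprob_itv u t'.
Qed.

Lemma bellman_lub u v (c : R) : ball_ok v ->
  (forall t, bok t -> bval t = v -> bprob u t <= c) -> bellman u v <= c.
Proof.
move=> okv H; apply: ge_sup; first by case: (bellman_has_sup u okv).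
by move=> _ [t [okt tv] <-]; exact: H.
Qed.

Lemma bellman_leaf u v : ball_ok v -> (lam < `|u|)%R%:R <= bellman u v.
Proof. by move=> okv; exact: (@bellman_ub u (Leaf v)). Qed.

Lemma bellman_ge0 u v : ball_ok v -> 0 <= bellman u v.
Proof. by move=> okv; apply: le_trans (bellman_leaf u okv). Qed.

Lemma bellman_le1 u v : ball_ok v -> bellman u v <= 1.
Proof.
by move=> okv; apply: bellman_lub => // t _ _; have /andP[] := bprob_itv u t.
Qed.

Lemma bellman_mono u u' v : ball_ok v -> 0 <=v u -> u <=v u' ->
  bellman u v <= bellman u' v.
Proof.
move=> okv u0 uu'; apply: bellman_lub => // t okt <-.
by apply: le_trans (bellman_ub u' okt); exact: bprob_mono.
Qed.

(** Nearly optimal trees for [a] and [b] hang below a common root. *)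
Lemma bellman_midpoint u a b : ball_ok a -> ball_ok b ->
  bellman (vsup u a) a + bellman (vsup u b) b <=
  2 * bellman u (2^-1 *: (a + b)).
Proof.
move=> oka okb; rewrite -lerBrDr; apply: bellman_lub => // l okl la.
rewrite lerBrDr addrC -lerBrDr; apply: bellman_lub => // r okr rb.
rewrite lerBrDr addrC -ler_pdivrMl// -la -rb.
exact: (@bellman_ub u (Node l r)).
Qed.

(** Only equal weights are available directly.  Let D(s) be the defect of the claim at
    weight s, so D >= -1.  For s <= 1/2 the point at weight s is the midpoint of [b] and
    the point at weight 2 s, which gives D(s) >= D(2 s) / 2, and symmetrically for
    s >= 1/2.  Iterating, D >= - 2^-n for all n. *)
Lemma bellman_concave u (th : R) a b : 0 <= th <= 1 -> 0 <=v u ->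
  ball_ok a -> ball_ok b ->
  th * bellman (vsup u a) a + (1 - th) * bellman (vsup u b) b <=
  bellman u (th *: a + (1 - th) *: b).
Proof.
move=> th01 u0 oka okb.
set X := bellman (vsup u a) a; set Y := bellman (vsup u b) b.
suff H n (s : R) : 0 <= s <= 1 -> - (2 ^- n) <=
    bellman u (s *: a + (1 - s) *: b) - (s * X + (1 - s) * Y).
  rewrite -subr_ge0; set D := (X in 0 <= X).
  have hD n : - (2 ^- n) <= D by exact: H.
  rewrite leNgt; apply/negP => D0.
  have [n hn] : exists n, 2 ^- n < - D :> R.
    have ND : 0 < - D by rewrite oppr_gt0.
    have [n _ /(_ n (leqnn n))] := near_infty_natSinv_expn_lt (PosNum ND).
    by rewrite div1r => ?; exists n.
  by have := hD n; rewrite leNgt ltrNr hn.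
elim: n s => [|n IH] s s01; have /andP[s0 s1] := s01.
  have U0 : 0 <= bellman u (s *: a + (1 - s) *: b).
    by apply: bellman_ge0; exact: ball_okM.
  have sX : s * X <= s by rewrite ler_piMr// bellman_le1.
  have sY : (1 - s) * Y <= 1 - s by rewrite ler_piMr ?subr_ge0// bellman_le1.
  by rewrite expr0 invr1; lra.
have step (x y : E) (c : R) : ball_ok x -> ball_ok y ->
    s *: a + (1 - s) *: b = 2^-1 *: (x + y) ->
    - 2 ^- n + 2 * (s * X + (1 - s) * Y) <= bellman u x + bellman (vsup u y) y ->
    - 2 ^- n.+1 <=
      bellman u (s *: a + (1 - s) *: b) - (s * X + (1 - s) * Y).
  move=> okx oky -> h.
  have h1 := bellman_midpoint u okx oky.
  have h2 : bellman u x <= bellman (vsup u x) x.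
    by apply: bellman_mono => //; exact: vsup_ubl.
  rewrite exprS invfM; set q := 2 ^- n in h *; lra.
have [s2|s2] := leP s 2^-1.
  have s' : 0 <= 2 * s <= 1 by apply/andP; split; lra.
  have h := IH _ s'.
  apply: (step ((2 * s) *: a + (1 - 2 * s) *: b) b) => //; first exact: ball_okM.
    rewrite scalerDr scalerDr !scalerA -addrA -scalerDl.
    by congr (_ *: _ + _ *: _); field.
  by rewrite -/Y; lra.
have s' : 0 <= 2 * s - 1 <= 1 by apply/andP; split; lra.
have h := IH _ s'.
apply: (step ((2 * s - 1) *: a + (1 - (2 * s - 1)) *: b) a) => //; first exact: ball_okM.
  rewrite scalerDr scalerDr !scalerA addrAC -scalerDl.
  by congr (_ *: _ + _ *: _); field.
by rewrite -/X; lra.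
Qed.

End bellman.

Section bellman_HL.
Context {R : realType} {d' : nat} {E : banachLatticeType R}.
Variables (p M lam : R) (p_gt0 : 0 < p) (M_ge0 : 0 <= M) (lam_gt0 : 0 < lam).
Hypothesis HLM : (HLnorm d'.+1 E p <= M%:E)%E.

(** The running supremum of a martingale tree is a dyadic maximal function on blocks
    of integers, so Chebyshev in [HL_discrete] bounds each competitor. *)
Lemma bellman_HL (v : E) : ball_ok v -> lam `^ p * bellman lam 0 v <= M `^ p.
Proof.
move=> okv; have lp : 0 < lam `^ p by rewrite powR_gt0.
rewrite -ler_pdivlMl//; apply: bellman_lub => // t okt _.
rewrite ler_pdivlMl//; set n := bdepth t.
have N0 : (0 : R) < (2 ^ n)%:R by rewrite ltr0n expn_gt0.
rewrite -(ler_pM2r N0) -mulrA [X in _ * X]mulrC -brun_count//.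
have := @HL_discrete R d' E p M lam p_gt0 M_ge0 lam_gt0 HLM n (bleaf t n) (brun 0 t n).
have -> : (#|[set k : 'I_(2 ^ n) | lam < `|brun 0 t n k|]%SET|)%:R =
    \sum_(0 <= k < 2 ^ n) ((lam < `|brun 0 t n k|)%R%:R : R).
  rewrite big_mkord -sum1_card natr_sum big_mkcond /=; apply: eq_bigr => k _.
  by rewrite inE; case: (_ < _).
apply.
- by move=> k; have [] := bleaf_ok n k okt.
- by move=> k; have [] := bleaf_ok n k okt.
- by move=> k kn Y Y0 H; exact: brun_lub.
- by move=> k; apply: brun_ge0; exact: vle_refl.
Qed.

End bellman_HL.

(** * A weak type estimate for arbitrary measures *)

Section tree_lemma.
Context {disp} {T : measurableType disp} {R : realType} {E : banachLatticeType R}.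
Variables (I : eqType) (cb : I -> set T) (sc : I -> int).
Hypothesis mcb : forall Q, measurable (cb Q).
Hypothesis lamin : forall Q Q' x, sc Q <= sc Q' -> cb Q x -> cb Q' x ->
  cb Q `<=` cb Q'.
Variables (S : set T) (w : set T -> R) (v : set T -> E).
Hypothesis wD : forall A B, measurable A -> measurable B -> A `<=` B -> B `<=` S ->
  w B = w A + w (B `\` A).
Hypothesis vD : forall A B, measurable A -> measurable B -> A `<=` B -> B `<=` S ->
  v B = v A + v (B `\` A).
Hypothesis v_ge0 : forall A, measurable A -> A `<=` S -> 0 <=v v A.
Hypothesis v_le : forall A, measurable A -> A `<=` S -> `|v A| <= w A.
Variable lam : R.

Let w_ge0 A : measurable A -> A `<=` S -> 0 <= w A.
Proof. by move=> mA AS; apply: le_trans (v_le mA AS). Qed.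

Let w_mono A B : measurable A -> measurable B -> A `<=` B -> B `<=` S -> w A <= w B.
Proof.
move=> mA mB AB BS; rewrite (wD mA mB AB BS) lerDl w_ge0//.
  exact: measurableD.
by apply: subset_trans BS; exact: subDsetl.
Qed.

Definition set_average A : E := (w A)^-1 *: v A.

Let set_average_ok A : measurable A -> A `<=` S -> ball_ok (set_average A).
Proof.
move=> mA AS; have w0 := w_ge0 mA AS; split.
  by apply: vscale_ge0; [rewrite invr_ge0|exact: v_ge0].
rewrite normrZ ger0_norm ?invr_ge0//.
have [->|wn0] := eqVneq (w A) 0; first by rewrite invr0 mul0r.
by rewrite ler_pdivrMl ?mulr1 ?v_le// lt_neqAle eq_sym wn0.
Qed.

Definition chain_sup (r : seq I) x : E :=
  \big[vsup/0]_(Q <- r) ((\1_(cb Q) x : R) *: set_average (cb Q)).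

Definition bad u (r : seq I) := [set x | lam < `|vsup u (chain_sup r x)|].

Lemma measurable_bad u r : measurable (bad u r).
Proof.
have ss : simple_fun (fun x => vsup u (chain_sup r x)).
  apply: (@simple_fun_comp _ _ _ E E (vsup u)).
  apply: (simple_fun_big vsup 0 r) => Q; apply: simple_fun_restr => //.
  exact: simple_fun_cst.
exact: (@simple_preimage _ _ _ _ _ [set z | lam < `|z|] ss).
Qed.

(** Split off a set Q of largest scale.  The average over A is the combination of the
    averages over Q and its complement in A, with weights proportional to [w].  The
    remaining sets lie inside Q or miss Q, so the induction hypothesis applies to both
    parts, on Q with its average joined to [u], and [bellman_concave] recombines them. *)
Lemma tree_lemma r A u : measurable A -> A `<=` S -> 0 <=v u ->
  (forall Q, Q \in r -> cb Q `<=` A) ->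
  w (A `&` bad u r) <= w A * bellman lam u (set_average A).
Proof.
have [n] := ubnP (size r); elim: n r A u => // n IH r A u rn mA AS u0 rA.
have mB u' r' : measurable (A `&` bad u' r') by apply: measurableI => //; exact: measurable_bad.
have okA : ball_ok (set_average A) by exact: set_average_ok.
have wA := w_ge0 mA AS.
have [wA0|wA0] := eqVneq (w A) 0.
  by rewrite wA0 mul0r -wA0; apply: w_mono => //; exact: subIsetl.
have {}wA0 : 0 < w A by rewrite lt_neqAle eq_sym wA0.
have [->|r0] := eqVneq r [::].
  apply: (@le_trans _ _ (w A * (lam < `|u|)%R%:R)); last first.
    by rewrite ler_pM2l//; exact: bellman_leaf.
  have bE : bad u [::] = [set x | lam < `|u|].
    by apply/seteqP; split => x; rewrite /bad /chain_sup /= big_nil;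
      (have -> : vsup u 0 = u by
        apply: vle_anti; [apply: vsup_lub => //; exact: vle_refl|exact: vsup_ubl]).
  rewrite bE; case: (ltP lam `|u|) => h; rewrite ?mulr1 ?mulr0.
    apply: w_mono => //.
    by rewrite (_ : [set _ | _] = setT) ?setIT//; apply/seteqP; split.
  have w0 : w set0 = 0.
    have := @wD set0 set0 measurable0 measurable0 (@subset_refl _ _) (@sub0set _ _).
    by rewrite setD0 => /eqP; rewrite -subr_eq subrr eq_sym => /eqP.
  by rewrite (_ : [set _ | _] = set0) ?setI0 ?w0//; apply/seteqP; split.
have [Q rQ maxQ] : exists2 Q, Q \in r & forall Q', Q' \in r -> sc Q' <= sc Q.
  elim: (r) r0 => // Q r' IHr _; have [->|/IHr[Q0 Q0r H]] := eqVneq r' [::].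
    by exists Q; rewrite ?mem_head// => Q'; rewrite inE => /eqP ->.
  have [le|/ltW le] := leP (sc Q0) (sc Q).
    exists Q; rewrite ?mem_head// => Q'; rewrite inE => /predU1P[->//|/H h].
    exact: le_trans h le.
  exists Q0; first by rewrite inE Q0r orbT.
  by move=> Q'; rewrite inE => /predU1P[->//|/H].
pose r1 := [seq Q' <- rem Q r | `[< cb Q' `<=` cb Q >]].
pose r2 := [seq Q' <- rem Q r | ~~ `[< cb Q' `<=` cb Q >]].
have memr Q' : Q' \in r -> [\/ Q' = Q, Q' \in r1 | Q' \in r2].
  move=> Q'r; have [->|Q'Q] := eqVneq Q' Q; first by constructor 1.
  have Q'rem : Q' \in rem Q r.
    by move: Q'r; rewrite (perm_mem (perm_to_rem rQ)) inE (negbTE Q'Q).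
  have [h|h] := boolP (`[< cb Q' `<=` cb Q >]).
    by constructor 2; rewrite mem_filter h.
  by constructor 3; rewrite mem_filter h.
have r1P Q' : Q' \in r1 -> cb Q' `<=` cb Q.
  by rewrite mem_filter => /andP[/asboolP].
have r2P Q' x : Q' \in r2 -> cb Q x -> ~ cb Q' x.
  rewrite mem_filter => /andP[/asboolP n2 /mem_rem Q'r] Qx Q'x; apply: n2.
  by apply: lamin Q'x Qx; exact: maxQ.
have srem : (size (rem Q r) < n)%N by rewrite size_rem//; case: (r) rQ rn.
have s1 : (size r1 < n)%N by apply: leq_ltn_trans srem; rewrite size_filter count_size.
have s2 : (size r2 < n)%N by apply: leq_ltn_trans srem; rewrite size_filter count_size.
have QA := rA _ rQ.
have QS : cb Q `<=` S by exact: subset_trans AS.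
have mAQ : measurable (A `\` cb Q) by exact: measurableD.
have AQS : A `\` cb Q `<=` S by apply: subset_trans AS; exact: subDsetl.
have okQ : ball_ok (set_average (cb Q)) by exact: set_average_ok.
have okAQ : ball_ok (set_average (A `\` cb Q)) by exact: set_average_ok.
have val_ge0 Q' : Q' \in r -> 0 <=v set_average (cb Q').
  by move=> /rA h; have [] := @set_average_ok (cb Q') (mcb Q') (subset_trans h AS).
have mbad u' r' := measurable_bad u' r'.
have split_bad : w (A `&` bad u r) =
    w (cb Q `&` bad u r) + w ((A `\` cb Q) `&` bad u r).
  rewrite (@wD (cb Q `&` bad u r))//; first last.
  - by apply: subset_trans AS; exact: subIsetl.
  - exact: setSI.
  - exact: measurableI.
  congr (_ + w _); apply/seteqP; split => x /=.
    by move=> [[Ax bx] nx]; split => //; split => // Qx; exact: nx.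
  by move=> [[Ax nQ] bx]; split => // -[].
have ge0_term Q' x : Q' \in r -> 0 <=v (\1_(cb Q') x : R) *: set_average (cb Q').
  by move=> Q'r; apply: vscale_ge0 => //; exact: val_ge0.
have le1 : w (cb Q `&` bad u r) <= w (cb Q) * bellman lam (vsup u (set_average (cb Q))) (set_average (cb Q)).
  apply: le_trans (IH r1 (cb Q) _ s1 (mcb Q) QS _ r1P); last first.
    by apply: vle_trans u0 (vsup_ubl _ _).
  apply: w_mono; [exact: measurableI|exact: measurableI| |].
    move=> x [Qx bx]; split => //; rewrite /bad /=; apply: lt_le_trans bx _.
    apply: vnorm_mono; first by apply: vle_trans u0 (vsup_ubl _ _).
    apply: vsup_lub; first by apply: vle_trans (vsup_ubl _ _) (vsup_ubl _ _).
    apply: vbig_lub => [|Q' Q'r _].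
      by apply: vle_trans (vle_trans _ _ _ u0 (vsup_ubl _ _)) (vsup_ubl _ _).
    have [->|Q'1|Q'2] := memr _ Q'r.
    - rewrite indicE mem_set// scale1r.
      by apply: vle_trans (vsup_ubr _ _) (vsup_ubl _ _).
    - apply: vle_trans (vsup_ubr _ _).
      exact: (vbig_ub (fun Q' => (\1_(cb Q') x : R) *: set_average (cb Q')) Q'1).
    - rewrite indicE memNset ?scale0r; last exact: r2P Q'2 Qx.
      by apply: vle_trans (vle_trans _ _ _ u0 (vsup_ubl _ _)) (vsup_ubl _ _).
  by apply: subset_trans QS; exact: subIsetl.
have le2 : w ((A `\` cb Q) `&` bad u r) <=
    w (A `\` cb Q) * bellman lam (vsup u (set_average (A `\` cb Q))) (set_average (A `\` cb Q)).
  apply: (@le_trans _ _ (w (A `\` cb Q) * bellman lam u (set_average (A `\` cb Q)))); last first.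
    apply: ler_wpM2l; first exact: w_ge0.
    by apply: bellman_mono => //; exact: vsup_ubl.
  apply: le_trans (IH r2 (A `\` cb Q) u s2 mAQ AQS u0 _); last first.
    move=> Q' Q'2 x Q'x; split; last by move=> Qx; exact: r2P Q'2 Qx Q'x.
    apply: rA Q'x; by move: Q'2; rewrite mem_filter => /andP[_ /mem_rem].
  apply: w_mono; [exact: measurableI|exact: measurableI| |].
    move=> x [[Ax nQ] bx]; split => //; rewrite /bad /=; apply: lt_le_trans bx _.
    apply: vnorm_mono; first by apply: vle_trans u0 (vsup_ubl _ _).
    apply: vsup_lub; first exact: vsup_ubl.
    apply: vbig_lub => [|Q' Q'r _]; first by apply: vle_trans u0 (vsup_ubl _ _).
    have [->|Q'1|Q'2] := memr _ Q'r.
    - rewrite indicE memNset// scale0r.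
      by apply: vle_trans u0 (vsup_ubl _ _).
    - rewrite indicE memNset ?scale0r; last by move=> /(r1P _ Q'1).
      by apply: vle_trans u0 (vsup_ubl _ _).
    - apply: vle_trans (vsup_ubr _ _).
      exact: (vbig_ub (fun Q' => (\1_(cb Q') x : R) *: set_average (cb Q')) Q'2).
  by apply: subset_trans AQS; exact: subIsetl.
rewrite split_bad; apply: le_trans (lerD le1 le2) _.
have wAE : w A = w (cb Q) + w (A `\` cb Q) by exact: wD.
have wQ := w_ge0 (mcb Q) QS; have wAQ := w_ge0 mAQ AQS.
pose th := w (cb Q) / w A.
have th01 : 0 <= th <= 1.
  rewrite divr_ge0//= ler_pdivrMr// mul1r wAE lerDl//.
have th1 : 1 - th = w (A `\` cb Q) / w A.
  by rewrite /th -{1}(@divff _ (w A)) ?gt_eqF// -mulrBl wAE addrAC subrr add0r.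
have wv B : measurable B -> B `<=` S -> (w B / w A) *: set_average B = (w A)^-1 *: v B.
  move=> mB' BS; rewrite /set_average scalerA mulrAC.
  have [wB0|wB0] := eqVneq (w B) 0; last by rewrite divff// mul1r.
  rewrite wB0 !mul0r scale0r.
  have : `|v B| <= 0 by rewrite -wB0 v_le.
  by rewrite normr_le0 => /eqP ->; rewrite scaler0.
have := bellman_concave lam th01 u0 okQ okAQ.
rewrite {3}/th th1 !wv// -scalerDr -vD// -/(set_average A).
rewrite -(ler_pM2l wA0); congr (_ <= _).
by rewrite /th; field; rewrite gt_eqF.
Qed.

End tree_lemma.

Section finite_set_functions.
Context {disp} {T : measurableType disp} {R : realType} {E : banachLatticeType R}.
Variable mu : {measure set T -> \bar R}.
Variables (S : set T) (f : T -> E).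
Hypotheses (mS : measurable S) (Soo : (mu S < +oo)%E) (fi : bint mu S f).

Definition meas A : R := fine (mu A).

Lemma meas_ge0 A : 0 <= meas A. Proof. exact: fine_ge0. Qed.

Lemma measE A : (mu A < +oo)%E -> mu A = (meas A)%:E.
Proof. by move=> Aoo; rewrite /meas fineK// ge0_fin_numE. Qed.

Let sub_oo A : measurable A -> A `<=` S -> (mu A < +oo)%E.
Proof. by move=> mA AS; apply: le_lt_trans Soo; apply: le_measure => //; rewrite inE. Qed.

Lemma measD A B : measurable A -> measurable B -> A `<=` B -> B `<=` S ->
  meas B = meas A + meas (B `\` A).
Proof.
move=> mA mB AB BS; have mBA : measurable (B `\` A) by exact: measurableD.
have e : A `|` (B `\` A) = B by rewrite setDUK.
apply: EFin_inj; rewrite EFinD -!measE; first last.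
- exact: sub_oo.
- by apply: sub_oo => //; exact: subset_trans AB BS.
- by apply: sub_oo => //; apply: subset_trans BS; exact: subDsetl.
by rewrite -[in LHS]e measureU//; rewrite setDE setICA setICr setI0.
Qed.

Definition norm_integral A : R := \int[mu]_(x in A) `|f x|.

Lemma norm_integral_ge0 A : 0 <= norm_integral A. Proof. exact: Rintegral_ge0. Qed.

Lemma norm_integralD A B : measurable A -> measurable B -> A `<=` B -> B `<=` S ->
  norm_integral B = norm_integral A + norm_integral (B `\` A).
Proof.
move=> mA mB AB BS; have mBA : measurable (B `\` A) by exact: measurableD.
have e : A `|` (B `\` A) = B by rewrite setDUK.
rewrite /norm_integral -{1}e Rintegral_setU//.
  by rewrite e; apply: bint_norm => //; exact: bint_sub fi.
by apply/disj_set2P; rewrite setDE setICA setICr setI0.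
Qed.

Lemma norm_integral_mono A B : measurable A -> measurable B -> A `<=` B -> B `<=` S ->
  norm_integral A <= norm_integral B.
Proof. by move=> mA mB AB BS; rewrite (norm_integralD mA mB AB BS) lerDl norm_integral_ge0. Qed.

End finite_set_functions.

Section weak_type.
Context {R : realType} {d' : nat} {E : banachLatticeType R}.
Local Notation d := d'.+1.
Variables (p M : R) (p_ge1 : 1 <= p) (M_gt0 : 0 < M).
Hypothesis HLM : (HLnorm d E p <= M%:E)%E.
Variable mu : {measure set (d.-tuple R) -> \bar R}.
Variables (F : dcube d) (f : d.-tuple R -> E) (a : R) (r : seq (dcube d)).
Hypotheses (Foo : (mu (cube F) < +oo)%E) (fi : bint mu (cube F) f).
Hypotheses (f_ge0 : forall x, 0 <=v f x) (a_gt0 : 0 < a).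

Definition average Q : E := (meas mu (cube Q))^-1 *: bochner_integral_on mu (cube Q) f.

Hypothesis rF : forall Q, Q \in r -> @cube R d Q `<=` cube F.
Hypothesis r4 : forall Q, Q \in r -> norm_integral mu f (cube Q) <= 4 * a * meas mu (cube Q).
Hypothesis F4 : norm_integral mu f (cube F) <= 4 * a * meas mu (cube F).

Definition big_set (c : R) := [set x : d.-tuple R |
  c < `|\big[vsup/0]_(Q <- r) ((\1_(cube Q) x : R) *: average Q)|].

Lemma measurable_big_set c : measurable (big_set c).
Proof.
have ss : simple_fun (fun x : d.-tuple R =>
    \big[vsup/0]_(Q <- r) ((\1_(cube Q) x : R) *: average Q)).
  apply: (simple_fun_big vsup 0 r) => Q; apply: simple_fun_restr.
    exact: measurable_cube.
  exact: simple_fun_cst.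
exact: (@simple_preimage _ _ _ _ _ [set z | c < `|z|] ss).
Qed.

(** Measure sets with w = mu + (4 a)^-1 |f| mu, against which v = (4 a)^-1 f mu has
    averages in the unit ball.  On the cubes in question w <= 2 mu, so the averages
    with respect to mu are at most 8 a times those of v with respect to w.  Hence the
    set lies where the supremum of the latter exceeds 8 M; there the Bellman function is
    at most 8^-p <= 1/8, and w F <= 2 mu F leaves 1/4. *)
Lemma weak_type :
  meas mu (cube F `&` big_set (64 * M * a)) <= 4^-1 * meas mu (cube F).
Proof.
have mF : measurable (@cube R d F) by exact: measurable_cube.
have a4 : 0 < 4 * a by rewrite mulr_gt0.
pose w A := meas mu A + (4 * a)^-1 * norm_integral mu f A.
pose v A := (4 * a)^-1 *: bochner_integral_on mu A f.
have wD A B : measurable A -> measurable B -> A `<=` B -> B `<=` cube F ->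
    w B = w A + w (B `\` A).
  move=> mA mB AB BF; rewrite /w (measD mF Foo mA mB AB BF).
  by rewrite (norm_integralD mF fi mA mB AB BF) mulrDr addrACA.
have vD A B : measurable A -> measurable B -> A `<=` B -> B `<=` cube F ->
    v B = v A + v (B `\` A).
  move=> mA mB AB BF; rewrite /v -scalerDr; congr (_ *: _).
  by apply: bochner_setD => //; exact: bint_sub fi.
have v0 A : measurable A -> A `<=` cube F -> 0 <=v v A.
  move=> mA AF; apply: vscale_ge0; first by rewrite invr_ge0 ltW.
  by apply: bochner_ge0 => //; exact: bint_sub fi.
have vle A : measurable A -> A `<=` cube F -> `|v A| <= w A.
  move=> mA AF; rewrite normrZ gtr0_norm ?invr_gt0//.
  apply: (@le_trans _ _ ((4 * a)^-1 * norm_integral mu f A)); last by rewrite lerDr meas_ge0.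
  rewrite ler_pM2l ?invr_gt0//; apply: bochner_norm => //; exact: bint_sub fi.
have lam0 : 0 < 8 * M by rewrite mulr_gt0.
have lamin (Q Q' : dcube d) (x : d.-tuple R) : Q.1 <= Q'.1 -> cube Q x -> cube Q' x ->
    @cube R d Q `<=` cube Q'.
  exact: cube_laminar.
have := @tree_lemma _ _ R E _ (@cube R d) (fun Q => Q.1) (@measurable_cube R d) lamin
   (cube F) w v wD vD v0 vle (8 * M) r (cube F) 0 mF (@subset_refl _ _) (vle_refl _) rF.
set Bd := bad _ _ _ _ _ _ => tl.
have okF : ball_ok (set_average w v (cube F)).
  split.
    apply: vscale_ge0; last exact: v0.
    by rewrite invr_ge0 (le_trans _ (vle _ mF _)).
  rewrite /set_average normrZ; have w0 : 0 <= w (cube F) by exact: le_trans (vle _ mF _).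
  rewrite ger0_norm ?invr_ge0//.
  have [->|wn0] := eqVneq (w (cube F)) 0; first by rewrite invr0 mul0r.
  by rewrite ler_pdivrMl ?mulr1 ?vle// lt_neqAle eq_sym wn0.
have bl := @bellman_HL R d' E p M (8 * M) (lt_le_trans ltr01 p_ge1) (ltW M_gt0) lam0 HLM _ okF.
have mBd : measurable Bd by apply: measurable_bad => Q; exact: measurable_cube.
have sub : cube F `&` big_set (64 * M * a) `<=` cube F `&` Bd.
  move=> x [Fx]; rewrite /big_set /Bd /bad /= => h; split => //.
  rewrite vsup_ler; last exact: vbig_ge0.
  have : `|\big[vsup/0]_(Q <- r) ((\1_(cube Q) x : R) *: average Q)| <=
      8 * a * `|chain_sup (@cube R d) w v r x|.
    rewrite -[X in X * `|_|]gtr0_norm ?mulr_gt0// -normrZ.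
    apply: vnorm_mono; first exact: vbig_ge0.
    apply: vbig_lub => [|Q rQ _].
      by apply: vscale_ge0; [rewrite mulr_ge0// ltW|exact: vbig_ge0].
    apply: (@vle_trans _ _ _ ((8 * a) *: ((\1_(cube Q) x : R) *: set_average w v (cube Q)))).
      rewrite scalerA mulrC -scalerA; apply: vscale_mono => //.
      rewrite /average /set_average /v !scalerA.
      have J0 : 0 <=v bochner_integral_on mu (cube Q) f.
        by apply: bochner_ge0 => //; [exact: measurable_cube|apply: bint_sub fi => //;
          [exact: measurable_cube|exact: rF]].
      apply: vle_subr0; rewrite -scalerBl; apply: vscale_ge0 => //.
      have [->|m0] := eqVneq (meas mu (cube Q)) 0.
        rewrite invr0 subr0 !mulr_ge0 ?invr_ge0//; [exact: ltW| |exact: ltW].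
        by rewrite (le_trans _ (vle _ (measurable_cube Q) (rF rQ))).
      have m1 : 0 < meas mu (cube Q) by rewrite lt_neqAle eq_sym m0 meas_ge0.
      have wm : w (cube Q) <= 2 * meas mu (cube Q).
        rewrite mulr_natl mulr2n /w lerD2l ler_pdivrMl//; exact: r4.
      have wp : 0 < w (cube Q).
        rewrite /w ltr_pwDl// mulr_ge0 ?norm_integral_ge0// invr_ge0 ltW//.
      rewrite subr_ge0 (_ : 8 * a / w (cube Q) / (4 * a) = 2 / w (cube Q)); last first.
        by field; rewrite !gt_eqF.
      by rewrite -div1r ler_pdivrMr// mulrAC ler_pdivlMr// mul1r.
    apply: vscale_mono; first by rewrite mulr_ge0// ltW.
    exact: (vbig_ub (fun Q => (\1_(cube Q) x : R) *: set_average w v (cube Q)) rQ).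
  move=> /(lt_le_trans h); rewrite (_ : 64 * M * a = 8 * a * (8 * M)); last by ring.
  by rewrite ltr_pM2l// mulr_gt0.
have mbig : measurable (cube F `&` big_set (64 * M * a)).
  by apply: measurableI => //; exact: measurable_big_set.
have wmono A B : measurable A -> measurable B -> A `<=` B -> B `<=` cube F -> w A <= w B.
  move=> mA mB AB BF; rewrite (wD A B)// lerDl (le_trans _ (vle _ _ _))//.
    exact: measurableD.
  by apply: subset_trans BF; exact: subDsetl.
apply: (@le_trans _ _ (w (cube F `&` big_set (64 * M * a)))).
  by rewrite /w lerDl mulr_ge0 ?norm_integral_ge0// invr_ge0 ltW.
apply: (@le_trans _ _ (w (cube F `&` Bd))).
  by apply: wmono => //; exact: measurableI.
apply: le_trans tl _.
have wF : w (cube F) <= 2 * meas mu (cube F).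
  by rewrite mulr_natl mulr2n /w lerD2l ler_pdivrMl.
set U := bellman _ _ _ in bl *.
have U0 : 0 <= U by exact: bellman_ge0.
have U8 : 8 * U <= 1.
  have h8 : 8 <= (8 : R) `^ p.
    by rewrite -{1}[8 : R]powRr1// ler_powR// ler1n.
  have Mp : 0 < M `^ p by rewrite powR_gt0.
  rewrite -(ler_pM2r Mp) mul1r; apply: le_trans bl.
  rewrite powRM//; last exact: ltW.
  rewrite [leRHS]mulrAC; apply: ler_wpM2r; first exact: ltW.
  exact: ler_wpM2r.
have m0 := meas_ge0 mu (cube F).
have := ler_wpM2r U0 wF => h1.
have : meas mu (cube F) * (8 * U) <= meas mu (cube F) * 1 by rewrite ler_wpM2l.
move=> h2; lra.
Qed.

End weak_type.

(** * Principal cubes *)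

Section families.
Context {R : realType} {d : nat}.
Hypothesis d_gt0 : (0 < d)%N.
Local Notation cube := (@cube R d).
Local Notation "Q <=c F" := (@subcube R d Q F) (at level 70).
Implicit Types (Q F : dcube d) (s r : seq (dcube d)).

Lemma subcubeP Q F : reflect (cube Q `<=` cube F) (Q <=c F).
Proof. exact: asboolP. Qed.

Lemma subcube_refl Q : Q <=c Q. Proof. by apply/subcubeP. Qed.

Lemma subcube_trans Q F G : Q <=c F -> F <=c G -> Q <=c G.
Proof. by move=> /subcubeP QF /subcubeP FG; apply/subcubeP; exact: subset_trans FG. Qed.

Lemma subcube_anti Q F : Q <=c F -> F <=c Q -> Q = F.
Proof. by move=> /subcubeP QF /subcubeP FQ; exact: cube_inj QF FQ. Qed.

Lemma subcube_scale Q F (x : d.-tuple R) : cube Q x -> cube F x -> Q.1 <= F.1 -> Q <=c F.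
Proof. by move=> Qx Fx QF; apply/subcubeP; exact: cube_laminar Qx Fx. Qed.

Lemma subcube_total Q F G : Q <=c F -> Q <=c G -> F <=c G \/ G <=c F.
Proof.
move=> /subcubeP QF /subcubeP QG; have Qx := @corner_in R d Q.
have [h|/ltW h] := leP F.1 G.1; [left|right];
  by apply: (subcube_scale (x := corner Q)) => //; [exact: QF|exact: QG]
  || by apply: (subcube_scale (x := corner Q)) => //; [exact: QG|exact: QF].
Qed.

(** Induction that removes a smallest cube first. *)
Lemma seq_scale_ind (P : seq (dcube d) -> Prop) :
  (forall r r', perm_eq r r' -> P r -> P r') -> P [::] ->
  (forall Q r, (forall Q', Q' \in r -> Q.1 <= Q'.1) -> P r -> P (Q :: r)) ->
  forall r, P r.
Proof.
move=> Pperm P0 PS r; pose leS := (fun Q Q' : dcube d => Q.1 <= Q'.1).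
have leS_tot : total leS by move=> Q Q'; exact: le_total.
have leS_tr : transitive leS by move=> Q Q' Q''; exact: le_trans.
apply: (@Pperm (sort leS r)); first by rewrite perm_sort.
have := sort_sorted leS_tot r; elim: (sort leS r) => // Q r' IH /= pr.
apply: PS; last exact/IH/(path_sorted pr).
by move=> Q' Q'r; have /allP/(_ _ Q'r) := order_path_min leS_tr pr.
Qed.

Lemma min_cube r x : (exists2 Q, Q \in r & cube Q x) ->
  exists Q, [/\ Q \in r, cube Q x & forall Q', Q' \in r -> cube Q' x -> Q <=c Q'].
Proof.
move: r; apply: seq_scale_ind => [r r' rr' H [Q Qr Qx]|[]//|Q r Qmin IH [Q0 Q0r Q0x]].
  case: H => [|Q0 [Q0r Q0x H]]; first by exists Q => //; rewrite (perm_mem rr').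
  by exists Q0; split => // [|Q' Q'r]; [rewrite -(perm_mem rr')|apply: H; rewrite (perm_mem rr')].
have [Qx|Qx] := pselect (cube Q x).
  exists Q; rewrite mem_head; split => // Q'; rewrite inE => /predU1P[->|Q'r] Q'x.
    exact: subcube_refl.
  by apply: (subcube_scale Qx Q'x); exact: Qmin.
case: IH => [|Q1 [Q1r Q1x H]].
  by move: Q0r; rewrite inE => /predU1P[e|]; [rewrite e in Q0x|exists Q0].
exists Q1; split => //; first by rewrite inE Q1r orbT.
by move=> Q'; rewrite inE => /predU1P[->//|/H].
Qed.

Lemma max_cube r F x : (exists Q, [/\ Q \in r, Q <=c F & cube Q x]) ->
  exists Q, [/\ Q \in r, Q <=c F, cube Q x &
    forall Q', Q' \in r -> Q <=c Q' -> Q' <=c F -> Q' = Q].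
Proof.
move: r; apply: seq_scale_ind => [r r' rr' H [Q [Qr QF Qx]]|[Q []//]|Q r Qmin IH [Q0 [Q0r Q0F Q0x]]].
  case: H => [|Q0 [Q0r Q0F Q0x H]]; first by exists Q; rewrite (perm_mem rr').
  by exists Q0; split => // [|Q' Q'r]; [rewrite -(perm_mem rr')|apply: H; rewrite (perm_mem rr')].
have [[Q1 [Q1r Q1F Q1x]]|nr] := pselect (exists Q, [/\ Q \in r, Q <=c F & cube Q x]).
  case: IH => [|Q2 [Q2r Q2F Q2x H]]; first by exists Q1.
  exists Q2; split => //; first by rewrite inE Q2r orbT.
  move=> Q'; rewrite inE => /predU1P[->|/H h] h1 h2; last exact: h.
  apply/esym/subcube_anti => //; apply: (subcube_scale _ Q2x); last exact: Qmin.
  by move: Q2x; exact/subcubeP.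
exists Q; rewrite mem_head.
have QQ0 : Q = Q0.
  by move: Q0r; rewrite inE => /predU1P[->//|Q0r]; case: nr; exists Q0.
rewrite -QQ0 in Q0F Q0x; split => // Q'; rewrite inE => /predU1P[//|Q'r] QQ' Q'F.
by case: nr; exists Q'; split => //; move: Q0x; exact/subcubeP.
Qed.

Variable stop : dcube d -> dcube d -> Prop.

Definition parent_in r Q F := [/\ F \in r, Q <=c F, Q <> F &
  forall F', F' \in r -> Q <=c F' -> Q <> F' -> F <=c F'].

(** [stop F Q] is the selection rule; it is only tested against the smallest member of
    the family that strictly contains the cube, and holds vacuously for maximal cubes. *)
Definition stops r Q := forall F, parent_in r Q F -> stop F Q.

(** Membership of a cube depends only on larger members, so the family is built from
    large cubes to small ones. *)
Lemma stopping_family s : uniq s -> exists Fm : seq (dcube d),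
  [/\ uniq Fm, {subset Fm <= s} & forall Q, Q \in s -> (Q \in Fm <-> stops Fm Q)].
Proof.
move: s; apply: seq_scale_ind => [r r' rr' H|_|Q r Qmin IH /= /andP[Qr /IH]].
- rewrite -(perm_uniq rr') => /H [Fm [uF Fs H']]; exists Fm; split => //.
    by move=> F /Fs; rewrite (perm_mem rr').
  by move=> Q; rewrite -(perm_mem rr'); exact: H'.
- by exists [::].
- move=> [Fm [uF Fs H]].
  have QFm : Q \notin Fm by apply: contra Qr; exact: Fs.
  have nQ Q' : Q' \in r -> ~ (Q' <=c Q).
    move=> Q'r Q'Q; have h : Q <=c Q'.
      apply: (subcube_scale (x := corner Q')); [|exact: corner_in|exact: Qmin].
      by move/subcubeP : Q'Q; apply; exact: corner_in.
    by move/negP : Qr; apply; rewrite (subcube_anti h Q'Q).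
  have parE Q' F : Q' \in Q :: r -> parent_in (Q :: Fm) Q' F <-> parent_in Fm Q' F.
    move=> Q'r; have nQQ : Q' <=c Q -> Q' <> Q -> False.
      by move: Q'r; rewrite inE => /predU1P[-> //|/nQ].
    split => -[h1 h2 h3 h4]; split => //.
    - move: h1; rewrite inE => /predU1P[e|//]; rewrite e in h2 h3.
      by case: (nQQ h2 h3).
    - by move=> F' F'r; apply: h4; rewrite inE F'r orbT.
    - by rewrite inE h1 orbT.
    - move=> F'; rewrite inE => /predU1P[-> h5 h6|]; last exact: h4.
      by case: (nQQ h5 h6).
  have stE Q' : Q' \in Q :: r -> stops (Q :: Fm) Q' <-> stops Fm Q'.
    by move=> Q'r; split => h F /(parE _ _ Q'r); exact: h.
  have [sQ|nsQ] := pselect (stops Fm Q).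
    exists (Q :: Fm); split.
    - by rewrite /= QFm.
    - move=> F; rewrite !inE => /predU1P[->|/Fs ->]; rewrite ?eqxx ?orbT//.
    - move=> Q' Q'r; rewrite (stE _ Q'r); move: Q'r; rewrite !inE.
      move=> /predU1P[->|Q'r]; first by rewrite eqxx; split.
      have -> : (Q' == Q) = false.
        by apply/negbTE; apply: contra Qr => /eqP <-.
      exact: H.
  exists Fm; split => //; first by move=> F /Fs; rewrite inE => ->; rewrite orbT.
  move=> Q'; rewrite inE => /predU1P[->|]; last exact: H.
  by rewrite (negbTE QFm); split.
Qed.

Variables (s Fm : seq (dcube d)).
Hypotheses (Fs : {subset Fm <= s}).
Hypothesis FmP : forall Q, Q \in s -> (Q \in Fm <-> stops Fm Q).

Definition is_principal Q F := [/\ F \in Fm, Q <=c F & forall F', F' \in Fm -> Q <=c F' -> F <=c F'].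

(** The default [Q] of [xget] is never used for cubes of the collection. *)
Definition principal Q := xget Q [set F | is_principal Q F].

Lemma cube_sub_corner Q F : Q <=c F -> cube F (corner Q).
Proof. by move=> /subcubeP; apply; exact: corner_in. Qed.

Lemma principalP Q : Q \in s -> is_principal Q (principal Q).
Proof.
move=> Qs; suff [F HF] : exists F, is_principal Q F by exact: xgetPex (ex_intro _ F HF).
have [F Fm_ QF] : exists2 F, F \in Fm & Q <=c F.
  have [QF|nQF] := boolP (Q \in Fm); first by exists Q => //; exact: subcube_refl.
  have := FmP Qs; rewrite (negbTE nQF) => -[_ h].
  apply: contrapT => nF; suff : false by []; apply: h => F [FF QF _ _].
  by case: nF; exists F.
pose rQ := [seq F <- Fm | Q <=c F].
have [|F0 [F0r F0x H]] := @min_cube rQ (corner Q).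
  by exists F; [rewrite mem_filter QF|exact: cube_sub_corner].
move: F0r; rewrite mem_filter => /andP[QF0 F0m]; exists F0; split => // F' F'm QF'.
by apply: H; [rewrite mem_filter QF'|exact: cube_sub_corner].
Qed.

Lemma principal_between Q Q' : Q \in s -> Q' \in s -> Q <=c Q' -> Q' <=c principal Q -> principal Q' = principal Q.
Proof.
move=> /principalP[a1 a2 a3] /principalP[b1 b2 b3] QQ' Q'p; apply: subcube_anti.
  exact: b3.
by apply: a3 => //; exact: subcube_trans QQ' b2.
Qed.

Lemma principal_id F : F \in Fm -> principal F = F.
Proof.
move=> FF; have [h1 h2 h3] := principalP (Fs FF); apply: subcube_anti => //.
by apply: h3 => //; exact: subcube_refl.
Qed.

Lemma principal_nstop Q : Q \in s -> Q <> principal Q -> ~ stop (principal Q) Q.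
Proof.
move=> Qs Qp st; have [h1 h2 h3] := principalP Qs.
have QF : Q \in Fm.
  apply/(FmP Qs) => F [f1 f2 f3 f4].
  suff -> : F = principal Q by [].
  apply: subcube_anti; last exact: h3.
  by apply: f4 => //.
by apply: Qp; rewrite principal_id.
Qed.

Lemma parent_stop F Q : Q \in Fm -> parent_in Fm Q F -> stop F Q.
Proof. by move=> QF; move/(FmP (Fs QF)) : (QF); apply. Qed.

End families.

Section set_sums.
Context {R : realType} {d : nat}.
Variables (S : set (d.-tuple R)) (g : set (d.-tuple R) -> R).
Hypothesis gD : forall A B, measurable A -> measurable B -> A `<=` B -> B `<=` S ->
  g B = g A + g (B `\` A).
Hypothesis g_ge0 : forall A, 0 <= g A.

Lemma sum_disjoint_le (L : seq (dcube d)) B : measurable B -> B `<=` S -> uniq L ->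
  (forall Q, Q \in L -> @cube R d Q `<=` B) ->
  (forall Q Q' (x : d.-tuple R), Q \in L -> Q' \in L -> cube Q x -> cube Q' x -> Q = Q') ->
  \sum_(Q <- L) g (cube Q) <= g B.
Proof.
elim: L B => [|Q L IH] B mB BS /=; first by rewrite big_nil.
move=> /andP[QL uL] LB disj; rewrite big_cons.
have QB : @cube R d Q `<=` B by apply: LB; rewrite mem_head.
rewrite (gD (measurable_cube Q) mB QB BS) lerD2l; apply: IH => //.
- by apply: measurableD => //; exact: measurable_cube.
- by apply: subset_trans BS; exact: subDsetl.
- move=> Q' Q'L x Q'x; split; first by apply: LB Q'x; rewrite inE Q'L orbT.
  move=> Qx; move/negP : QL; apply.
  by rewrite (disj Q Q' x)// ?mem_head// inE Q'L orbT.
- by move=> Q1 Q2 x Q1L Q2L; apply: disj; rewrite inE ?Q1L ?Q2L orbT.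
Qed.

Lemma setfun_mono A B : measurable A -> measurable B -> A `<=` B -> B `<=` S -> g A <= g B.
Proof. by move=> mA mB AB BS; rewrite (gD mA mB AB BS) lerDl. Qed.

Lemma setfun_setU A B : measurable A -> measurable B -> A `<=` S -> B `<=` S ->
  g (A `|` B) <= g A + g B.
Proof.
move=> mA mB AS BS; have AB : A `|` B `<=` S by rewrite subUset.
rewrite (@gD A (A `|` B))//; last exact: measurableU.
rewrite lerD2l; apply: setfun_mono => //.
  by apply: measurableD => //; exact: measurableU.
by move=> x [[]].
Qed.

Lemma setfun_bigU (I : choiceType) (L : seq I) (P : pred I) (c : I -> set (d.-tuple R)) :
  (forall i, measurable (c i)) -> (forall i, i \in L -> P i -> c i `<=` S) ->
  g (\big[setU/set0]_(i <- L | P i) c i) <= \sum_(i <- L | P i) g (c i).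
Proof.
move=> mc; elim: L => [|i L IH] LS.
  rewrite !big_nil; have := gD measurable0 measurable0 (@subset_refl _ _) (@sub0set _ _).
  by rewrite setD0 => /eqP; rewrite -subr_eq subrr eq_sym => /eqP ->.
have {}IH := IH (fun j jL => LS j (@mem_behead _ (i :: L) _ jL)).
rewrite !big_cons; case: ifP => // Pi; apply: le_trans (lerD (lexx _) IH).
apply: setfun_setU => //; [exact: bigsetU_measurable|by apply: LS => //; exact: mem_head|].
rewrite -bigcup_seq_cond => x [j /andP[jL Pj]]; apply: LS => //.
by rewrite inE jL orbT.
Qed.

End set_sums.

Section sparse.
Context {R : realType} {d' : nat} {E : banachLatticeType R}.
Local Notation d := d'.+1.
Local Notation cube := (@cube R d).
Local Notation "Q <=c F" := (@subcube R d Q F) (at level 70).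
Variables (p M : R) (p_ge1 : 1 <= p) (M_gt0 : 0 < M).
Hypothesis HLM : (HLnorm d E p <= M%:E)%E.
Variable mu : {measure set (d.-tuple R) -> \bar R}.
Variables (f : d.-tuple R -> E) (s : seq (dcube d)).
Hypotheses (f_ge0 : forall x, 0 <=v f x).
Hypothesis s_oo : forall Q, Q \in s -> (mu (cube Q) < +oo)%E.
Hypothesis s_gt0 : forall Q, Q \in s -> 0 < meas mu (cube Q).
Hypothesis s_int : forall Q, Q \in s -> bint mu (cube Q) f.

Definition norm_average F : R := norm_integral mu f (cube F) / meas mu (cube F).

(** The second alternative bounds the norm of a lattice supremum over the chain of
    cubes from [Q] to [F] rather than that of a single average; this is where the
    lattice maximal function enters. *)
Definition lstop F Q : Prop := 4 * norm_average F * meas mu (cube Q) < norm_integral mu f (cube Q) \/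
  64 * M * norm_average F < `|\big[vsup/0]_(Q' <- s | (Q <=c Q') && (Q' <=c F)) average mu f Q'|.

Variable Fm : seq (dcube d).
Hypotheses (uFm : uniq Fm) (Fs : {subset Fm <= s}).
Hypothesis FmP : forall Q, Q \in s -> (Q \in Fm <-> stops (R := R) lstop Fm Q).

Definition core F : set (d.-tuple R) :=
  cube F `\` \big[setU/set0]_(F' <- Fm | (F' <=c F) && (F' != F)) cube F'.

Let mcube Q : measurable (cube Q). Proof. exact: measurable_cube. Qed.

Lemma measurable_core F : measurable (core F).
Proof. by apply: measurableD => //; exact: bigsetU_measurable. Qed.

Lemma norm_average_ge0 F : 0 <= norm_average F.
Proof. by rewrite divr_ge0 ?norm_integral_ge0 ?meas_ge0. Qed.

Lemma norm_averageM F : F \in s -> norm_average F * meas mu (cube F) = norm_integral mu f (cube F).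
Proof. by move=> Fs'; rewrite divfK// gt_eqF// s_gt0. Qed.

Lemma core_disjoint F F' (x : d.-tuple R) : F \in Fm -> F' \in Fm ->
  core F x -> core F' x -> F = F'.
Proof.
move=> FF FF' [Fx nF] [F'x nF']; have [//|neq] := eqVneq F F'.
have [h|/ltW h] := leP F.1 F'.1.
  case: nF'; rewrite -bigcup_seq_cond; exists F => //.
  by rewrite /= FF neq andbT; exact: (subcube_scale Fx F'x).
case: nF; rewrite -bigcup_seq_cond; exists F' => //.
by rewrite /= FF' eq_sym neq andbT; exact: (subcube_scale F'x Fx).
Qed.

(** Maximal members inside [F] come in two kinds.  Where the average of |f| has grown
    by a factor 4, they are disjoint and cover at most a quarter of [F].  The others lie
    in the set where the supremum of the averages over cubes that are not heavy is
    large, which is at most another quarter by [weak_type]. *)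
Lemma sparse F : F \in Fm -> meas mu (cube F) <= 2 * meas mu (core F).
Proof.
move=> FF; have Fs' := Fs FF; have Foo := s_oo Fs'; have Fint := s_int Fs'.
have gD A B : measurable A -> measurable B -> A `<=` B -> B `<=` cube F ->
    meas mu B = meas mu A + meas mu (B `\` A) by exact: measD.
have nD A B : measurable A -> measurable B -> A `<=` B -> B `<=` cube F ->
    norm_integral mu f B = norm_integral mu f A + norm_integral mu f (B `\` A) by exact: norm_integralD.
pose child Q := `[< parent_in (R := R) Fm Q F >].
pose heavy Q := 4 * norm_average F * meas mu (cube Q) < norm_integral mu f (cube Q).
have childF Q : child Q -> Q <=c F by move=> /asboolP[].
pose L := [seq Q <- Fm | child Q & heavy Q].
pose U1 := \big[setU/set0]_(Q <- L) cube Q.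
pose r := [seq Q <- s | (Q <=c F) && ~~ heavy Q].
pose U2 := cube F `&` big_set mu f r (64 * M * norm_average F).
have m0 := meas_ge0 mu (cube F).
have mU1 : measurable U1 by exact: bigsetU_measurable.
have mU2 : measurable U2 by apply: measurableI => //; exact: measurable_big_set.
have U1F : U1 `<=` cube F.
  rewrite /U1 -bigcup_seq => x [Q /=]; rewrite mem_filter => /andP[/andP[/childF/subcubeP + _] _].
  exact.
have disj Q Q' (x : d.-tuple R) : Q \in L -> Q' \in L -> cube Q x -> cube Q' x -> Q = Q'.
  rewrite !mem_filter => /andP[/andP[/asboolP c1 _] Q1] /andP[/andP[/asboolP c2 _] Q2] Qx Q'x.
  have aux G G' : parent_in (R := R) Fm G F -> parent_in (R := R) Fm G' F ->
      G' \in Fm -> G <=c G' -> G = G'.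
    move=> [_ _ _ h] [_ G'F G'nF _] G'm GG'; apply: contrapT => ne.
    by apply: G'nF; apply: (@subcube_anti R d isT) => //; exact: h.
  have [h|/ltW h] := leP Q.1 Q'.1; first by apply: aux => //; exact: (subcube_scale Qx Q'x).
  by apply/esym/aux => //; exact: (subcube_scale Q'x Qx).
have childP Q x : Q \in Fm -> Q <=c F -> Q != F -> cube Q x ->
    exists2 Q0, Q0 \in Fm & parent_in (R := R) Fm Q0 F /\ cube Q0 x.
  move=> QFm QF QnF Qx.
  have [|Q0 [Q0F Q0sub Q0x H]] := @max_cube R d isT [seq Q <- Fm | Q != F] F x.
    by exists Q; split => //; rewrite mem_filter QnF.
  move: Q0F; rewrite mem_filter => /andP[Q0nF Q0Fm]; exists Q0 => //; split => //.
  split => //; first by apply/eqP.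
  move=> F' F'm Q0F' Q0nF'; have [//|F'F] := subcube_total Q0sub Q0F'.
  have [->|F'nF] := eqVneq F' F; first exact: subcube_refl.
  by case: Q0nF'; rewrite (H F')// mem_filter F'nF.
have [a0|a0] := eqVneq (norm_average F) 0.
  (* f vanishes almost everywhere on F, so no smaller cube in F is selected. *)
  suff -> : core F = cube F by rewrite mulr_natl mulr2n lerDl.
  rewrite /core big1_seq ?setD0// => Q /andP[/andP[QF QnF] QFm]; exfalso.
  have [Q0 Q0Fm [par _]] := childP _ _ QFm QF QnF (corner_in Q).
  have zero Q' : Q' <=c F -> norm_integral mu f (cube Q') = 0.
    move=> /subcubeP Q'F; apply/eqP; rewrite eq_le norm_integral_ge0 andbT.
    have := norm_averageM Fs'; rewrite a0 mul0r => ->.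
    by apply: (@norm_integral_mono _ _ _ _ mu (cube F)) => //; exact: Fint.
  have Q0F : Q0 <=c F by case: par.
  have := parent_stop Fs FmP Q0Fm par; rewrite /lstop a0 !mulr0 !mul0r zero//.
  rewrite ltxx => -[//|].
  suff -> : \big[vsup/0]_(Q' <- s | (Q0 <=c Q') && (Q' <=c F)) average mu f Q' = 0.
    by rewrite normr0 ltxx.
  apply: vle_anti; last exact: vbig_ge0.
  apply: vbig_lub => [|Q' Q's /andP[_ Q'F]]; first exact: vle_refl.
  suff -> : average mu f Q' = 0 by exact: vle_refl.
  have : `|bochner_integral_on mu (cube Q') f| <= 0.
    by rewrite -(zero _ Q'F); apply: bochner_norm => //; exact: s_int.
  by rewrite normr_le0 /average => /eqP ->; rewrite scaler0.
have {}a0 : 0 < norm_average F by rewrite lt_neqAle eq_sym a0 norm_average_ge0.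
have nF : norm_integral mu f (cube F) <= 4 * norm_average F * meas mu (cube F).
  by rewrite -mulrA norm_averageM// ler_peMl ?norm_integral_ge0// ler1n.
have wt : meas mu U2 <= 4^-1 * meas mu (cube F).
  apply: (weak_type p_ge1 M_gt0 HLM Foo Fint f_ge0 a0) => // Q.
    by rewrite mem_filter => /andP[/andP[/subcubeP]].
  by rewrite mem_filter => /andP[/andP[_]]; rewrite /heavy -leNgt.
have LF Q : Q \in L -> cube Q `<=` cube F.
  by rewrite mem_filter => /andP[/andP[/childF/subcubeP]].
have h1 : meas mu U1 <= 4^-1 * meas mu (cube F).
  have e1 : meas mu U1 <= \sum_(Q <- L) meas mu (cube Q).
    apply: (setfun_bigU gD (meas_ge0 mu)) => // Q QL _; exact: LF.
  have e2 : \sum_(Q <- L) norm_integral mu f (cube Q) <= norm_integral mu f (cube F).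
    by apply: (sum_disjoint_le nD (norm_integral_ge0 mu f)) => //; exact: filter_uniq.
  have e3 : 4 * norm_average F * \sum_(Q <- L) meas mu (cube Q) <= \sum_(Q <- L) norm_integral mu f (cube Q).
    rewrite mulr_sumr; rewrite !big_seq; apply: ler_sum => Q.
    by rewrite mem_filter => /andP[/andP[_ /ltW]].
  have := le_trans e3 e2; rewrite -(norm_averageM Fs') -mulrA (mulrCA 4).
  by rewrite ler_pM2l// => e4; apply: le_trans e1 _; lra.
(* A point outside the core lies in a maximal member inside F. *)
have cov : cube F `<=` core F `|` (U1 `|` U2).
  move=> x Fx; have [cx|ncx] := pselect (core F x); first by left.
  right; have [Q [QFm QF QnF Qx]] : exists Q, [/\ Q \in Fm, Q <=c F, Q != F & cube Q x].
    apply: contrapT => nQ; apply: ncx; split => //.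
    rewrite -bigcup_seq_cond => -[Q /= /andP[QFm /andP[QF QnF]] Qx].
    by apply: nQ; exists Q.
  have [Q0 Q0Fm [par Q0x]] := childP _ _ QFm QF QnF Qx.
  have [_ Q0F Q0nF Q0min] := par.
  have [hv|nhv] := boolP (heavy Q0).
    left; rewrite /U1 -bigcup_seq; exists Q0 => //=.
    by rewrite mem_filter hv Q0Fm !andbT; apply/asboolP.
  right; split => //; have := parent_stop Fs FmP Q0Fm par.
  move=> [|]; first by rewrite -/(heavy Q0) (negbTE nhv).
  rewrite /big_set /=; move=> /lt_le_trans; apply.
  apply: vnorm_mono; first exact: vbig_ge0.
  apply: vbig_lub => [|Q' Q's /andP[Q0Q' Q'F]]; first exact: vbig_ge0.
  have Q'r : Q' \in r.
    rewrite mem_filter Q'F Q's !andbT /=; apply/negP => hv.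
    have [e|Q'nF] := eqVneq Q' F; first by move: hv; rewrite e /heavy ltNge nF.
    have [e|Q'nQ0] := eqVneq Q' Q0; first by move: nhv; rewrite -e hv.
    have [p1 p2 p3] := principalP FmP Q's.
    have pF : @principal R d Fm Q' = F.
      apply: (@subcube_anti R d isT) => //; first exact: p3.
      apply: Q0min => //; first exact: subcube_trans Q0Q' p2.
      move=> e; move/eqP : Q'nQ0; apply; apply: (@subcube_anti R d isT) => //.
      by rewrite e.
    have := @principal_nstop R d isT _ _ _ Fs FmP _ Q's; rewrite pF => /(_ (elimN eqP Q'nF)).
    by apply; left.
  have Q'x : cube Q' x by move/subcubeP : Q0Q'; exact.
  have := @vbig_ub R E _ r xpredT (fun Q => (\1_(cube Q) x : R) *: average mu f Q) _ Q'r isT.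
  by rewrite indicE mem_set// scale1r.
have h2 : meas mu (cube F) <= meas mu (core F) + (meas mu U1 + meas mu U2).
  have mc := measurable_core F.
  have cF : core F `<=` cube F by exact: subDsetl.
  have U2F : U2 `<=` cube F by exact: subIsetl.
  have U12F : U1 `|` U2 `<=` cube F by rewrite subUset.
  have mU12 : measurable (U1 `|` U2) by exact: measurableU.
  apply: (@le_trans _ _ (meas mu (core F `|` (U1 `|` U2)))).
    apply: (setfun_mono gD (meas_ge0 mu)) => //; first exact: measurableU.
    by rewrite subUset.
  apply: le_trans (setfun_setU gD (meas_ge0 mu) mc mU12 cF U12F) _.
  by rewrite lerD2l; exact: (setfun_setU gD (meas_ge0 mu) mU1 mU2 U1F U2F).
lra.
Qed.

End sparse.

(** * Carleson embedding and packing *)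

Section conjugate_exponents.
Context {R : realType}.
Variables (p p' : R) (p_gt1 : 1 < p) (pp' : p^-1 + p'^-1 = 1).

Lemma conjugate_gt1 : 1 < p'.
Proof.
have p_gt0 : 0 < p by exact: lt_trans ltr01 p_gt1.
have h : p'^-1 = 1 - p^-1 by rewrite -pp' addrAC subrr add0r.
have pV : p^-1 < 1 by rewrite invf_lt1.
have h0 : 0 < p'^-1 by rewrite h subr_gt0.
by rewrite -[p']invrK invf_gt1// h ltrBlDr ltrDl invr_gt0.
Qed.

Lemma conjugateM : (p - 1) * p' = p.
Proof.
have p0 : p != 0 by rewrite gt_eqF// (lt_trans ltr01).
have p'0 : p' != 0 by rewrite gt_eqF// (lt_trans ltr01 conjugate_gt1).
have /(congr1 ( *%R (p * p'))) := pp'; rewrite mulrDr mulr1 mulrAC divff//.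
by rewrite mul1r -mulrA divff// mulr1 => e; rewrite mulrBl mul1r -e; ring.
Qed.

End conjugate_exponents.

(** The fundamental theorem of calculus for t^p on [m, a], where t <= a, with Young's
    inequality in place of the integral. *)
Lemma doob_scalar (R : realType) (p p' m a : R) : 1 < p -> p^-1 + p'^-1 = 1 ->
  0 <= m -> m < a ->
  a `^ p - m `^ p <= p' * ((a `^ (p - 1) - m `^ (p - 1)) * a).
Proof.
move=> p1 pp' m0 ma; have a0 : 0 < a by exact: le_lt_trans ma.
have p0 : 0 < p by exact: lt_trans p1.
have p'0 : 0 < p' by apply: lt_trans (conjugate_gt1 p1 pp').
have powS : a `^ (p - 1) * a = a `^ p by rewrite mulrC mulr_powRB1// ltW.
rewrite mulrBl powS.
have := @conjugate_powR R (m `^ (p - 1)) a p' p (powR_ge0 _ _) (ltW a0) p'0 p0.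
rewrite addrC => /(_ pp'); rewrite -powRrM (conjugateM p1 pp') => h.
have /(ler_wpM2l (ltW p'0)) := h.
have p'p : p' / p = p' - 1.
  have -> : p^-1 = 1 - p'^-1 by rewrite -pp' addrK.
  by rewrite mulrBr mulr1 divff// gt_eqF.
rewrite mulrDr [p' * (_ / p')]mulrC divfK ?gt_eqF// [p' * (_ / p)]mulrCA p'p.
lra.
Qed.

Lemma doob_step (R : realType) (c a1 a0 b1 b0 s a X Y : R) : 0 <= s ->
  a0 * s + X <= c * (b0 * (a * s) + Y) ->
  a1 - a0 <= c * ((b1 - b0) * a) ->
  a1 * s + X <= c * (b1 * (a * s) + Y).
Proof. by move=> s0 h1 /(ler_wpM2r s0) h2; lra. Qed.

Section carleson.
Context {R : realType} {d' : nat} {E : banachLatticeType R}.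
Local Notation d := d'.+1.
Local Notation cube := (@cube R d).
Local Notation "Q <=c F" := (@subcube R d Q F) (at level 70).
Variables (p p' : R) (p_gt1 : 1 < p) (pp' : p^-1 + p'^-1 = 1).
Variable mu : {measure set (d.-tuple R) -> \bar R}.
Variables (f : d.-tuple R -> E) (S : set (d.-tuple R)).
Hypotheses (mS : measurable S) (Soo : (mu S < +oo)%E) (fi : bint mu S f).
Local Notation av Q := (norm_average mu f Q).

Let p_gt0 : 0 < p. Proof. exact: lt_trans ltr01 p_gt1. Qed.
Let p'_gt1 : 1 < p'. Proof. exact: conjugate_gt1 pp'. Qed.
Let p'_gt0 : 0 < p'. Proof. exact: lt_trans ltr01 p'_gt1. Qed.
Let p'M : (p - 1) * p' = p. Proof. exact: conjugateM pp'. Qed.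

(** Doob's maximal function of |f| for the cubes of [r]. *)
Definition runmax r (x : d.-tuple R) : R :=
  \big[Num.max/0]_(Q <- r) (\1_(cube Q) x * av Q).

Let simple_runmax r : simple_fun (runmax r : d.-tuple R -> R^o).
Proof.
apply: (@simple_fun_big _ _ _ R^o Num.max 0) => Q.
apply: (@simple_fun_comp2 _ _ _ R^o R^o R^o *%R).
  by apply: simple_fun_indic; exact: measurable_cube.
exact: simple_fun_cst.
Qed.

Lemma runmax_ge0 r x : 0 <= runmax r x.
Proof. by rewrite /runmax; elim/big_rec : _ => // Q y _ y0; rewrite le_max y0 orbT. Qed.

Lemma runmax_ub r x Q : Q \in r -> cube Q x -> av Q <= runmax r x.
Proof.
rewrite /runmax; elim: r => // Q' r IH; rewrite inE big_cons le_max.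
move=> /predU1P[<-|Qr] Qx; last by rewrite IH// orbT.
by rewrite indicE mem_set// mul1r lexx.
Qed.

Lemma measurable_runmax r (h : R -> R) :
  measurable_fun setT (fun x => h (runmax r x)).
Proof.
have sh := simple_fun_comp (h : R^o -> R^o) (simple_runmax r).
exact: (@measurable_simple _ _ _ _ _ (fun x => x : R) sh).
Qed.

Lemma integrable_runmax r (h : R -> R) : mu.-integrable S (fun x => (h (runmax r x))%:E).
Proof.
have sh := simple_fun_comp (h : R^o -> R^o) (simple_runmax r).
have [K K0 hK] := simple_fun_bounded sh.
apply: (@le_integrable _ _ _ mu S mS _ (cst K%:E)).
- apply/measurable_EFinP/measurable_funTS; exact: measurable_runmax.
- by move=> x _; rewrite /= lee_fin (gtr0_norm K0); exact: hK.
- apply/integrableP; split; first exact/measurable_EFinP.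
  by rewrite integral_cst//= lte_mul_pinfty.
Qed.

Let integrable_runmaxf r (h : R -> R) :
  mu.-integrable S (fun x => (h (runmax r x) * `|f x|)%:E).
Proof.
have sh := simple_fun_comp (h : R^o -> R^o) (simple_runmax r).
have [K K0 hK] := simple_fun_bounded sh.
apply: (@le_integrable _ _ _ mu S mS _ (fun x => (K * `|f x|)%:E)).
- apply/measurable_EFinP/measurable_funTS; apply: measurable_funM.
    exact: measurable_runmax.
  exact: measurable_norm_smeas fi.1.
- move=> x _; rewrite /= lee_fin !normrM normr_id ler_wpM2r// (gtr0_norm K0).
  exact: hK.
- by under eq_fun do rewrite EFinM; apply: integrableZl => //; exact: bint_norm.
Qed.

Let splitS Q (h : d.-tuple R -> R) : cube Q `<=` S ->
  mu.-integrable S (EFin \o h) ->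
  \int[mu]_(x in S) h x =
  \int[mu]_(x in cube Q) h x + \int[mu]_(x in S `\` cube Q) h x.
Proof.
move=> QS hi; have e : cube Q `|` (S `\` cube Q) = S by rewrite setDUK.
rewrite -{1}e Rintegral_setU//; [exact: measurable_cube| | |].
- by apply: measurableD => //; exact: measurable_cube.
- by rewrite e.
- by apply/disj_set2P; rewrite setDE setICA setICr setI0.
Qed.

(** On a smallest cube of the family the maximal function is constant, and adding that
    cube changes it only there.  Both sides then change by multiples of the measure of
    the cube, which [doob_scalar] compares. *)
Lemma doob_linear r : (forall Q, Q \in r -> cube Q `<=` S) ->
  (forall Q, Q \in r -> 0 < meas mu (cube Q)) ->
  \int[mu]_(x in S) (runmax r x `^ p) <=
  p' * \int[mu]_(x in S) (runmax r x `^ (p - 1) * `|f x|).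
Proof.
move: r; apply: seq_scale_ind => [r r' rr' H h1 h2|_ _|Q r Qmin IH h1 h2].
- have e : runmax r' = runmax r.
    by apply/funext => x; rewrite /runmax (perm_big _ rr').
  rewrite e; apply: H => Q Qr; [apply: h1|apply: h2]; rewrite -(perm_mem rr')//.
- have -> : \int[mu]_(x in S) runmax [::] x `^ p = 0.
    transitivity (\int[mu]_(x in S) (0 : R)).
      by apply: eq_Rintegral => x _; rewrite /runmax big_nil powR0// gt_eqF.
    by rewrite Rintegral_cst// mul0r.
  apply: mulr_ge0; first exact: ltW.
  by apply: Rintegral_ge0 => x _; rewrite mulr_ge0// powR_ge0.
have {}IH := IH (fun Q' Q'r => h1 Q' (@mem_behead _ (Q :: r) _ Q'r))
  (fun Q' Q'r => h2 Q' (@mem_behead _ (Q :: r) _ Q'r)).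
have QS : cube Q `<=` S by apply: h1; exact: mem_head.
have mQ : 0 < meas mu (cube Q) by apply: h2; exact: mem_head.
pose m0 := runmax r (corner Q); pose m1 := Num.max (av Q) m0.
have rQ x : cube Q x -> runmax r x = m0.
  move=> Qx; rewrite /m0 /runmax; apply: eq_big_seq => Q' Q'r.
  have h : (cube Q' x) <-> cube Q' (corner Q).
    have aux y z : cube Q y -> cube Q z -> cube Q' y -> cube Q' z.
      move=> Qy Qz Q'y; have /subcubeP := subcube_scale Qy Q'y (Qmin _ Q'r).
      exact.
    by split; apply: aux => //; exact: corner_in.
  by rewrite !indicE; congr (_%:R * _); congr nat_of_bool; apply/idP/idP; rewrite !inE => /h.
have QrQ x : cube Q x -> runmax (Q :: r) x = m1.
  by move=> Qx; rewrite /runmax big_cons indicE mem_set// mul1r -/(runmax r x) rQ.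
have QrS x : ~ cube Q x -> runmax (Q :: r) x = runmax r x.
  move=> Qx; rewrite /runmax big_cons indicE memNset// mul0r -/(runmax r x).
  by rewrite max_r// runmax_ge0.
have mcQ : measurable (cube Q) by exact: measurable_cube.
rewrite (splitS QS (integrable_runmax (Q :: r) (fun t => t `^ p))).
rewrite (splitS QS (integrable_runmaxf (Q :: r) (fun t => t `^ (p - 1)))).
move: IH; rewrite (splitS QS (integrable_runmax r (fun t => t `^ p))).
rewrite (splitS QS (integrable_runmaxf r (fun t => t `^ (p - 1)))).
have cstQ (h : d.-tuple R -> R) c : (forall x, cube Q x -> h x = c) ->
    \int[mu]_(x in cube Q) h x = c * meas mu (cube Q).
  move=> hc; rewrite -Rintegral_cst//; apply: eq_Rintegral => x.
  by rewrite inE; exact: hc.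
have cstQf (h : d.-tuple R -> R) c : (forall x, cube Q x -> h x = c) ->
    \int[mu]_(x in cube Q) (h x * `|f x|) = c * (av Q * meas mu (cube Q)).
  move=> hc; rewrite divfK ?gt_eqF// -RintegralZl//.
    by apply: eq_Rintegral => x; rewrite inE => /hc ->.
  by apply: bint_norm => //; exact: bint_sub fi.
rewrite (cstQ _ (m0 `^ p)); last by move=> x Qx; rewrite rQ.
rewrite (cstQf _ (m0 `^ (p - 1))); last by move=> x Qx; rewrite rQ.
rewrite (cstQ _ (m1 `^ p)); last by move=> x Qx; rewrite QrQ.
rewrite (cstQf _ (m1 `^ (p - 1))); last by move=> x Qx; rewrite QrQ.
have e1 : \int[mu]_(x in S `\` cube Q) runmax (Q :: r) x `^ p =
    \int[mu]_(x in S `\` cube Q) runmax r x `^ p.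
  by apply: eq_Rintegral => x; rewrite inE => -[_ /QrS ->].
have e2 : \int[mu]_(x in S `\` cube Q) (runmax (Q :: r) x `^ (p - 1) * `|f x|) =
    \int[mu]_(x in S `\` cube Q) (runmax r x `^ (p - 1) * `|f x|).
  by apply: eq_Rintegral => x; rewrite inE => -[_ /QrS ->].
rewrite e1 e2; set X := Rintegral _ _ _; set Y := Rintegral _ _ _ => IH.
suff key : m1 `^ p - m0 `^ p <= p' * ((m1 `^ (p - 1) - m0 `^ (p - 1)) * av Q).
  exact: (doob_step (ltW mQ) IH key).
have m00 : 0 <= m0 by exact: runmax_ge0.
rewrite /m1; case: (leP (av Q) m0) => [_|lt].
  by rewrite !subrr mul0r mulr0.
exact: (doob_scalar p_gt1 pp').
Qed.

(** Young's inequality absorbs the maximal function on the right of [doob_linear] into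
    the left. *)
Lemma doob r : (forall Q, Q \in r -> cube Q `<=` S) ->
  (forall Q, Q \in r -> 0 < meas mu (cube Q)) ->
  mu.-integrable S (fun x => (`|f x| `^ p)%:E) ->
  \int[mu]_(x in S) (runmax r x `^ p) <= p' `^ p * \int[mu]_(x in S) (`|f x| `^ p).
Proof.
move=> rS r0 fpi; have h := doob_linear rS r0.
have i1 := integrable_runmax r (fun t => t `^ p).
have i2 := integrable_runmaxf r (fun t => t `^ (p - 1)).
set I1 := \int[mu]_(x in S) (runmax r x `^ p) in h *.
set I3 := \int[mu]_(x in S) (`|f x| `^ p).
have young x : p' * (runmax r x `^ (p - 1) * `|f x|) <=
    p'^-1 * (runmax r x `^ p) + p' `^ p / p * (`|f x| `^ p).
  have := @conjugate_powR R (runmax r x `^ (p - 1)) (p' * `|f x|) p' p (powR_ge0 _ _)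
    (mulr_ge0 (ltW p'_gt0) (normr_ge0 _)) p'_gt0 p_gt0.
  rewrite addrC => /(_ pp'); rewrite -powRrM p'M powRM//; last exact: ltW.
  by rewrite [leLHS]mulrCA (mulrC p'^-1) [p' `^ p / p * _]mulrAC.
have h2 : p' * \int[mu]_(x in S) (runmax r x `^ (p - 1) * `|f x|) <=
    p'^-1 * I1 + p' `^ p / p * I3.
  rewrite -!RintegralZl// -RintegralD//; last 2 first.
  - by have := integrableZl mS p'^-1 i1; apply: eq_integrable.
  - by have := integrableZl mS (p' `^ p / p) fpi; apply: eq_integrable.
  apply: le_Rintegral => //.
  - by have := integrableZl mS p' i2; apply: eq_integrable.
  - have := integrableD mS (integrableZl mS p'^-1 i1) (integrableZl mS (p' `^ p / p) fpi).
    exact: eq_integrable.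
have h3 := le_trans h h2.
have e : p'^-1 = 1 - p^-1 by rewrite -pp' addrAC subrr add0r.
have : p^-1 * I1 <= p^-1 * (p' `^ p * I3).
  by move: h3; rewrite e mulrAC mulrC; lra.
by rewrite ler_pM2l// invr_gt0.
Qed.

End carleson.

Section disjoint_sum.
Context {disp} {T : measurableType disp} {R : realType}.
Variable mu : {measure set T -> \bar R}.

(** Sums over sparse families become integrals of a maximal function once the cubes are
    replaced by their disjoint cores. *)
Lemma disjoint_sum_le (I : eqType) (L : seq I) (c : I -> set T) (k : I -> R)
  (D : set T) (H : T -> \bar R) :
  uniq L -> measurable D -> (forall i, measurable (c i)) ->
  (forall i, i \in L -> c i `<=` D) ->
  (forall i j x, i \in L -> j \in L -> c i x -> c j x -> i = j) ->
  (forall i, 0 <= k i) -> measurable_fun D H -> (forall x, D x -> (0 <= H x)%E) ->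
  (forall i x, i \in L -> c i x -> ((k i)%:E <= H x)%E) ->
  (\sum_(i <- L) (k i)%:E * mu (c i) <= \int[mu]_(x in D) H x)%E.
Proof.
move=> uL mD mc cD disj k0 mH H0 kH.
have -> : (\sum_(i <- L) (k i)%:E * mu (c i) =
    \int[mu]_(x in D) \sum_(i <- L) (k i * \1_(c i) x)%:E)%E.
  rewrite ge0_integral_sum//; first last.
  - by move=> i x _; rewrite lee_fin mulr_ge0.
  - by move=> i; apply/measurable_EFinP/measurable_funM.
  apply: eq_big_seq => i iL; under eq_integral do rewrite EFinM.
  rewrite ge0_integralZl//; [|by apply/measurable_EFinP|by rewrite lee_fin].
  by rewrite integral_indic// setIidl//; exact: cD.
apply: ge0_le_integral => //.
- by move=> x _; rewrite sume_ge0// => i _; rewrite lee_fin mulr_ge0.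
- by apply: emeasurable_sum => i; apply/measurable_EFinP/measurable_funM.
move=> x Dx; rewrite sumEFin.
have [[i [iL ix]]|ni] := pselect (exists i, i \in L /\ c i x).
  rewrite (big_rem i)//= indicE mem_set// mulr1 big1_seq ?addr0; first exact: kH.
  move=> j /=; rewrite (mem_rem_uniq _ uL) inE => /andP[ji jL].
  rewrite indicE memNset ?mulr0// => jx.
  by move/eqP : ji; apply; exact: (disj j i x).
rewrite big1_seq; first exact: H0.
by move=> i /= iL; rewrite indicE memNset ?mulr0// => ix; apply: ni; exists i.
Qed.

End disjoint_sum.

Lemma bigmaxe_ub {R : realType} (I : eqType) (r : seq I) (P : pred I) (g : I -> \bar R) i :
  i \in r -> P i -> (g i <= \big[maxe/0]_(j <- r | P j) g j)%E.
Proof.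
elim: r => // j r IH; rewrite inE big_cons => /predU1P[<- Pi|ir Pi].
  by rewrite Pi le_max lexx.
by case: ifP => _; [rewrite le_max IH// orbT|exact: IH].
Qed.

Section Ainf_max.
Context {R : realType} {d : nat} (DD : {fset dcube d}).
Variables (sigma omega : {measure set (d.-tuple R) -> \bar R}) (F : dcube d).

Lemma Ainf_max_ge0 x : (0 <= Ainf_max DD sigma omega F x)%E.
Proof. by rewrite /Ainf_max; elim/big_rec : _ => // Q y _ y0; rewrite le_max y0 orbT. Qed.

Lemma measurable_Ainf_max : measurable_fun setT (Ainf_max DD sigma omega F).
Proof.
rewrite /Ainf_max; elim: (enum_fset DD) => [|Q r IH].
  by under eq_fun do rewrite big_nil; exact: measurable_cst.
under eq_fun do rewrite big_cons.
case: (subcube Q F && (0%R < omega (cube Q))%E) => //.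
apply: measurable_maxe => //; apply: emeasurable_funM => //.
by apply/measurable_EFinP; apply: measurable_indic; exact: measurable_cube.
Qed.

End Ainf_max.

Section sparse_sums.
Context {R : realType} {d' : nat} {E : banachLatticeType R}.
Local Notation d := d'.+1.
Local Notation cube := (@cube R d).
Variable mu : {measure set (d.-tuple R) -> \bar R}.
Variables (Fm : seq (dcube d)) (co : dcube d -> set (d.-tuple R)).
Hypotheses (uFm : uniq Fm) (mco : forall F, measurable (co F)).
Hypothesis co_cube : forall F, co F `<=` cube F.
Hypothesis co_disj : forall F F' x, F \in Fm -> F' \in Fm -> co F x -> co F' x -> F = F'.
Hypothesis co_sparse : forall F, F \in Fm -> meas mu (cube F) <= 2 * meas mu (co F).
Hypothesis Foo : forall F, F \in Fm -> (mu (cube F) < +oo)%E.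
Hypothesis Fgt0 : forall F, F \in Fm -> 0 < meas mu (cube F).

Let coE F : F \in Fm -> mu (co F) = (meas mu (co F))%:E.
Proof.
move=> FF; apply: measE; apply: le_lt_trans (Foo FF); apply: le_measure; rewrite ?inE//.
exact: measurable_cube.
Qed.

(** On the core of F the maximal function is at least the average over F; the cores are
    disjoint and carry half of the measure. *)
Lemma carleson (p p' : R) (f : d.-tuple R -> E) (S : set (d.-tuple R)) (N : R) :
  1 < p -> p^-1 + p'^-1 = 1 -> measurable S -> (mu S < +oo)%E ->
  (forall F, F \in Fm -> cube F `<=` S) -> bint mu S f ->
  (\int[mu]_x (`|f x| `^ p)%:E <= N%:E)%E ->
  \sum_(F <- Fm) norm_average mu f F `^ p * meas mu (cube F) <= 2 * (p' `^ p * N).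
Proof.
move=> p1 pp' mS Soo FS fi fN.
have mfp : measurable_fun setT (fun x => `|f x| `^ p).
  apply: (@measurableT_comp _ _ _ _ _ _ (fun t => t `^ p)) => //.
  exact: measurable_norm_smeas fi.1.
have fSN : (\int[mu]_(x in S) (`|f x| `^ p)%:E <= N%:E)%E.
  by apply: le_trans fN; apply: ge0_subset_integral => //; exact/measurable_EFinP.
have fpi : mu.-integrable S (fun x => (`|f x| `^ p)%:E).
  apply/integrableP; split; first exact/measurable_EFinP/measurable_funTS.
  under eq_integral do rewrite gee0_abs ?lee_fin ?powR_ge0//.
  by apply: le_lt_trans fSN _; rewrite ltry.
have db := doob p1 pp' mS Soo fi FS Fgt0 fpi.
have {}db : \int[mu]_(x in S) (runmax mu f Fm x `^ p) <= p' `^ p * N.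
  apply: le_trans db _; rewrite ler_wpM2l ?powR_ge0// -lee_fin fineK//.
  exact: integrable_fin_num.
have mrun : measurable_fun S (fun x => (runmax mu f Fm x `^ p)%:E).
  by apply/measurable_EFinP/measurable_funTS; exact: (measurable_runmax mu f Fm (fun t => t `^ p)).
have rmi : (\int[mu]_(x in S) (runmax mu f Fm x `^ p)%:E)%E =
    (\int[mu]_(x in S) (runmax mu f Fm x `^ p))%:E.
  rewrite /Rintegral fineK//; apply: integrable_fin_num => //.
  exact: (@integrable_runmax R d' E mu f S mS Soo Fm (fun t => t `^ p)).
have := @disjoint_sum_le _ _ R mu _ Fm co (fun F => norm_average mu f F `^ p) S
  (fun x => (runmax mu f Fm x `^ p)%:E) uFm mS mco
  (fun F FF => subset_trans (@co_cube F) (FS F FF)) co_disj (fun F => powR_ge0 _ _) mrun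
  (fun x _ => powR_ge0 _ _).
rewrite rmi => h.
have {h} : (\sum_(F <- Fm) (norm_average mu f F `^ p)%:E * mu (co F) <= (p' `^ p * N)%:E)%E.
  apply: (le_trans (h _)); last by rewrite lee_fin.
  move=> F x FF Fx; rewrite lee_fin; apply: ge0_ler_powR.
  - by rewrite ltW// (lt_trans ltr01).
  - by rewrite nnegrE divr_ge0 ?norm_integral_ge0 ?meas_ge0.
  - by rewrite nnegrE runmax_ge0.
  - by apply: runmax_ub => //; exact: co_cube.
rewrite (eq_big_seq (fun F => (norm_average mu f F `^ p * meas mu (co F))%:E)); last first.
  by move=> F FF; rewrite coE.
rewrite sumEFin lee_fin => h.
rewrite -(ler_pM2l (ltr0Sn R 1)) in h; apply: le_trans h; rewrite mulr_sumr.
rewrite big_seq [leRHS]big_seq; apply: ler_sum => F FF.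
by rewrite mulrCA ler_wpM2l ?powR_ge0// co_sparse.
Qed.

(** σ(G) is at most 2 σ(G) / μ(G) μ(core G), and on the core of G the integrand of the
    A_∞ characteristic is at least σ(G) / μ(G). *)
Lemma Ainf_sum (sigma : {measure set (d.-tuple R) -> \bar R}) (DD : {fset dcube d})
    (F : dcube d) (A : R) :
  {subset Fm <= DD} -> (forall G, G \in Fm -> (sigma (cube G) < +oo)%E) -> 
  (\int[mu]_x Ainf_max DD sigma mu F x <= (A * meas sigma (cube F))%:E)%E ->
  \sum_(G <- Fm | subcube (R := R) G F) meas sigma (cube G) <= 2 * A * meas sigma (cube F).
Proof.
move=> FD soo AF; rewrite -big_filter; set L := [seq _ <- _ | _].
have LF G : G \in L -> G \in Fm by rewrite mem_filter => /andP[].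
have := @disjoint_sum_le _ _ R mu _ L co
  (fun G => meas sigma (cube G) / meas mu (cube G)) setT
  (Ainf_max DD sigma mu F) (filter_uniq _ uFm) measurableT mco (fun _ _ _ _ => I)
  (fun G G' x GL G'L => @co_disj G G' x (LF _ GL) (LF _ G'L))
  (fun G => divr_ge0 (meas_ge0 _ _) (meas_ge0 _ _)) (measurable_Ainf_max _ _ _ _)
  (fun x _ => Ainf_max_ge0 _ _ _ _ x).
move=> h.
have {h} : (\sum_(G <- L) (meas sigma (cube G) / meas mu (cube G))%:E * mu (co G) <=
    (A * meas sigma (cube F))%:E)%E.
  apply: (le_trans (h _)) => // G x GL Gx; have GFm := LF _ GL.
  have := @bigmaxe_ub R _ DD (fun Q => subcube (R := R) Q F && (0 < mu (cube Q))%E)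
    (fun Q => (sigma (cube Q) / mu (cube Q) * (\1_(cube Q) x)%:E)%E) G (FD _ GFm).
  have GF : subcube (R := R) G F by move: GL; rewrite mem_filter => /andP[].
  have mG : mu (cube G) = (meas mu (cube G))%:E.
    by apply: measE; exact: Foo.
  have sG : sigma (cube G) = (meas sigma (cube G))%:E.
    by apply: measE; exact: soo.
  rewrite GF mG sG lte_fin Fgt0// => /(_ isT); apply: le_trans.
  rewrite indicE mem_set ?mule1; last exact: co_cube.
  by rewrite inver gt_eqF ?Fgt0.
rewrite (eq_big_seq (fun G => (meas sigma (cube G) / meas mu (cube G) * meas mu (co G))%:E));
  last by move=> G GL; rewrite coE// LF.
rewrite sumEFin lee_fin => h.
rewrite -(ler_pM2l (ltr0Sn R 1)) mulrA in h; apply: le_trans h; rewrite mulr_sumr.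
rewrite big_seq [leRHS]big_seq; apply: ler_sum => G /LF GF.
have := co_sparse GF; have := Fgt0 GF => m0 h.
have -> : 2 * (meas sigma (cube G) / meas mu (cube G) * meas mu (co G)) =
    meas sigma (cube G) / meas mu (cube G) * (2 * meas mu (co G)) by ring.
apply: le_trans (ler_wpM2l _ h); last by rewrite divr_ge0 ?meas_ge0.
by rewrite divfK// gt_eqF.
Qed.

End sparse_sums.

(** * The bilinear estimate *)

Section holder_seq.
Context {R : realType}.
Implicit Types (u v : R).

(** Young's inequality with the conjugate exponent p' of [p]; since [t <= p'] and
    [v <= 1], the power of [v] may be lowered to [t]. *)
Lemma young_le (p t u v : R) : 1 < p -> 1 < t -> 1 <= p^-1 + t^-1 ->
  0 <= u -> 0 <= v -> v <= 1 -> u * v <= u `^ p + v `^ t.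
Proof.
move=> p1 t1 pt u0 v0 v1; have p0 : 0 < p by exact: lt_trans p1.
have t0 : 0 < t by exact: lt_trans t1.
pose p' := (1 - p^-1)^-1.
have pV : 0 < 1 - p^-1 by rewrite subr_gt0 invf_lt1.
have p'0 : 0 < p' by rewrite invr_gt0.
have pp' : p^-1 + p'^-1 = 1 by rewrite invrK addrC subrK.
have p'1 : 1 < p' by exact: conjugate_gt1 pp'.
apply: le_trans (conjugate_powR u0 v0 p0 p'0 pp') _; apply: lerD.
  by rewrite ler_pdivrMr// ler_peMr ?powR_ge0// ltW.
apply: (@le_trans _ _ (v `^ p')).
  by rewrite ler_pdivrMr// ler_peMr ?powR_ge0// ltW.
have tp' : t <= p'.
  by rewrite -[t]invrK lef_pV2 ?posrE ?invr_gt0// lerBlDl.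
move: v0; rewrite le_eqVlt => /predU1P[<-|v0].
  by rewrite !powR0// gt_eqF.
rewrite /powR (gt_eqF v0) ler_expR ler_wnM2r//.
by rewrite -ln1 ler_ln ?posrE.
Qed.

(** After normalization all [v i] are at most 1, because a single term is bounded by the
    sum, and [young_le] applies termwise. *)
Lemma holder_seq (I : Type) (r : seq I) (p t U V : R) (u v : I -> R) :
  1 < p -> 1 < t -> 1 <= p^-1 + t^-1 -> 0 < U -> 0 < V ->
  (forall i, 0 <= u i) -> (forall i, 0 <= v i) ->
  \sum_(i <- r) u i `^ p <= U -> \sum_(i <- r) v i `^ t <= V ->
  \sum_(i <- r) u i * v i <= 2 * (U `^ p^-1 * V `^ t^-1).
Proof.
move=> p1 t1 pt U0 V0 u0 v0 uU vV.
have p0 : 0 < p by exact: lt_trans p1.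
have t0 : 0 < t by exact: lt_trans t1.
have aux (e W : R) (w : I -> R) : 0 < e -> 0 < W -> (forall i, 0 <= w i) ->
    \sum_(i <- r) w i `^ e <= W -> \sum_(i <- r) (w i / W `^ e^-1) `^ e <= 1.
  move=> e0 W0 w0 h; under eq_bigr do rewrite powRM ?invr_ge0 ?powR_ge0//.
  rewrite -mulr_suml -[in leLHS]powRN -powRrM mulNr mulVf ?gt_eqF// powRN powRr1; last exact: ltW.
  by rewrite ler_pdivrMr// mul1r.
have hu := aux p U u p0 U0 u0 uU; have hv := aux t V v t0 V0 v0 vV.
have Up : 0 < U `^ p^-1 by exact: powR_gt0.
have Vt : 0 < V `^ t^-1 by exact: powR_gt0.
rewrite -ler_pdivrMr ?mulr_gt0// mulr_suml.
apply: (@le_trans _ _ (\sum_(i <- r) ((u i / U `^ p^-1) `^ p + (v i / V `^ t^-1) `^ t))).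
  rewrite -(big_mkcond xpredT)/=.
  elim: r hv {hu uU vV aux} => [|i r IH]; first by rewrite !big_nil.
  rewrite !big_cons => hv.
  have s0 : 0 <= \sum_(j <- r) (v j / V `^ t^-1) `^ t by apply: sumr_ge0 => j _; exact: powR_ge0.
  apply: lerD; last by apply: IH; apply: le_trans hv; rewrite lerDr powR_ge0.
  rewrite invfM mulrACA; apply: young_le => //; [exact: divr_ge0 (ltW _)|exact: divr_ge0 (ltW _)|].
  have h : (v i / V `^ t^-1) `^ t <= 1 by apply: le_trans hv; rewrite lerDl.
  rewrite leNgt; apply/negP => lt1; move: h; rewrite leNgt => /negP; apply.
have e1 : 1 = 1 `^ t :> R by rewrite powR1.
by rewrite [ltLHS]e1; apply: gt0_ltr_powR => //; rewrite nnegrE ?ler01// ltW// (lt_trans ltr01).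
by rewrite big_split/=; apply: le_trans (lerD hu hv) _; rewrite -natr1.
Qed.

End holder_seq.

Section half_sum.
Context {R : realType} {d : nat}.
Local Notation "Q <=c F" := (@subcube R d Q F) (at level 70).
Variables (s O I : seq (dcube d)) (piO piI : dcube d -> dcube d).
Hypotheses (uO : uniq O) (uI : uniq I) (Is : {subset I <= s}).
Hypothesis piOP : forall Q, Q \in s -> @is_principal R d O Q (piO Q).
Hypothesis piIP : forall Q, Q \in s -> @is_principal R d I Q (piI Q).
Hypothesis piO_between : forall Q Q', Q \in s -> Q' \in s -> Q <=c Q' ->
  Q' <=c piO Q -> piO Q' = piO Q.
Variables (a nO nI mO mI : dcube d -> R) (r t k A NO NI : R).
Hypotheses (r1 : 1 < r) (t1 : 1 < t) (rt : 1 <= r^-1 + t^-1).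
Hypotheses (k0 : 0 <= k) (A0 : 0 < A) (NO0 : 0 < NO) (NI0 : 0 < NI).
Hypotheses (nO0 : forall F, 0 <= nO F) (nI0 : forall F, 0 <= nI F).
Hypotheses (mO0 : forall F, 0 <= mO F) (mI0 : forall F, 0 <= mI F).
Hypothesis local : forall G (P : pred (dcube d)), G \in I ->
  (forall Q, Q \in s -> P Q -> piI Q = G /\ piO Q = piO G) ->
  \sum_(Q <- s | P Q) a Q <=
  k * (nO (piO G) * mO G `^ r^-1 * (nI G * mI G `^ t^-1)).
Hypothesis packing : forall F, F \in O -> \sum_(G <- I | G <=c F) mO G <= A * mO F.
Hypothesis carlO : \sum_(F <- O) nO F `^ r * mO F <= NO.
Hypothesis carlI : \sum_(G <- I) nI G `^ t * mI G <= NI.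

(** [O] and [I] are the principal cubes of the two functions.  A cube Q with principal
    cubes F in [O] and G in [I], G contained in F, is charged to G, for F is then the
    smallest member of [O] that contains G.  In the Hölder sum over G, the powers of the
    averages over F are collected with [packing]. *)
Lemma half_sum : \sum_(Q <- s | piI Q <=c piO Q) a Q <=
  k * (2 * ((A * NO) `^ r^-1 * NI `^ t^-1)).
Proof.
have r0 : 0 < r by exact: lt_trans r1.
have t0 : 0 < t by exact: lt_trans t1.
have powK (e x y : R) : 0 < e -> 0 <= x -> 0 <= y -> (x * y `^ e^-1) `^ e = x `^ e * y.
  by move=> e0 x0 y0; rewrite powRM ?powR_ge0// -powRrM mulVf ?gt_eqF// powRr1.
have split_sum (J : seq (dcube d)) (pj : dcube d -> dcube d) (L : seq (dcube d))
    (P : pred (dcube d)) (b : dcube d -> R) : uniq J ->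
    (forall Q, Q \in L -> pj Q \in J) ->
    \sum_(Q <- L | P Q) b Q = \sum_(G <- J) \sum_(Q <- L | (pj Q == G) && P Q) b Q.
  move=> uJ pJ; under [RHS]eq_bigr do rewrite big_mkcondl.
  rewrite exchange_big/= big_seq_cond [RHS]big_seq_cond.
  apply: eq_bigr => Q /andP[QL _]; rewrite (big_rem (pj Q))/= ?pJ// eqxx.
  rewrite big1_seq ?addr0// => G /=; rewrite mem_rem_uniq// inE eq_sym => /andP[/negbTE -> _].
  by [].
rewrite (@split_sum I piI)//; last by move=> Q /piIP[].
apply: (@le_trans _ _ (\sum_(G <- I) k * (nO (piO G) * mO G `^ r^-1 * (nI G * mI G `^ t^-1)))).
  rewrite big_seq [leRHS]big_seq; apply: ler_sum => G GI; apply: local => // Q Qs.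
  move=> /andP[/eqP QG QF]; split => //; rewrite QG in QF.
  apply/esym/piO_between => //; first exact: Is.
  by rewrite -QG; case: (piIP Qs).
rewrite -mulr_sumr ler_wpM2l//; apply: holder_seq => //; first exact: mulr_gt0.
- by move=> G; rewrite mulr_ge0// powR_ge0.
- by move=> G; rewrite mulr_ge0// powR_ge0.
- under eq_bigr do rewrite powK//.
  rewrite (@split_sum O piO _ xpredT)//; last by move=> Q /Is /piOP[].
  apply: (@le_trans _ _ (\sum_(F <- O) nO F `^ r * (A * mO F))).
    rewrite big_seq [leRHS]big_seq; apply: ler_sum => F FO.
    under eq_bigl do rewrite andbT.
    rewrite (eq_bigr (fun G => nO F `^ r * mO G)); last by move=> G /eqP ->.
    rewrite -mulr_sumr ler_wpM2l ?powR_ge0//; apply: le_trans (packing FO).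
    rewrite big_seq_cond [leRHS]big_mkcond [leRHS]big_seq/= big_mkcondr/=.
    apply: ler_sum => G GI; case: ifP => [/eqP <-|_]; last by case: ifP.
    by case: (piOP (Is GI)) => _ ->.
  by under eq_bigr do rewrite mulrCA; rewrite -mulr_sumr ler_wpM2l// ltW.
- by under eq_bigr do rewrite powK//.
Qed.

End half_sum.

Section stopping_sup.
Context {R : realType} {d' : nat} {E : banachLatticeType R}.
Local Notation d := d'.+1.
Local Notation cube := (@cube R d).
Local Notation "Q <=c F" := (@subcube R d Q F) (at level 70).
Variables (M : R) (M_ge1 : 1 <= M).
Variable mu : {measure set (d.-tuple R) -> \bar R}.
Variables (f : d.-tuple R -> E) (s : seq (dcube d)).
Hypothesis f_ge0 : forall x, 0 <=v f x.
Hypothesis s_gt0 : forall Q, Q \in s -> 0 < meas mu (cube Q).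
Hypothesis s_int : forall Q, Q \in s -> bint mu (cube Q) f.
Variable Fm : seq (dcube d).
Hypotheses (Fs : {subset Fm <= s}).
Hypothesis FmP : forall Q, Q \in s ->
  (Q \in Fm <-> stops (R := R) (lstop M mu f s) Fm Q).

(** Test functions for the testing condition: the supremum of the averages over a
    group of cubes. *)
Definition local_sup (P : pred (dcube d)) (x : d.-tuple R) : E :=
  \big[vsup/0]_(Q <- s | P Q) ((\1_(cube Q) x : R) *: average mu f Q).

Lemma average_ge0 Q : Q \in s -> 0 <=v average mu f Q.
Proof.
move=> Qs; apply: vscale_ge0; first by rewrite invr_ge0 meas_ge0.
by apply: bochner_ge0 => //; [exact: measurable_cube|exact: s_int].
Qed.

(** The cubes of the group that contain [x] form a chain from some Q up to at most [F].
    Either Q is [F], or Q has not been selected and the second stopping condition fails. *)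
Lemma local_sup_bound (P : pred (dcube d)) F x : F \in s ->
  (forall Q, Q \in s -> P Q -> @principal R d Fm Q = F) ->
  `|local_sup P x| <= 64 * M * norm_average mu f F.
Proof.
move=> Fs' PF; have n0 : 0 <= norm_average mu f F by exact: norm_average_ge0.
have M0 : 0 <= M by exact: le_trans M_ge1.
have [[Q0 [Q0s Q0P Q0x]]|none] := pselect (exists Q, [/\ Q \in s, P Q & cube Q x]); last first.
  suff e : local_sup P x = 0 by rewrite e normr0 mulr_ge0// mulr_ge0.
  apply: vle_anti; last exact: vbig_ge0.
  apply: vbig_lub => [|Q Qs PQ]; first exact: vle_refl.
  rewrite indicE memNset ?scale0r; first exact: vle_refl.
  by move=> Qx; apply: none; exists Q.
have [|Q [Qr Qx Qmin]] := @min_cube R d [seq Q <- s | P Q] x.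
  by exists Q0 => //; rewrite mem_filter Q0P.
move: Qr; rewrite mem_filter => /andP[QP Qs].
have piQ := PF _ Qs QP.
have QF : Q <=c F by rewrite -piQ; case: (principalP FmP Qs).
have [QeF|QnF] := eqVneq Q F.
  apply: (@le_trans _ _ `|average mu f F|).
    apply: vnorm_mono; first exact: vbig_ge0.
    apply: vbig_lub => [|Q' Q's PQ']; first exact: average_ge0.
    have [Q'x|Q'x] := pselect (cube Q' x); last first.
      by rewrite indicE memNset// scale0r; exact: average_ge0.
    rewrite indicE mem_set// scale1r.
    suff -> : Q' = F by exact: vle_refl.
    apply: (@subcube_anti R d isT).
      by rewrite -(PF _ Q's PQ'); case: (principalP FmP Q's).
    by rewrite -QeF; apply: Qmin => //; rewrite mem_filter PQ'.
  apply: (@le_trans _ _ (norm_average mu f F)).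
    rewrite normrZ ger0_norm ?invr_ge0 ?meas_ge0// mulrC ler_wpM2r ?invr_ge0 ?meas_ge0//.
    by apply: bochner_norm; [exact: measurable_cube|exact: s_int].
  by rewrite ler_peMl// mulr_ege1// ler1n.
have := @principal_nstop R d isT _ _ _ Fs FmP _ Qs; rewrite piQ => /(_ (elimN eqP QnF)) ns.
have {}ns : `|\big[vsup/0]_(Q' <- s | (Q <=c Q') && (Q' <=c F)) average mu f Q'| <= 64 * M * norm_average mu f F.
  by rewrite leNgt; apply/negP => h; apply: ns; right.
apply: le_trans ns; apply: vnorm_mono; first exact: vbig_ge0.
apply: vbig_lub => [|Q' Q's PQ']; first exact: vbig_ge0.
have [Q'x|Q'x] := pselect (cube Q' x); last first.
  by rewrite indicE memNset// scale0r; exact: vbig_ge0.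
rewrite indicE mem_set// scale1r; apply: vbig_ub => //.
rewrite Qmin ?mem_filter ?PQ'//=.
by rewrite -(PF _ Q's PQ'); case: (principalP FmP Q's).
Qed.

Lemma simple_local_sup P : simple_fun (local_sup P).
Proof.
rewrite /local_sup; under eq_fun do rewrite -big_filter.
apply: simple_fun_big => Q; apply: simple_fun_restr; first exact: measurable_cube.
exact: simple_fun_cst.
Qed.

End stopping_sup.

Lemma bint_Lp {disp} {T : measurableType disp} {R : realType} {E : banachLatticeType R}
  (mu : {measure set T -> \bar R}) (S : set T) (f : T -> E) (t : R) :
  1 <= t -> measurable S -> (mu S < +oo)%E -> strongly_measurable f ->
  (\int[mu]_x (`|f x| `^ t)%:E < +oo)%E -> bint mu S f.
Proof.
move=> t1 mS Soo sf ft; split => //.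
have mf := measurable_norm_smeas sf.
have mft : measurable_fun setT (fun x => `|f x| `^ t).
  exact: (@measurableT_comp _ _ _ _ _ _ (fun u => u `^ t)).
apply: (@le_lt_trans _ _ (\int[mu]_(x in S) (1%:E + (`|f x| `^ t)%:E)%E)%E).
  apply: ge0_le_integral => //.
  - exact/measurable_EFinP/measurable_funTS.
  - by apply: emeasurable_funD => //; exact/measurable_EFinP/measurable_funTS.
  move=> x _; rewrite -EFinD lee_fin.
  have [h|/ltW h] := leP `|f x| 1; first by rewrite (le_trans h)// lerDl powR_ge0.
  by rewrite (@le_trans _ _ (`|f x| `^ t))// ?lerDr// -[leLHS]powRr1// ler_powR.
rewrite ge0_integralD//; last exact/measurable_EFinP/measurable_funTS.
rewrite integral_cst// mul1e lte_add_pinfty//.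
apply: le_lt_trans ft; apply: ge0_subset_integral => //; exact/measurable_EFinP.
Qed.

Section principal_cubes.
Context {R : realType} {d' : nat} {E : banachLatticeType R}.
Local Notation d := d'.+1.
Local Notation cube := (@cube R d).
Local Notation "Q <=c F" := (@subcube R d Q F) (at level 70).
Variables (t t' M : R) (t_gt1 : 1 < t) (tt' : t^-1 + t'^-1 = 1) (M_ge1 : 1 <= M).
Hypothesis HLM : (HLnorm d E t <= M%:E)%E.
Variable mu : {measure set (d.-tuple R) -> \bar R}.
Variables (f : d.-tuple R -> E) (s : seq (dcube d)).
Hypotheses (us : uniq s) (f_ge0 : forall x, 0 <=v f x) (sf : strongly_measurable f).
Hypothesis f1 : (\int[mu]_x (`|f x| `^ t)%:E <= 1)%E.
Hypothesis s_oo : forall Q, Q \in s -> (mu (cube Q) < +oo)%E.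
Hypothesis s_gt0 : forall Q, Q \in s -> 0 < meas mu (cube Q).

(** The construction is needed once for f and σ and once for g and ω; only these
    properties of it matter. *)
Lemma principal_cubes : exists (J : seq (dcube d)) (pj : dcube d -> dcube d),
  [/\ uniq J, {subset J <= s}, (forall Q, Q \in s -> @is_principal R d J Q (pj Q)) &
   (forall Q Q', Q \in s -> Q' \in s -> Q <=c Q' -> Q' <=c pj Q -> pj Q' = pj Q)] /\
  [/\ (forall (P : pred (dcube d)) F x, F \in s ->
       (forall Q, Q \in s -> P Q -> pj Q = F) ->
       `|local_sup mu f s P x| <= 64 * M * norm_average mu f F),
   \sum_(F <- J) norm_average mu f F `^ t * meas mu (cube F) <= 2 * t' `^ t &
   forall (nu : {measure set (d.-tuple R) -> \bar R}) (DD : {fset dcube d}) F (A : R),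
     {subset s <= DD} -> (forall Q, Q \in s -> (nu (cube Q) < +oo)%E) ->
     (\int[mu]_x Ainf_max DD nu mu F x <= (A * meas nu (cube F))%:E)%E ->
     \sum_(G <- J | G <=c F) meas nu (cube G) <= 2 * A * meas nu (cube F)].
Proof.
have foo : (\int[mu]_x (`|f x| `^ t)%:E < +oo)%E by apply: le_lt_trans f1 _; rewrite ltry.
have mcube Q : measurable (cube Q) by exact: measurable_cube.
have sint Q : Q \in s -> bint mu (cube Q) f.
  by move=> Qs; apply: bint_Lp foo => //; [exact: ltW|exact: s_oo].
have [J [uJ Js JP]] := @stopping_family R d isT (lstop M mu f s) s us.
have M_gt0 : 0 < M by exact: lt_le_trans ltr01 M_ge1.
have sp := sparse (ltW t_gt1) M_gt0 HLM f_ge0 s_oo s_gt0 sint uJ Js JP.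
have mco := measurable_core (R := R) J.
have coc F : core (R := R) J F `<=` cube F by exact: subDsetl.
have cod := @core_disjoint R d' J.
have Joo F : F \in J -> (mu (cube F) < +oo)%E by move=> /Js; exact: s_oo.
have J0 F : F \in J -> 0 < meas mu (cube F) by move=> /Js; exact: s_gt0.
exists J, (@principal R d J); split; split => //.
- exact: (principalP JP).
- exact: (@principal_between R d isT _ _ _ JP).
- by move=> P F x Fs PF; exact: (local_sup_bound M_ge1 f_ge0 sint Js JP).
- pose S := \big[setU/set0]_(Q <- J) cube Q.
  have mS : measurable S by exact: bigsetU_measurable.
  have Soo : (mu S < +oo)%E.
    suff h r : {subset r <= J} -> (mu (\big[setU/set0]_(Q <- r) cube Q) < +oo)%E by exact: h.
    elim: r => [|F r IH] rJ; first by rewrite big_nil measure0 ltry.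
    rewrite big_cons; apply: le_lt_trans (measureU2 _ _ _) _ => //.
      exact: bigsetU_measurable.
    rewrite lte_add_pinfty//; first by apply/Joo/rJ; exact: mem_head.
    by apply: IH => Q Qr; apply: rJ; rewrite inE Qr orbT.
  have JS F : F \in J -> cube F `<=` S.
    by move=> FJ x Fx; rewrite /S -bigcup_seq; exists F.
  have := carleson uJ mco coc cod sp Joo J0 t_gt1 tt' mS Soo JS _ f1.
  rewrite mulr1; apply.
  by apply: bint_Lp foo => //; exact: ltW.
- move=> nu DD F A sD noo; apply: (Ainf_sum uJ mco coc cod sp Joo J0).
    by move=> G /Js/sD.
  by move=> G /Js/noo.
Qed.

End principal_cubes.

Lemma ler_sum_sub {R : realType} (I : eqType) (r r' : seq I) (P P' : pred I) (F : I -> R) :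
  uniq r -> uniq r' -> (forall i, i \in r -> P i -> i \in r' /\ P' i) ->
  (forall i, 0 <= F i) -> \sum_(i <- r | P i) F i <= \sum_(i <- r' | P' i) F i.
Proof.
move=> ur ur' rr' F0; rewrite -big_filter -[leRHS]big_filter.
have : {subset [seq i <- r | P i] <= [seq i <- r' | P' i]}.
  by move=> i; rewrite !mem_filter => /andP[Pi ir]; have [-> ->] := rr' i ir Pi.
move: (filter_uniq P ur) (filter_uniq P' ur').
elim: [seq i <- r | P i] [seq i <- r' | P' i] => [|x r1 IH] r2 /=.
  by move=> _ _ _; rewrite big_nil; exact: sumr_ge0.
move=> /andP[xr1 u1] u2 sub; rewrite big_cons [leRHS](big_rem x)/=; last first.
  by apply: sub; exact: mem_head.
rewrite lerD2l; apply: IH => //; first exact: rem_uniq.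
move=> y yr1; rewrite mem_rem_uniq// inE sub ?andbT; last by rewrite inE yr1 orbT.
by apply: contraNneq xr1 => <-.
Qed.

Section bnorm_oo.
Context {disp} {T : measurableType disp} {R : realType} {E : normedModType R}.
Variable mu : {measure set T -> \bar R}.

Lemma bnorm_oo_le (f : T -> E) (a : R) : (forall x, `|f x| <= a) -> 0 <= a ->
  (bnorm mu +oo f <= a%:E)%E.
Proof.
move=> fa a0; rewrite /bnorm Lnorm.unlock; case: ifPn => // _.
by apply/ess_supP/aeW => x /=; rewrite normr_id lee_fin.
Qed.

End bnorm_oo.

Section test_local.
Context {R : realType} {d' : nat} {C D : banachLatticeType R}.
Local Notation d := d'.+1.
Local Notation cube := (@cube R d).
Local Notation "Q <=c F" := (@subcube R d Q F) (at level 70).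
Variables (DD : {fset dcube d}) (sigma omega : {measure set (d.-tuple R) -> \bar R}).
Variable lam : dcube d -> {linear C -> D}.
Hypothesis lam_ge0 : forall Q, Q \in DD -> forall c : C, 0 <=v c -> 0 <=v lam Q c.
Variables (p q' c : R).
Hypotheses (c_ge0 : 0 <= c) (tb : testing_bound DD sigma omega lam p q' c).
Variable s : seq (dcube d).
Hypotheses (us : uniq s) (sD : {subset s <= DD}).
Hypothesis DD_oo : forall Q, Q \in DD -> (sigma (cube Q) < +oo)%E /\ (omega (cube Q) < +oo)%E.
Hypothesis s_sigma : forall Q, Q \in s -> 0 < meas sigma (cube Q).
Hypothesis s_omega : forall Q, Q \in s -> 0 < meas omega (cube Q).
Variables (f : d.-tuple R -> C) (g : d.-tuple R -> dual D).
Hypotheses (f_ge0 : forall x, 0 <=v f x) (g_ge0 : forall x, 0 <=v g x).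
Hypothesis f_int : forall Q, Q \in s -> bint sigma (cube Q) f.
Hypothesis g_int : forall Q, Q \in s -> bint omega (cube Q) g.

Definition pairing Q : R := bochner_integral_on omega (cube Q) g
  (lam Q (bochner_integral_on sigma (cube Q) f)).

(** The averages of [local_sup] over the cubes of the group dominate those of [f] and
    [g].  By positivity, testing with them bounds the corresponding part of the form. *)
Lemma test_local (R0 : dcube d) (P : pred (dcube d)) (alpha beta : R) : R0 \in DD ->
  (forall Q, Q \in s -> P Q -> Q <=c R0) -> 0 <= alpha -> 0 <= beta ->
  (forall x, `|local_sup sigma f s P x| <= alpha) ->
  (forall x, `|local_sup omega g s P x| <= beta) ->
  \sum_(Q <- s | P Q) pairing Q <=
  c * (alpha * meas sigma (cube R0) `^ p^-1 * (beta * meas omega (cube R0) `^ q'^-1)).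
Proof.
move=> R0D PR0 a0 b0 fa gb; have mcube Q : measurable (cube Q) by exact: measurable_cube.
set fF := local_sup sigma f s P in fa; set gG := local_sup omega g s P in gb.
have sfF : simple_fun fF by exact: simple_local_sup.
have sgG : simple_fun gG by exact: simple_local_sup.
have fF0 x : 0 <=v fF x by exact: vbig_ge0.
have gG0 x : 0 <=v gG x by exact: vbig_ge0.
have outside (E : banachLatticeType R) (mu : {measure set (d.-tuple R) -> \bar R})
    (h : d.-tuple R -> E) x : ~ cube R0 x -> local_sup mu h s P x = 0.
  move=> nx; apply: vle_anti; last exact: vbig_ge0.
  apply: vbig_lub => [|Q Qs PQ]; first exact: vle_refl.
  rewrite indicE memNset ?scale0r; first exact: vle_refl.
  by move=> Qx; apply: nx; move/subcubeP : (PR0 _ Qs PQ); exact.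
have fFL : Linfty_on sigma (cube R0) fF.
  split; last by move=> x; exact: outside.
  split; first exact: simple_smeas.
  by apply: le_lt_trans (bnorm_oo_le sigma fa a0) _; rewrite ltry.
have gGL : Linfty_on omega (cube R0) gG.
  split; last by move=> x; exact: outside.
  split; first exact: simple_smeas.
  by apply: le_lt_trans (bnorm_oo_le omega gb b0) _; rewrite ltry.
have tF := tb R0D fFL gGL.
have [sR0 oR0] := DD_oo R0D.
have sE : sigma (cube R0) = (meas sigma (cube R0))%:E.
  by exact: measE.
have oE : omega (cube R0) = (meas omega (cube R0))%:E.
  by exact: measE.
have {}tF : (\int[omega]_x (gG x (T_loc DD sigma lam R0 fF x))%:E <=
  (c * (alpha * meas sigma (cube R0) `^ p^-1 * (beta * meas omega (cube R0) `^ q'^-1)))%:E)%E.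
  apply: (le_trans tF).
  have -> : c * (alpha * meas sigma (cube R0) `^ p^-1 * (beta * meas omega (cube R0) `^ q'^-1)) =
    c * alpha * beta * meas sigma (cube R0) `^ p^-1 * meas omega (cube R0) `^ q'^-1 by ring.
  rewrite sE oE !poweR_EFin !EFinM.
  have n0 (E : normedModType R) (mu : {measure set (d.-tuple R) -> \bar R})
    (h : d.-tuple R -> E) : (0 <= bnorm mu +oo h)%E by exact: Lnorm_ge0.
  do 2 (apply: lee_wpmul2r; first by rewrite lee_fin powR_ge0).
  apply: lee_pmul; [|exact: n0| |exact: bnorm_oo_le].
    by rewrite mule_ge0// n0.
  by apply: lee_wpmul2l; [rewrite lee_fin|exact: bnorm_oo_le].
rewrite -lee_fin; apply: le_trans tF.
pose w Q := lam Q (bochner_integral_on sigma (cube Q) f).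
have int_ge0 Q : Q \in s -> 0 <=v bochner_integral_on sigma (cube Q) f.
  by move=> Qs; apply: bochner_ge0 => //; exact: f_int.
have wge0 Q : Q \in s -> 0 <=v w Q by move=> Qs; apply: lam_ge0; [exact: sD|exact: int_ge0].
have g0 Q : Q \in s -> 0 <=v average omega g Q by move=> Qs; exact: average_ge0 g_int _ Qs.
pose k Q : R := `|average omega g Q (w Q)|.
have k0 Q : 0 <= k Q by exact: normr_ge0.
have kE Q : Q \in s -> k Q = average omega g Q (w Q).
  by move=> Qs; rewrite /k ger0_norm//; apply: dual_ge0; [exact: g0|exact: wge0].
have mH : measurable_fun setT (fun x => gG x (T_loc DD sigma lam R0 fF x)).
  have sT : simple_fun (T_loc DD sigma lam R0 fF).
    by apply: simple_fun_sum => Q; apply: simple_fun_restr => //; exact: simple_fun_cst.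
  have := simple_fun_comp2 (fun (u : dual D) v => u v : R^o) sgG sT.
  exact: (@measurable_simple _ _ _ _ _ (fun x => x : R)).
rewrite -big_filter; set L := [seq Q <- s | P Q].
have LsP Q : Q \in L -> Q \in s /\ P Q by rewrite mem_filter => /andP[].
have -> : (\sum_(Q <- L) pairing Q)%:E =
    (\int[omega]_x (\sum_(Q <- L) (k Q * \1_(cube Q) x)%:E)%E)%E.
  rewrite ge0_integral_sum//; first last.
  - by move=> Q x _; rewrite lee_fin mulr_ge0.
  - by move=> Q; apply/measurable_EFinP/measurable_funM.
  rewrite -sumEFin; apply: eq_big_seq => Q /LsP[Qs _]; under eq_integral do rewrite EFinM.
  rewrite ge0_integralZl//; [|exact/measurable_EFinP|by rewrite lee_fin].
  rewrite integral_indic// setIT.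
  have -> : omega (cube Q) = (meas omega (cube Q))%:E.
    by apply: measE; case: (DD_oo (sD Qs)).
  rewrite -EFinM kE// /average /pairing -/(w Q); congr EFin.
  rewrite -[RHS]/((meas omega (cube Q))^-1 * bochner_integral_on omega (cube Q) g (w Q) *
    meas omega (cube Q)).
  by rewrite mulrAC mulVf ?mul1r// gt_eqF// s_omega.
have fFint Q : Q \in DD -> bint sigma (cube Q) fF.
  move=> QD; split; first exact: simple_smeas.
  have mfF : measurable_fun setT (fun x => `|fF x|).
    exact: (@measurable_simple _ _ _ _ _ (fun v => `|v|) sfF).
  apply: (@le_lt_trans _ _ (\int[sigma]_(x in cube Q) (cst alpha%:E x))%E).
    apply: ge0_le_integral => //; first exact/measurable_EFinP/measurable_funTS.
    by move=> x _; rewrite lee_fin.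
  by rewrite integral_cst//= lte_mul_pinfty//; case: (DD_oo QD).
have fle Q : Q \in s -> P Q ->
    bochner_integral_on sigma (cube Q) f <=v bochner_integral_on sigma (cube Q) fF.
  move=> Qs PQ; have [sQ _] := DD_oo (sD Qs).
  have [ci ce] := @bochner_cst _ _ _ C sigma (cube Q) (fun=> average sigma f Q) _ (mcube Q) sQ
    (simple_smeas (simple_fun_cst _)) (fun _ _ => erefl).
  have -> : bochner_integral_on sigma (cube Q) f = meas sigma (cube Q) *: average sigma f Q.
    by rewrite /average scalerA divff ?scale1r// gt_eqF// s_sigma.
  rewrite /meas -ce; apply: bochner_mono => //; first exact/fFint/sD.
  move=> x Qx; have := @vbig_ub R C _ s P (fun Q => (\1_(cube Q) x : R) *: average sigma f Q) Q Qs PQ.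
  by rewrite indicE mem_set// scale1r.
have key x : \sum_(Q <- L) (k Q * \1_(cube Q) x) <= gG x (T_loc DD sigma lam R0 fF x).
  pose z Q : R := if Q \in DD then
    \1_(cube Q) x * gG x (lam Q (bochner_integral_on sigma (cube Q) fF)) else 0.
  have z0 Q : 0 <= z Q.
    rewrite /z; case: ifPn => // QD; rewrite mulr_ge0//; apply: dual_ge0 => //.
    by apply: lam_ge0 => //; apply: bochner_ge0 => //; exact: fFint.
  have -> : gG x (T_loc DD sigma lam R0 fF x) = \sum_(Q <- DD | Q <=c R0) z Q.
    rewrite /T_loc linear_sum big_seq_cond [RHS]big_seq_cond.
    by apply: eq_bigr => Q /andP[QD _]; rewrite linearZ /z QD.
  apply: (@le_trans _ _ (\sum_(Q <- s | P Q) z Q)); last first.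
    by apply: ler_sum_sub => // [|Q Qs PQ]; [exact: fset_uniq|split; [exact: sD|exact: PR0]].
  rewrite -[leRHS]big_filter -/L big_seq [leRHS]big_seq; apply: ler_sum => Q /LsP[Qs PQ].
  have [Qx|Qx] := pselect (cube Q x); last first.
    by rewrite /z (sD Qs) indicE memNset// mulr0 mul0r.
  rewrite /z (sD Qs) (kE _ Qs).
  rewrite [leLHS]mulrC.
  apply: ler_wpM2l; first by [].
  apply: dual_mono.
  - exact: g0.
  - have := @vbig_ub R _ _ s P (fun Q => (\1_(cube Q) x : R) *: average omega g Q) Q Qs PQ.
    by rewrite indicE mem_set// scale1r.
  - exact: wge0.
  - apply: vle_subr0; rewrite -raddfB; apply: lam_ge0; first exact: sD.
    by apply: vsubr_ge0; exact: fle.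
apply: ge0_le_integral => //.
- by move=> x _; rewrite sume_ge0// => Q _; rewrite lee_fin mulr_ge0.
- by apply: emeasurable_sum => Q; apply/measurable_EFinP/measurable_funM.
- exact/measurable_EFinP.
by move=> x _; rewrite sumEFin lee_fin; exact: key.
Qed.

End test_local.

Lemma le_trans_eq2 {R : realType} (a b a' b' : R) : a' = a -> b = b' -> a <= b -> a' <= b'.
Proof. by move=> -> <-. Qed.

Lemma main_arith {R : realType} (p q' A1 A2 NF NG M c : R) :
  0 < p -> 0 < q' -> 0 <= A1 -> 0 <= A2 -> 0 <= NF -> 0 <= NG -> 0 <= M -> 0 <= c ->
  64 * 64 * M * c * (2 * ((2 * A1 * NF) `^ p^-1 * NG `^ q'^-1)) +
  64 * 64 * M * c * (2 * ((2 * A2 * NG) `^ q'^-1 * NF `^ p^-1)) <=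
  64 * 64 * 2 * ((2 * NF) `^ p^-1 * (2 * NG) `^ q'^-1) * M *
    (A1 `^ p^-1 + A2 `^ q'^-1) * c.
Proof.
move=> p0 q'0 A10 A20 NF0 NG0 M0 c0.
rewrite (_ : 2 * A1 * NF = A1 * (2 * NF)); last by ring.
rewrite (_ : 2 * A2 * NG = A2 * (2 * NG)); last by ring.
rewrite (powRM _ A10 (mulr_ge0 (ler0n R 2) NF0)) (powRM _ A20 (mulr_ge0 (ler0n R 2) NG0)).
have h (x e : R) : 0 < e -> 0 <= x -> x `^ e^-1 <= (2 * x) `^ e^-1.
  move=> e0 x0; apply: ge0_ler_powR; rewrite ?nnegrE ?invr_ge0 ?mulr_ge0//; first exact: ltW.
  by rewrite ler_peMl// ler1n.
have h1 := h _ _ p0 NF0; have h2 := h _ _ q'0 NG0.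
have := powR_ge0 A1 p^-1; have := powR_ge0 A2 q'^-1.
have := powR_ge0 (2 * NF) p^-1; have := powR_ge0 (2 * NG) q'^-1.
move: h1 h2 (powR_ge0 NF p^-1) (powR_ge0 NG q'^-1).
move: (A1 `^ _) (A2 `^ _) ((2 * NF) `^ _) ((2 * NG) `^ _) (NF `^ _) (NG `^ _).
move=> a b X Y x y xX yY x0 y0 Y0 X0 b0 a0.
have e1 : a * X * y <= a * X * Y by apply: ler_wpM2l => //; exact: mulr_ge0.
have e2 : b * Y * x <= b * Y * X by apply: ler_wpM2l => //; exact: mulr_ge0.
have k0 : 0 <= 64 * 64 * M * c * 2 by rewrite !mulr_ge0.
have := ler_wpM2l k0 (lerD e1 e2); apply: le_trans_eq2; ring.
Qed.

Section main_sum.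
Context {R : realType} {d' : nat} {C D : banachLatticeType R}.
Local Notation d := d'.+1.
Local Notation cube := (@cube R d).
Local Notation "Q <=c F" := (@subcube R d Q F) (at level 70).
Variables (p p' q q' M1 M2 A1 A2 c : R).
Hypotheses (p_gt1 : 1 < p) (pp' : p^-1 + p'^-1 = 1).
Hypotheses (q_gt1 : 1 < q) (qq' : q^-1 + q'^-1 = 1) (pq' : 1 <= p^-1 + q'^-1).
Hypotheses (M1_ge1 : 1 <= M1) (M2_ge1 : 1 <= M2) (A1_gt0 : 0 < A1) (A2_gt0 : 0 < A2).
Hypotheses (HLC : (HLnorm d C p <= M1%:E)%E) (HLD : (HLnorm d (dual D) q' <= M2%:E)%E).
Variables (DD : {fset dcube d}) (sigma omega : {measure set (d.-tuple R) -> \bar R}).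
Variable lam : dcube d -> {linear C -> D}.
Hypothesis lam_ge0 : forall Q, Q \in DD -> forall c : C, 0 <=v c -> 0 <=v lam Q c.
Hypotheses (c_ge0 : 0 <= c) (tb : testing_bound DD sigma omega lam p q' c).
Variable s : seq (dcube d).
Hypotheses (us : uniq s) (sD : {subset s <= DD}).
Hypothesis DD_oo : forall Q, Q \in DD -> (sigma (cube Q) < +oo)%E /\ (omega (cube Q) < +oo)%E.
Hypothesis s_sigma : forall Q, Q \in s -> 0 < meas sigma (cube Q).
Hypothesis s_omega : forall Q, Q \in s -> 0 < meas omega (cube Q).
Hypothesis Ainf_sigma : forall F, F \in s ->
  (\int[omega]_x Ainf_max DD sigma omega F x <= (A1 * meas sigma (cube F))%:E)%E.
Hypothesis Ainf_omega : forall F, F \in s ->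
  (\int[sigma]_x Ainf_max DD omega sigma F x <= (A2 * meas omega (cube F))%:E)%E.
Variables (f : d.-tuple R -> C) (g : d.-tuple R -> dual D).
Hypotheses (f_ge0 : forall x, 0 <=v f x) (g_ge0 : forall x, 0 <=v g x).
Hypotheses (sf : strongly_measurable f) (sg : strongly_measurable g).
Hypothesis f1 : (\int[sigma]_x (`|f x| `^ p)%:E <= 1)%E.
Hypothesis g1 : (\int[omega]_x (`|g x| `^ q')%:E <= 1)%E.

(** 64 comes twice from the stopping condition, the factors 2 from the two uses of
    sparseness and from [holder_seq], the powers from Doob's inequality. *)
Definition bound_const : R :=
  64 * 64 * 2 * ((2 * (2 * p' `^ p)) `^ p^-1 * (2 * (2 * q `^ q')) `^ q'^-1).

Lemma main_sum : \sum_(Q <- s) pairing sigma omega lam f g Q <=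
  bound_const * (M1 * M2) * (A1 `^ p^-1 + A2 `^ q'^-1) * c.
Proof.
have q'_gt1 : 1 < q' by exact: conjugate_gt1 qq'.
have p0 : 0 < p by exact: lt_trans p_gt1.
have q'0 : 0 < q' by exact: lt_trans q'_gt1.
have p'0 : 0 < p' by exact: lt_trans (conjugate_gt1 p_gt1 pp').
have q0 : 0 < q by exact: lt_trans q_gt1.
have qq'c : q'^-1 + q^-1 = 1 by rewrite addrC.
have s_oo Q : Q \in s -> (sigma (cube Q) < +oo)%E /\ (omega (cube Q) < +oo)%E.
  by move=> /sD /DD_oo.
have mcube Q : measurable (cube Q) by exact: measurable_cube.
have f_int Q : Q \in s -> bint sigma (cube Q) f.
  move=> /s_oo[h _]; apply: (@bint_Lp _ _ _ _ _ _ _ p) => //; first exact: ltW.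
  by apply: le_lt_trans f1 _; rewrite ltry.
have g_int Q : Q \in s -> bint omega (cube Q) g.
  move=> /s_oo[_ h]; apply: (@bint_Lp _ _ _ _ _ _ _ q') => //; first exact: ltW.
  by apply: le_lt_trans g1 _; rewrite ltry.
have [Fm [pf [[uF Fs pfP pfb] [supF carF packF]]]] := principal_cubes p_gt1 pp' M1_ge1 HLC
  us f_ge0 sf f1 (fun Q Qs => (s_oo Q Qs).1) s_sigma.
have [Gm [pg [[uG Gs pgP pgb] [supG carG packG]]]] := principal_cubes q'_gt1 qq'c M2_ge1 HLD
  us g_ge0 sg g1 (fun Q Qs => (s_oo Q Qs).2) s_omega.
pose a := pairing sigma omega lam f g.
pose nf := norm_average sigma f; pose ng := norm_average omega g.
pose ms Q := meas sigma (cube Q); pose mo Q := meas omega (cube Q).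
have nf0 F : 0 <= nf F by exact: norm_average_ge0.
have ng0 F : 0 <= ng F by exact: norm_average_ge0.
have ms0 F : 0 <= ms F by exact: meas_ge0.
have mo0 F : 0 <= mo F by exact: meas_ge0.
have M10 : 0 <= M1 by exact: le_trans M1_ge1.
have M20 : 0 <= M2 by exact: le_trans M2_ge1.
pose k := 64 * 64 * (M1 * M2) * c.
have k0 : 0 <= k by rewrite !mulr_ge0.
have a0 Q : Q \in s -> 0 <= a Q.
  move=> Qs; apply: dual_ge0.
    by apply: bochner_ge0 => //; exact: g_int.
  by apply: lam_ge0; [exact: sD|apply: bochner_ge0 => //; exact: f_int].
have loc R0 F G (P : pred (dcube d)) : R0 \in s -> F \in s -> G \in s ->
    (forall Q, Q \in s -> P Q -> [/\ pf Q = F, pg Q = G & Q <=c R0]) ->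
    \sum_(Q <- s | P Q) a Q <= k * (nf F * ms R0 `^ p^-1 * (ng G * mo R0 `^ q'^-1)).
  move=> R0s Fs' Gs' PP.
  have := @test_local R d' C D DD sigma omega lam lam_ge0 p q' c c_ge0 tb s us sD DD_oo
    s_sigma s_omega f g f_ge0 g_ge0 f_int g_int R0 P (64 * M1 * nf F) (64 * M2 * ng G)
    (sD R0s) (fun Q Qs PQ => let: And3 _ _ h := PP Q Qs PQ in h).
  rewrite -/a => h; apply: le_trans (h _ _ _ _) _.
  - by rewrite mulr_ge0// mulr_ge0.
  - by rewrite mulr_ge0// mulr_ge0.
  - by move=> x; apply: supF => // Q Qs PQ; case: (PP Q Qs PQ).
  - by move=> x; apply: supG => // Q Qs PQ; case: (PP Q Qs PQ).
  by rewrite /k -/(ms R0) -/(mo R0) le_eqVlt; apply/orP; left; apply/eqP; ring.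
have NF0 : 0 < 2 * p' `^ p by rewrite mulr_gt0// powR_gt0.
have NG0 : 0 < 2 * q `^ q' by rewrite mulr_gt0// powR_gt0.
have half1 : \sum_(Q <- s | pg Q <=c pf Q) a Q <=
    k * (2 * ((2 * A1 * (2 * p' `^ p)) `^ p^-1 * (2 * q `^ q') `^ q'^-1)).
  apply: (@half_sum R d s Fm Gm pf pg uF uG Gs pfP pgP pfb a nf ng ms mo) => //.
  - by rewrite mulr_gt0.
  - move=> G P GG PG; apply: loc; [exact: Gs| |exact: Gs|].
      by case: (pfP _ (Gs _ GG)) => /Fs.
    move=> Q Qs /(PG _ Qs)[e1 e2]; split => //.
    by rewrite -e1; case: (pgP _ Qs).
  - move=> F FF; apply: (packG _ DD) => //; last exact: Ainf_sigma (Fs _ FF).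
    by move=> Q /s_oo[].
have half2 : \sum_(Q <- s | pf Q <=c pg Q) a Q <=
    k * (2 * ((2 * A2 * (2 * q `^ q')) `^ q'^-1 * (2 * p' `^ p) `^ p^-1)).
  apply: (@half_sum R d s Gm Fm pg pf uG uF Fs pgP pfP pgb a ng nf mo ms) => //.
  - by rewrite addrC.
  - by rewrite mulr_gt0.
  - move=> F P FF PF; rewrite [X in k * X]mulrC; apply: loc; [exact: Fs|exact: Fs| |].
      by case: (pgP _ (Fs _ FF)) => /Gs.
    move=> Q Qs /(PF _ Qs)[e1 e2]; split => //.
    by rewrite -e1; case: (pfP _ Qs).
  - move=> G GG; apply: (packF _ DD) => //; last exact: Ainf_omega (Gs _ GG).
    by move=> Q /s_oo[].
apply: (@le_trans _ _ (\sum_(Q <- s | pg Q <=c pf Q) a Q + \sum_(Q <- s | pf Q <=c pg Q) a Q)).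
  rewrite [X in _ <= X + _]big_mkcond [X in _ <= _ + X]big_mkcond -big_split/=.
  rewrite big_seq [leRHS]big_seq; apply: ler_sum => Q Qs.
  have [_ Qf _] := pfP _ Qs; have [_ Qg _] := pgP _ Qs; have aQ := a0 _ Qs.
  rewrite -/(a Q); have [->|->] := subcube_total Qf Qg.
    by rewrite lerDr; case: ifP.
  by rewrite lerDl; case: ifP.
apply: le_trans (lerD half1 half2) _.
apply: main_arith => //; rewrite ?mulr_ge0 ?powR_ge0//; exact: ltW.
Qed.

End main_sum.

(** * Duality and the lower bound *)

Lemma vabs_continuous {R : realType} {E : banachLatticeType R} :
  continuous (vabs : E -> E).
Proof.
move=> x; apply/cvgrPdist_le => e e0; near=> y.
apply: le_trans (vabs_lip x y) _; near: y; move: e e0; apply/cvgrPdist_le.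
exact: cvg_id.
Unshelve. all: by end_near. Qed.

Section evaluation.
Context {R : realType} {E : banachLatticeType R}.
Variable y : E.

Let ev (f : dual E) : R^o := f y.

Let ev_linear : linear ev. Proof. by []. Qed.

Let ev_bound f : `|ev f| <= `|y| * `|f|.
Proof. by rewrite mulrC; exact: ler_dual. Qed.

Definition evaluation : dual (dual E) :=
  Dual (@linear_bounded_functional _ _ ev `|y| ev_linear ev_bound).

End evaluation.

Section extremal.
Context {disp} {T : measurableType disp} {R : realType} {D : banachLatticeType R}.
Variables (omega : {measure set T -> \bar R}) (q q' : R).
Hypotheses (q_gt1 : 1 < q) (qq' : q^-1 + q'^-1 = 1).

Let q_gt0 : 0 < q. Proof. exact: lt_trans q_gt1. Qed.

Lemma le_integral_power (u v : T -> D) : simple_fun u -> simple_fun v ->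
  (forall x, `|u x| <= `|v x|) ->
  (\int[omega]_x (`|u x| `^ q)%:E <= \int[omega]_x (`|v x| `^ q)%:E)%E.
Proof.
move=> su sv uv; apply: ge0_le_integral => //.
- apply/measurable_EFinP; exact: (@measurable_simple _ _ _ _ _ (fun y => `|y| `^ q) su).
- apply/measurable_EFinP; exact: (@measurable_simple _ _ _ _ _ (fun y => `|y| `^ q) sv).
by move=> x _; rewrite lee_fin; apply: ge0_ler_powR; rewrite ?nnegrE//; exact: ltW.
Qed.

(** The extremal dual function g = |h|^(q-1) psi(h), where psi(y) is a positive functional
    that norms y, is measurable because [h] takes finitely many values. *)
Lemma extremal (h : T -> D) (b : R) : simple_fun h -> (forall x, 0 <=v h x) -> 0 <= b ->
  (\int[omega]_x (`|h x| `^ q)%:E < +oo)%E ->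
  (forall g : T -> dual D, simple_fun g -> (forall x, 0 <=v g x) ->
    (\int[omega]_x (`|g x| `^ q')%:E <= 1)%E -> (\int[omega]_x (g x (h x))%:E <= b%:E)%E) ->
  (\int[omega]_x (`|h x| `^ q)%:E <= (b `^ q)%:E)%E.
Proof.
move=> sh h0 b0; pose nu x := `|h x| `^ q; pose Z := (\int[omega]_x (nu x)%:E)%E.
rewrite -/Z => Zoo Hb.
have q'_gt1 : 1 < q' by exact: conjugate_gt1 qq'.
have q'_gt0 : 0 < q' by exact: lt_trans q'_gt1.
have mnu : measurable_fun setT nu.
  exact: (@measurable_simple _ _ _ _ _ (fun y => `|y| `^ q) sh).
have Z0 : (0 <= Z)%E by apply: integral_ge0 => x _; rewrite lee_fin powR_ge0.
have ZE : Z = (fine Z)%:E by rewrite fineK// ge0_fin_numE.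
have [Z00|Zn0] := eqVneq Z 0%E; first by rewrite Z00 lee_fin powR_ge0.
have Zr0 : 0 < fine Z by rewrite fine_gt0// lt0e Zn0 Z0.
pose t := fine Z `^ (- q'^-1); have t0 : 0 < t by exact: powR_gt0.
pose psi y := projT1 (cid (@positive_functional _ D y)).
have psiP y : 0 <=v y -> [/\ 0 <=v psi y, `|psi y| <= 1 & psi y y = `|y|].
  rewrite /psi; case: cid => /= phi [phi0 phi1 e] y0; split => //.
  rewrite e; congr (`|_|); apply: vle_anti; last exact: vsup_ubl.
  by apply: vsup_lub => //; exact: vle_refl.
pose g x := (t * `|h x| `^ (q - 1)) *: psi (h x).
have sg : simple_fun g.
  exact: (simple_fun_comp (fun y => (t * `|y| `^ (q - 1)) *: psi y) sh).
have k0 x : 0 <= t * `|h x| `^ (q - 1) by rewrite mulr_ge0 ?powR_ge0// ltW.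
have g0 x : 0 <=v g x by apply: vscale_ge0 => //; case: (psiP _ (h0 x)).
have g1 : (\int[omega]_x (`|g x| `^ q')%:E <= 1)%E.
  apply: (@le_trans _ _ (\int[omega]_x ((fine Z)^-1%:E * (nu x)%:E))%E).
    apply: ge0_le_integral => //.
    - apply/measurable_EFinP.
      exact: (@measurable_simple _ _ _ _ _ (fun y => `|y| `^ q') sg).
    - by apply: emeasurable_funM => //; exact/measurable_EFinP.
    move=> x _; rewrite -EFinM lee_fin; have [_ p1 _] := psiP _ (h0 x).
    apply: (@le_trans _ _ ((t * `|h x| `^ (q - 1)) `^ q')).
      apply: ge0_ler_powR; rewrite ?nnegrE//; first exact: ltW.
      by rewrite normrZ ger0_norm// ler_piMr.
    rewrite /t powRM ?powR_ge0//.
    rewrite -!powRrM mulNr mulVf ?gt_eqF// powR_inv1; last exact: ltW.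
    by rewrite (conjugateM q_gt1 qq').
  rewrite ge0_integralZl//; [|exact/measurable_EFinP| |].
  - by rewrite -/Z ZE -EFinM lee_fin mulVf// gt_eqF.
  - by move=> x _; rewrite lee_fin powR_ge0.
  - by rewrite lee_fin invr_ge0 ltW.
have := Hb g sg g0 g1.
have -> : (\int[omega]_x (g x (h x))%:E = (t * fine Z)%:E)%E.
  rewrite EFinM -ZE -ge0_integralZl//; [|exact/measurable_EFinP| |].
  - apply: eq_integral => x _; rewrite -EFinM; congr EFin.
    have [_ _ e] := psiP _ (h0 x).
    rewrite -[LHS]/(t * `|h x| `^ (q - 1) * psi (h x) (h x)) e -mulrA; congr (_ * _).
    by rewrite mulrC mulr_powRB1.
  - by move=> x _; rewrite lee_fin powR_ge0.
  - by rewrite lee_fin ltW.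
rewrite lee_fin => tZ; rewrite ZE lee_fin.
have e : t * fine Z = fine Z `^ q^-1.
  rewrite -[X in t * X]powRr1; last exact: ltW.
  rewrite -powRD; last by rewrite (gt_eqF Zr0) implybT.
  by rewrite -qq' addrCA addNr addr0.
rewrite e in tZ; rewrite -[leLHS]powRr1; last exact: ltW.
rewrite -[X in _ `^ X](@mulVf _ q) ?gt_eqF// powRrM.
by apply: ge0_ler_powR => //; rewrite ?nnegrE ?powR_ge0//; exact: ltW.
Qed.

End extremal.

Lemma opnorm_ge0 {disp1 disp2} {T1 : measurableType disp1} {T2 : measurableType disp2}
  {R : realType} {E F : normedModType R} (mu : {measure set T1 -> \bar R})
  (nu : {measure set T2 -> \bar R}) (p : R) (q : \bar R) (A : (T1 -> E) -> T2 -> F) :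
  0 < p -> (0 <= opnorm mu nu p%:E q A)%E.
Proof.
move=> p0; have b1 : (bnorm mu p%:E (cst 0%R : T1 -> E) <= 1)%E.
  rewrite (bnorm_leP _ _ p0 ler01) powR1.
  under eq_integral do rewrite normr0 powR0 ?gt_eqF//.
  by rewrite integral0.
apply: (@le_trans _ _ (bnorm nu q (A (cst 0)))); first exact: Lnorm_ge0.
apply: ereal_sup_ubound; exists (cst 0) => //=; split => //; split.
  exact: simple_smeas (simple_fun_cst _).
by apply: le_lt_trans b1 _; rewrite ltry.
Qed.

Section duality.
Context {R : realType} {d' : nat} {C D : banachLatticeType R}.
Local Notation d := d'.+1.
Local Notation cube := (@cube R d).
Variables (p q q' : R) (p_gt1 : 1 < p) (q_gt1 : 1 < q) (qq' : q^-1 + q'^-1 = 1).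
Variables (DD : {fset dcube d}) (sigma omega : {measure set (d.-tuple R) -> \bar R}).
Variable lam : dcube d -> {linear C -> D}.
Hypothesis lam_ge0 : forall Q, Q \in DD -> forall c : C, 0 <=v c -> 0 <=v lam Q c.
Hypothesis DD_oo : forall Q, Q \in DD -> (sigma (cube Q) < +oo)%E /\ (omega (cube Q) < +oo)%E.
Local Notation T := (T_op DD sigma lam).

Let p_gt0 : 0 < p. Proof. exact: lt_trans p_gt1. Qed.
Let q_gt0 : 0 < q. Proof. exact: lt_trans q_gt1. Qed.
Let mcube Q : measurable (cube Q). Proof. exact: measurable_cube. Qed.

Lemma bint_cube_Lp Q (f : d.-tuple R -> C) : Q \in DD -> strongly_measurable f ->
  (\int[sigma]_x (`|f x| `^ p)%:E < +oo)%E -> bint sigma (cube Q) f.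
Proof.
by move=> /DD_oo[h _] sf fp; apply: bint_Lp fp => //; exact: ltW.
Qed.

Lemma smeas_vabs (f : d.-tuple R -> C) : strongly_measurable f ->
  strongly_measurable (fun x => vabs (f x)).
Proof. exact: smeas_comp vabs_continuous. Qed.

Lemma simple_T (f : d.-tuple R -> C) (P : pred (dcube d)) :
  simple_fun (fun x => \sum_(Q <- DD | P Q)
     (\1_(cube Q) x : R) *: lam Q (bochner_integral_on sigma (cube Q) f)).
Proof.
by apply: simple_fun_sum => Q; apply: simple_fun_restr => //; exact: simple_fun_cst.
Qed.

Lemma lam_mono Q (x y : C) : Q \in DD -> x <=v y -> lam Q x <=v lam Q y.
Proof.
move=> QD xy; apply: vle_subr0; rewrite -raddfB; apply: lam_ge0 => //.
exact: vsubr_ge0.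
Qed.

Lemma T_ge0 (f : d.-tuple R -> C) (P : pred (dcube d)) x : (forall x, 0 <=v f x) ->
  (forall Q, Q \in DD -> bint sigma (cube Q) f) ->
  0 <=v \sum_(Q <- DD | P Q)
     (\1_(cube Q) x : R) *: lam Q (bochner_integral_on sigma (cube Q) f).
Proof.
move=> f0 fi; rewrite big_seq_cond; apply: vsum_ge0 => Q /andP[QD _].
apply: vscale_ge0 => //; apply: lam_ge0 => //.
by apply: bochner_ge0 => //; exact: fi.
Qed.

Lemma T_vabs (f : d.-tuple R -> C) (P : pred (dcube d)) x :
  (forall Q, Q \in DD -> bint sigma (cube Q) f) ->
  `|\sum_(Q <- DD | P Q) (\1_(cube Q) x : R) *: lam Q (bochner_integral_on sigma (cube Q) f)|
  <= `|T (fun x => vabs (f x)) x|.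
Proof.
move=> fi; have fi' Q : Q \in DD -> bint sigma (cube Q) (fun x => vabs (f x)).
  move=> /fi[sf foo]; split; first exact: smeas_vabs.
  by under eq_integral do rewrite vnorm_abs.
apply: vnorm_le_ge0.
pose z Q := (\1_(cube Q) x : R) *:
  lam Q (bochner_integral_on sigma (cube Q) (fun x => vabs (f x))).
apply: (@vle_trans _ _ _ (\sum_(Q <- DD | P Q) z Q)).
  apply: vle_trans (vabs_sum _ _ _) _; rewrite big_seq_cond [X in _ <=v X]big_seq_cond.
  apply: vsum_mono => Q /andP[QD _]; rewrite vabsZ//; apply: vscale_mono => //.
  have mi := bochner_mono (mcube Q) (fi Q QD) (fi' Q QD) (fun x _ => vsup_ubl _ _).
  have [mfi me] := bochnerZ (-1) (mcube Q) (fi Q QD).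
  have := bochner_mono (mcube Q) mfi (fi' Q QD) => /(_ _)/wrap[x0 _|].
    by rewrite scaleN1r; exact: vsup_ubr.
  rewrite me scaleN1r => mi'; apply: vabs_le; first exact: lam_mono.
  by rewrite -raddfN; exact: lam_mono.
rewrite /T_op [X in _ <=v X](bigID P)/= -[X in X <=v _]addr0; apply: vleD.
  exact: vle_refl.
by apply: T_ge0 => // y; exact: vabs_ge0.
Qed.

Lemma simple_integrable_cubes (h : d.-tuple R -> R^o) : simple_fun h ->
  (forall x, 0 <= h x) -> (forall x, (forall Q, Q \in DD -> ~ cube Q x) -> h x = 0) ->
  (\int[omega]_x (h x)%:E < +oo)%E.
Proof.
move=> sh h0 hD; have [K K0 hK] := simple_fun_bounded sh.
apply: (@le_lt_trans _ _ (\int[omega]_x \sum_(Q <- DD) (K * \1_(cube Q) x)%:E)%E).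
  apply: ge0_le_integral => //.
  - by move=> x _; rewrite lee_fin.
  - by apply/measurable_EFinP; exact: (@measurable_simple _ _ _ _ _ (fun x => x : R) sh).
  - by apply: emeasurable_sum => Q; apply/measurable_EFinP/measurable_funM.
  move=> x _; rewrite sumEFin lee_fin.
  have t0 (Q : dcube d) : 0 <= K * \1_(cube Q) x by rewrite mulr_ge0// ltW.
  have [[Q [QD Qx]]|none] := pselect (exists Q, Q \in DD /\ cube Q x).
    rewrite (big_rem Q)//= indicE mem_set// mulr1.
    rewrite (le_trans (le_trans (ler_norm _) (hK x)))// lerDl; exact: sumr_ge0.
  by rewrite hD ?sumr_ge0// => Q QD Qx; apply: none; exists Q.
rewrite ge0_integral_sum//; last 2 first.
- by move=> Q; apply/measurable_EFinP/measurable_funM.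
- by move=> Q x _; rewrite lee_fin mulr_ge0// ltW.
rewrite big_seq; apply: lte_sum_pinfty => Q QD.
under eq_integral do rewrite EFinM.
rewrite ge0_integralZl//; [|exact/measurable_EFinP|by rewrite lee_fin ltW].
rewrite integral_indic// setIT lte_mul_pinfty ?lee_fin ?ltW//.
by case: (DD_oo QD).
Qed.

(** Cubes that are null for one of the measures contribute nothing to the form, and
    averages are available on the others. *)
Definition charged : seq (dcube d) :=
  [seq Q <- DD | (0 < meas sigma (cube Q)) && (0 < meas omega (cube Q))].

Lemma integral_null {E : banachLatticeType R} (mu : {measure set (d.-tuple R) -> \bar R})
  (f : d.-tuple R -> E) Q : (mu (cube Q) < +oo)%E -> ~~ (0 < meas mu (cube Q)) ->
  bint mu (cube Q) f -> bochner_integral_on mu (cube Q) f = 0.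
Proof.
move=> Qoo m0 fi; apply/eqP; rewrite -normr_le0.
apply: le_trans (bochner_norm (mcube Q) fi) _.
have mu0 : mu (cube Q) = 0%E.
  have : mu (cube Q) = (meas mu (cube Q))%:E by exact: measE.
  move=> ->; congr EFin; apply/eqP; rewrite eq_le meas_ge0 andbT leNgt//.
rewrite /Rintegral (@null_set_integral _ _ _ mu (cube Q))//.
by apply/measurable_EFinP/measurable_funTS; exact: measurable_norm_smeas fi.1.
Qed.

Lemma pairing_sum (f : d.-tuple R -> C) (g : d.-tuple R -> dual D) :
  (forall x, 0 <=v f x) -> (forall x, 0 <=v g x) ->
  (forall Q, Q \in DD -> bint sigma (cube Q) f) ->
  (forall Q, Q \in DD -> bint omega (cube Q) g) ->
  (\int[omega]_x (g x (T f x))%:E)%E =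
  (\sum_(Q <- charged) pairing sigma omega lam f g Q)%:E.
Proof.
move=> f0 g0 fi gi; pose w Q := lam Q (bochner_integral_on sigma (cube Q) f).
have w0 Q : Q \in DD -> 0 <=v w Q.
  by move=> QD; apply: lam_ge0 => //; apply: bochner_ge0 => //; exact: fi.
pose z Q x : R := if Q \in DD then \1_(cube Q) x * g x (w Q) else 0.
transitivity (\int[omega]_x (\sum_(Q <- DD) (z Q x)%:E)%E)%E.
  apply: eq_integral => x _; rewrite sumEFin; congr EFin.
  rewrite /T_op linear_sum big_seq [RHS]big_seq; apply: eq_bigr => Q QD.
  by rewrite /z QD linearZ.
have mz Q : measurable_fun setT (z Q).
  have [QD|QD] := boolP (Q \in DD); last first.
    have -> : z Q = cst 0 by apply/funext => x; rewrite /z (negbTE QD).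
    exact: measurable_cst.
  have -> : z Q = fun x => \1_(cube Q) x * g x (w Q) by apply/funext => x; rewrite /z QD.
  apply: measurable_funM => //.
  exact: (measurable_smeas (@dual_continuous _ _ (evaluation (w Q))) (gi _ QD).1).
rewrite ge0_integral_sum//; first last.
- move=> Q x _; rewrite /z lee_fin; case: ifPn => // QD; apply: mulr_ge0 => //.
  by apply: dual_ge0 => //; exact: w0.
- by move=> Q; exact/measurable_EFinP.
transitivity (\sum_(Q <- DD) (pairing sigma omega lam f g Q)%:E)%E.
  apply: eq_big_seq => Q QD; rewrite /pairing -/(w Q).
  have -> : bochner_integral_on omega (cube Q) g (w Q) =
      evaluation (w Q) (bochner_integral_on omega (cube Q) g) by [].
  rewrite (bochner_dual _ (mcube Q) (gi _ QD)) /Rintegral fineK; last first.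
    by apply: integrable_fin_num => //; exact: bint_dual (gi _ QD).
  rewrite [RHS]integral_mkcond; apply: eq_integral => x _; rewrite /z QD patchE.
  rewrite indicE; case: ifPn => _; first by rewrite mul1r.
  by rewrite mul0r.
rewrite sumEFin; congr EFin; rewrite /charged big_filter [RHS]big_mkcond/=.
apply: eq_big_seq => Q QD; case: ifPn => //; rewrite negb_and /pairing.
have [soo ooo] := DD_oo QD.
move=> /orP[h|h].
  by rewrite (integral_null soo h (fi _ QD)) !linear0.
by rewrite (integral_null ooo h (gi _ QD)).
Qed.

(** As the λ_Q are positive, |T f| is at most |T (vabs f)|.  The latter is a simple
    positive function of x, and its pairing with a dual function is the form. *)
Lemma duality (b : R) : 0 <= b ->
  (forall f g, (forall x, 0 <=v f x) -> (forall x, 0 <=v g x) ->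
    strongly_measurable f -> strongly_measurable g ->
    (\int[sigma]_x (`|f x| `^ p)%:E <= 1)%E -> (\int[omega]_x (`|g x| `^ q')%:E <= 1)%E ->
    \sum_(Q <- charged) pairing sigma omega lam f g Q <= b) ->
  (opnorm sigma omega p%:E q%:E T <= b%:E)%E.
Proof.
move=> b0 Hb; apply: ge_ereal_sup => _ [f [[sf _] f1] <-].
have q'_gt1 : 1 < q' by exact: conjugate_gt1 qq'.
have q'_gt0 : 0 < q' by exact: lt_trans q'_gt1.
have f1' : (\int[sigma]_x (`|f x| `^ p)%:E <= 1)%E by rewrite bnorm_leP ?powR1// in f1.
pose F x := vabs (f x); have F0 x : 0 <=v F x by exact: vabs_ge0.
have sF : strongly_measurable F by exact: smeas_vabs.
have F1 : (\int[sigma]_x (`|F x| `^ p)%:E <= 1)%E.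
  by under eq_integral do rewrite vnorm_abs.
have fin1 (x : \bar R) : (x <= 1 -> x < +oo)%E by move=> h; apply: le_lt_trans h _; rewrite ltry.
have fi Q : Q \in DD -> bint sigma (cube Q) f.
  by move=> QD; exact: bint_cube_Lp QD sf (fin1 _ f1').
have Fi Q : Q \in DD -> bint sigma (cube Q) F.
  by move=> QD; exact: bint_cube_Lp QD sF (fin1 _ F1).
pose h := T F; have sh : simple_fun h by exact: (simple_T F xpredT).
have h0 x : 0 <=v h x by exact: T_ge0.
have sTf : simple_fun (T f) by exact: (simple_T f xpredT).
have Tfh x : `|T f x| <= `|h x| by exact: (T_vabs xpredT x fi).
rewrite (bnorm_leP _ _ q_gt0 b0).
apply: (le_trans (le_integral_power omega q_gt1 sTf sh Tfh)).
have hout x : (forall Q, Q \in DD -> ~ cube Q x) -> h x = 0.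
  move=> hx; rewrite /h /T_op big1_seq// => Q /= QD.
  by rewrite indicE memNset ?scale0r//; exact: hx.
have hoo : (\int[omega]_x (`|h x| `^ q)%:E < +oo)%E.
  apply: (simple_integrable_cubes (simple_fun_comp (fun y : D => `|y| `^ q : R^o) sh)).
    by move=> x; exact: powR_ge0.
  by move=> x hx; rewrite /= (hout _ hx) normr0 powR0// gt_eqF.
apply: (extremal q_gt1 qq' sh h0 b0 hoo) => g sg g0 g1.
have gi Q : Q \in DD -> bint omega (cube Q) g.
  by move=> /DD_oo[_ Qoo]; exact: (bint_Lp (ltW q'_gt1) (mcube Q) Qoo (simple_smeas sg) (fin1 _ g1)).
have := Hb F g F0 g0 sF (simple_smeas sg) F1 g1.
by rewrite -lee_fin -pairing_sum.
Qed.

(** The norm of [f] is replaced by N + e, which is positive, to avoid a case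
    distinction when N = 0. *)
Lemma opnorm_scale (c N : R) (f : d.-tuple R -> C) : 0 <= c -> 0 <= N ->
  (opnorm sigma omega p%:E q%:E T <= c%:E)%E -> strongly_measurable f ->
  (\int[sigma]_x (`|f x| `^ p)%:E <= (N `^ p)%:E)%E ->
  (bnorm omega q%:E (T f) <= (c * N)%:E)%E.
Proof.
move=> c0 N0 Tc sf fN.
have fi Q : Q \in DD -> bint sigma (cube Q) f.
  by move=> QD; apply: (bint_cube_Lp QD sf); apply: le_lt_trans fN _; rewrite ltry.
have scale (E : banachLatticeType R) (mu : {measure set (d.-tuple R) -> \bar R}) (r a : R)
    (u : d.-tuple R -> E) : 0 <= a -> strongly_measurable u ->
    (\int[mu]_x (`|a *: u x| `^ r)%:E = (a `^ r)%:E * \int[mu]_x (`|u x| `^ r)%:E)%E.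
  move=> a0 su; rewrite -ge0_integralZl//.
  - apply: eq_integral => x _; rewrite -EFinM; congr EFin.
    by rewrite normrZ ger0_norm// powRM.
  - apply/measurable_EFinP; apply: (@measurableT_comp _ _ _ _ _ _ (fun t => t `^ r)) => //.
    exact: measurable_norm_smeas.
  - by rewrite lee_fin powR_ge0.
apply/lee_addgt0Pr => e e0; pose e' := e / (c + 1).
have c1 : 0 < c + 1 by rewrite ltr_wpDl.
have e'0 : 0 < e' by rewrite divr_gt0.
pose N' := N + e'; have N'0 : 0 < N' by rewrite ltr_wpDl.
have N'V : 0 <= N'^-1 by rewrite invr_ge0 ltW.
have sTf : strongly_measurable (T f) by apply: simple_smeas; exact: (simple_T f xpredT).
have le1 : (bnorm omega q%:E (fun x => (N'^-1)%R *: T f x) <= c%:E)%E.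
  apply: le_trans Tc.
  have -> : (fun x => N'^-1 *: T f x) = T (fun x => N'^-1 *: f x).
    apply/funext => x; rewrite /T_op scaler_sumr big_seq [RHS]big_seq.
    apply: eq_bigr => Q QD; have [_ ->] := bochnerZ N'^-1 (mcube Q) (fi Q QD).
    by rewrite [in RHS]linearZ /= !scalerA mulrC.
  apply: ereal_sup_ubound; exists (fun x => N'^-1 *: f x) => //=.
  have b1 : (bnorm sigma p%:E (fun x => (N'^-1)%R *: f x) <= 1)%E.
    rewrite (bnorm_leP _ _ p_gt0 ler01) scale// powR1.
    apply: (@le_trans _ _ ((N'^-1 `^ p)%:E * (N `^ p)%:E)%E).
      by apply: lee_wpmul2l => //; rewrite lee_fin powR_ge0.
    rewrite -EFinM lee_fin -powRM//.
    have e1 : 1 = 1 `^ p :> R by rewrite powR1.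
    rewrite [leRHS]e1; apply: ge0_ler_powR; rewrite ?nnegrE ?mulr_ge0//; first exact: ltW.
    by rewrite mulrC ler_pdivrMr// mul1r lerDl ltW.
  split => //; split; first exact: smeasZ.
  by apply: le_lt_trans b1 _; rewrite ltry.
have le2 : (bnorm omega q%:E (T f) <= (c * N')%:E)%E.
  have cN' : 0 <= c * N' by rewrite mulr_ge0// ltW.
  have N'q : (0 <= (N' `^ q)%:E)%E by rewrite lee_fin powR_ge0.
  move: le1; rewrite !bnorm_leP// scale// => /(lee_wpmul2l N'q).
  rewrite muleA -!EFinM -(powRM _ (ltW N'0) N'V) -(powRM _ (ltW N'0) c0).
  by rewrite divff ?gt_eqF// powR1 mul1e mulrC.
apply: (le_trans le2); rewrite -EFinD lee_fin mulrDr lerD2l mulrA ler_pdivrMr// mulrC.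
by rewrite ler_wpM2l ?lerDl// ltW.
Qed.

Lemma ae_le_bnorm {E : normedModType R} (mu : {measure set (d.-tuple R) -> \bar R})
  (f : d.-tuple R -> E) : Lp mu +oo%E f ->
  \forall x \ae mu, `|f x| <= fine (bnorm mu +oo f).
Proof.
move=> [_ foo]; have f0 : (0 <= bnorm mu +oo f)%E by exact: Lnorm_ge0.
have fE : bnorm mu +oo f = (fine (bnorm mu +oo f))%:E by rewrite fineK// ge0_fin_numE.
have : (bnorm mu +oo f <= (fine (bnorm mu +oo f))%:E)%E by rewrite -fE.
rewrite {1}/bnorm Lnorm.unlock; case: ifPn => [_|].
  move=> /ess_supP; apply: filterS => x /=; by rewrite lee_fin normr_id.
rewrite -leNgt => m0 _; exists setT; split => //.
by apply/eqP; rewrite eq_le m0 measure_ge0.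
Qed.

Lemma T_loc_vabs R0 (f : d.-tuple R -> C) x :
  (forall Q, Q \in DD -> bint sigma (cube Q) f) ->
  `|T_loc DD sigma lam R0 f x| <= `|T (fun x => vabs (f x)) x|.
Proof. exact: T_vabs. Qed.

Lemma measurable_apply (g : d.-tuple R -> dual D) (u : d.-tuple R -> D) :
  strongly_measurable g -> simple_fun u -> measurable_fun setT (fun x => g x (u x)).
Proof.
move=> [s [ss sg]] su.
apply: (@measurable_smeas _ _ _ R^o (fun x => g x (u x)) id); first by move=> x; exact: cvg_id.
exists (fun n x => s n x (u x)); split.
  by move=> n; exact: (simple_fun_comp2 (fun (phi : dual D) y => phi y : R^o)).
move=> x; apply: (@continuous_cvg _ _ _ _ _ (fun n => s n x) (evaluation (u x)) (g x)) => //.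
exact: dual_continuous.
Qed.

Lemma integral_indic_hoelder (R0 : dcube d) (u : d.-tuple R -> D) (X : R) : R0 \in DD ->
  simple_fun u -> (bnorm omega q%:E u <= X%:E)%E -> 0 <= X ->
  (\int[omega]_x (`|u x| * \1_(cube R0) x)%:E <= (X * meas omega (cube R0) `^ q'^-1)%:E)%E.
Proof.
move=> R0D su uX X0.
have q'_gt1 : 1 < q' by exact: conjugate_gt1 qq'.
have q'_gt0 : 0 < q' by exact: lt_trans q'_gt1.
have mu' : measurable_fun setT (fun x => `|u x|).
  exact: (@measurable_simple _ _ _ _ _ (fun y => `|y|) su).
have m1 : measurable_fun setT (\1_(cube R0) : d.-tuple R -> R) by exact: measurable_indic.
have := hoelder omega mu' m1 q_gt0 q'_gt0 qq'; rewrite Lnorm1.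
have -> : (Lnorm omega q'%:E (EFin \o \1_(cube R0)) = (meas omega (cube R0) `^ q'^-1)%:E)%E.
  rewrite Lnorm.unlock.
  have -> : (\int[omega]_x `|(EFin \o \1_(cube R0)) x| `^ q' = \int[omega]_x (\1_(cube R0) x)%:E)%E.
    apply: eq_integral => x _; rewrite /= indicE; congr EFin.
    by case: (x \in cube R0); rewrite ?normr1 ?powR1// normr0 powR0// gt_eqF.
  rewrite integral_indic// setIT.
  have -> : omega (cube R0) = (meas omega (cube R0))%:E.
    by apply: measE; case: (DD_oo R0D).
  by rewrite poweR_EFin.
move=> h; apply: (@le_trans _ _ (bnorm omega q%:E u * (meas omega (cube R0) `^ q'^-1)%:E)%E).
  apply: le_trans h; rewrite le_eqVlt; apply/orP; left; apply/eqP.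
  by apply: eq_integral => x _; rewrite /= normrM normr_id ger0_norm.
by rewrite EFinM; apply: lee_wpmul2r => //; rewrite lee_fin powR_ge0.
Qed.

(** On R0 the functions satisfy |g| <= ‖g‖_∞ and |f| <= ‖f‖_∞ almost everywhere, so the
    form is at most ‖g‖_∞ times the integral of |T (vabs f)| over R0. *)
Lemma lower_bound :
  (testing_const DD sigma omega lam p q' <= opnorm sigma omega p%:E q%:E T)%E.
Proof.
have [->|Tfin] := eqVneq (opnorm sigma omega p%:E q%:E T) +oo%E; first exact: leey.
have T0 := opnorm_ge0 sigma omega q%:E T p_gt0.
have TE : opnorm sigma omega p%:E q%:E T = (fine (opnorm sigma omega p%:E q%:E T))%:E.
  by rewrite fineK// ge0_fin_numE// ltey.
set c := fine _ in TE; have c0 : 0 <= c by exact: fine_ge0.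
rewrite TE; apply: ereal_inf_lbound; exists c => //; split => // R0 R0D f g [Lf fout] [Lg gout].
have af := ae_le_bnorm Lf; have ag := ae_le_bnorm Lg.
have fE : bnorm sigma +oo f = (fine (bnorm sigma +oo f))%:E.
  by rewrite fineK// ge0_fin_numE ?Lnorm_ge0//; exact: Lf.2.
have gE : bnorm omega +oo g = (fine (bnorm omega +oo g))%:E.
  by rewrite fineK// ge0_fin_numE ?Lnorm_ge0//; exact: Lg.2.
have alpha0 : 0 <= fine (bnorm sigma +oo f) by rewrite fine_ge0// Lnorm_ge0.
have beta0 : 0 <= fine (bnorm omega +oo g) by rewrite fine_ge0// Lnorm_ge0.
rewrite fE gE; move: af ag alpha0 beta0 {fE gE}.
move: (fine (bnorm sigma +oo f)) (fine (bnorm omega +oo g)) => alpha beta af ag alpha0 beta0.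
have [soo ooo] := DD_oo R0D.
have sE : sigma (cube R0) = (meas sigma (cube R0))%:E by exact: measE.
have oE : omega (cube R0) = (meas omega (cube R0))%:E by exact: measE.
rewrite sE oE !poweR_EFin -!EFinM.
set N := alpha * meas sigma (cube R0) `^ p^-1.
have N0 : 0 <= N by rewrite mulr_ge0// powR_ge0.
have sF : strongly_measurable (fun x => vabs (f x)) by exact: smeas_vabs Lf.1.
have fN : (\int[sigma]_x (`|vabs (f x)| `^ p)%:E <= (N `^ p)%:E)%E.
  apply: (@le_trans _ _ (\int[sigma]_x ((alpha `^ p)%:E * (\1_(cube R0) x)%:E)%E)%E).
    apply: ae_ge0_le_integral => //.
    - apply/measurable_EFinP; apply: (@measurableT_comp _ _ _ _ _ _ (fun t => t `^ p)) => //.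
      exact: measurable_norm_smeas.
    - by move=> x _; rewrite -EFinM lee_fin mulr_ge0// powR_ge0.
    - by apply: emeasurable_funM => //; exact/measurable_EFinP.
    apply: filterS af => x xa _; rewrite -EFinM lee_fin vnorm_abs.
    have [Rx|Rx] := pselect (cube R0 x).
      rewrite indicE mem_set// mulr1; apply: ge0_ler_powR; rewrite ?nnegrE//; exact: ltW.
    by rewrite fout// normr0 powR0 ?gt_eqF// mulr_ge0// powR_ge0.
  rewrite ge0_integralZl//; [|exact/measurable_EFinP|by rewrite lee_fin powR_ge0].
  rewrite integral_indic// setIT sE -EFinM lee_fin /N powRM ?powR_ge0// -powRrM.
  by rewrite mulVf ?gt_eqF// powRr1// meas_ge0.
have fi Q : Q \in DD -> bint sigma (cube Q) f.
  move=> QD; apply: (bint_cube_Lp QD Lf.1).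
  under eq_integral do rewrite -vnorm_abs.
  by apply: le_lt_trans fN _; rewrite ltry.
have TF : (bnorm omega q%:E (T (fun x => vabs (f x))) <= (c * N)%:E)%E.
  by apply: opnorm_scale => //; rewrite TE.
have sTF : simple_fun (T (fun x => vabs (f x))) by exact: (simple_T _ xpredT).
have sTl : simple_fun (T_loc DD sigma lam R0 f) by exact: (simple_T f (subcube (R := R) ^~ R0)).
have mTF : measurable_fun setT
    (fun x => `|T (fun x => vabs (f x)) x| * \1_(cube R0) x).
  apply: measurable_funM => //.
  exact: (@measurable_simple _ _ _ _ _ (fun y => `|y|) sTF).
have hh := integral_indic_hoelder R0D sTF TF (mulr_ge0 c0 N0).
have mgT := measurable_apply Lg.1 sTl.
apply: (le_trans (lee_abs _)); apply: (le_trans (le_abse_integral _ _ _)) => //.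
  exact/measurable_EFinP.
apply: (@le_trans _ _ (\int[omega]_x (beta%:E * (`|T (fun x => vabs (f x)) x| * \1_(cube R0) x)%:E)%E)%E).
  apply: ae_ge0_le_integral => //.
  - by apply: measurableT_comp => //; exact/measurable_EFinP.
  - by move=> x _; rewrite -EFinM lee_fin mulr_ge0// mulr_ge0.
  - by apply: emeasurable_funM => //; exact/measurable_EFinP.
  apply: filterS ag => x xb _; rewrite -EFinM lee_fin.
  have [Rx|Rx] := pselect (cube R0 x); last first.
    by rewrite gout//= normr0 !mulr_ge0.
  rewrite indicE mem_set// mulr1; apply: le_trans (ler_dual _ _) _.
  exact: ler_pM (normr_ge0 _) (normr_ge0 _) xb (T_loc_vabs R0 x fi).
rewrite ge0_integralZl//; [|exact/measurable_EFinP].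
apply: (le_trans (lee_wpmul2l _ hh)); first by rewrite lee_fin.
by rewrite -EFinM lee_fin /N le_eqVlt; apply/orP; left; apply/eqP; ring.
Qed.

End duality.

(** * Degenerate cases and the upper bound *)

Lemma HLnorm_ge0 {R : realType} d (E : banachLatticeType R) (p : R) : 0 < p ->
  (0 <= HLnorm d E p)%E.
Proof.
move=> p0; apply: (@le_trans _ _ (opnorm (lebesgue_Rd d) (lebesgue_Rd d) p%:E p%:E
  (HLmax fset0 : (d.-tuple R -> E) -> _))); first exact: opnorm_ge0.
by apply: ereal_sup_ubound; exists fset0.
Qed.

Section HLnorm_ge1.
Context {R : realType} {d' : nat} {E : banachLatticeType R}.
Local Notation d := d'.+1.

(** The maximal operator of the unit cube fixes its indicator.  The bound shows that an
    infinite Hardy-Littlewood constant is not cancelled by a vanishing one. *)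
Lemma HLnorm_ge1 (p : R) : 0 < p -> (exists e : E, e != 0) -> (1 <= HLnorm d E p)%E.
Proof.
move=> p0 [e0 e00]; pose e := `|e0|^-1 *: e0.
have e1 : `|e| = 1.
  by rewrite normrZ ger0_norm ?invr_ge0// mulVf// normr_eq0.
pose Q : dcube d := (0, [tuple 0 | i < d]).
pose mu : {measure set (d.-tuple R) -> \bar R} := lebesgue_Rd d.
have Q1 : mu (cube Q) = 1%E.
  have -> : cube Q = box (fun=> 0) (fun=> 1) :> set (d.-tuple R).
    by apply/seteqP; split => x Qx i; have := Qx i; rewrite /= tnth_mktuple !expr0z mul0r mul1r.
  rewrite [LHS](@lebesgue_box R d (fun=> 0) (fun=> 1) (fun=> ler01)).
  by rewrite big1// => i _; rewrite subr0.
have mQ : measurable (cube Q : set (d.-tuple R)) by exact: measurable_cube.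
pose f (x : d.-tuple R) := (\1_(cube Q) x : R) *: e.
have sf : strongly_measurable f.
  by apply: simple_smeas; apply: simple_fun_restr => //; exact: simple_fun_cst.
have fE : HLmax [fset Q]%fset f = f.
  apply/funext => x; rewrite /HLmax.
  have -> : enum_fset [fset Q]%fset = [:: Q] by apply: perm_small_eq => //; rewrite -fset_seq1.
  rewrite /= /f; congr (_ *: _); rewrite /cube_average.
  have Qoo : (mu (cube Q) < +oo)%E by rewrite Q1 ltry.
  have fQ (y : d.-tuple R) : cube Q y -> f y = e.
    by move=> Qy; rewrite /f indicE mem_set// scale1r.
  have [_ be] := @bochner_cst _ _ _ E mu (cube Q) f e mQ Qoo sf fQ.
  have fl : fine (lebesgue_Rd d (cube Q : set (d.-tuple R))) = 1.
    by transitivity (fine (mu (cube Q))); rewrite ?Q1.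
  rewrite fl invr1 scale1r; transitivity (fine (mu (cube Q)) *: e); first exact: be.
  by rewrite Q1 scale1r.
have f1 : bnorm mu p%:E f = 1%E.
  rewrite bnormE.
  have -> : (\int[mu]_x (`|f x| `^ p)%:E = \int[mu]_x (\1_(cube Q) x)%:E)%E.
    apply: eq_integral => x _; rewrite /f normrZ e1 mulr1 indicE.
    by case: (x \in _); rewrite ?normr1 ?powR1// normr0 powR0// gt_eqF.
  by rewrite integral_indic// setIT Q1 poweR_EFin powR1.
apply: (@le_trans _ _ (opnorm mu mu p%:E p%:E (HLmax [fset Q]%fset : (d.-tuple R -> E) -> _))).
  apply: ereal_sup_ubound; exists f; last by rewrite fE f1.
  by split; rewrite ?f1//; split => //; rewrite f1 ltry.
by apply: ereal_sup_ubound; exists [fset Q]%fset.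
Qed.

End HLnorm_ge1.

Section Ainf_char.
Context {R : realType} {d' : nat}.
Local Notation d := d'.+1.
Local Notation cube := (@cube R d).
Variables (DD : {fset dcube d}) (sigma omega : {measure set (d.-tuple R) -> \bar R}).
Hypothesis Afin : (Ainf_char DD sigma omega < +oo)%E.
Local Notation A := (fine (Ainf_char DD sigma omega)).

Lemma Ainf_char_ge0 : (0 <= Ainf_char DD sigma omega)%E.
Proof. by rewrite /Ainf_char; elim/big_rec : _ => // Q y _ y0; rewrite le_max y0 orbT. Qed.

Let AE : Ainf_char DD sigma omega = A%:E.
Proof. by rewrite fineK// ge0_fin_numE// Ainf_char_ge0. Qed.

Variable F : dcube d.
Hypotheses (FD : F \in DD) (soo : (sigma (cube F) < +oo)%E).
Hypothesis s0 : 0 < meas sigma (cube F).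

Let sE : sigma (cube F) = (meas sigma (cube F))%:E.
Proof. by exact: measE. Qed.

Lemma Ainf_char_ub :
  (\int[omega]_x Ainf_max DD sigma omega F x <= (A * meas sigma (cube F))%:E)%E.
Proof.
have ub : (0 < sigma (cube F))%E ->
    ((sigma (cube F))^-1 * \int[omega]_x Ainf_max DD sigma omega F x <=
     Ainf_char DD sigma omega)%E.
  exact: (@bigmaxe_ub R _ DD (fun Q => (0 < sigma (cube Q))%E)
    (fun Q => ((sigma (cube Q))^-1 * \int[omega]_x Ainf_max DD sigma omega Q x)%E) F FD).
move: ub; have := AE; set a := fine _ => ->.
by rewrite sE lte_fin => /(_ s0); rewrite inver gt_eqF// lee_pdivrMl// -EFinM mulrC.
Qed.

Lemma Ainf_char_ge1 : (omega (cube F) < +oo)%E -> 0 < meas omega (cube F) -> 1 <= A.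
Proof.
move=> ooo o0; have mF : measurable (cube F) by exact: measurable_cube.
have oE : omega (cube F) = (meas omega (cube F))%:E by exact: measE.
rewrite -(ler_pM2r s0) mul1r -lee_fin; apply: le_trans Ainf_char_ub.
have FF : subcube (R := R) F F by exact: subcube_refl.
apply: (@le_trans _ _ (\int[omega]_x ((meas sigma (cube F) / meas omega (cube F))%:E * (\1_(cube F) x)%:E))%E).
  rewrite ge0_integralZl//; [|exact/measurable_EFinP|by rewrite lee_fin divr_ge0 ?meas_ge0].
  by rewrite integral_indic// setIT oE -EFinM divfK// gt_eqF.
apply: ge0_le_integral => //.
- by move=> x _; rewrite -EFinM lee_fin mulr_ge0// divr_ge0 ?meas_ge0.
- by apply: emeasurable_funM => //; exact/measurable_EFinP.
- exact: measurable_Ainf_max.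
move=> x _.
have := @bigmaxe_ub R _ DD (fun Q => subcube (R := R) Q F && (0 < omega (cube Q))%E)
    (fun Q => (sigma (cube Q) / omega (cube Q) * (\1_(cube Q) x)%:E)%E) F FD.
by rewrite FF oE lte_fin => /(_ o0); rewrite sE inver gt_eqF.
Qed.

End Ainf_char.

Section upper_bound.
Context {R : realType} {d' : nat} {C D : banachLatticeType R}.
Local Notation d := d'.+1.
Local Notation cube := (@cube R d).
Variables (p p' q q' : R) (p_gt1 : 1 < p) (pp' : p^-1 + p'^-1 = 1).
Hypotheses (q_gt1 : 1 < q) (qq' : q^-1 + q'^-1 = 1) (p_le_q : p <= q).
Variables (DD : {fset dcube d}) (sigma omega : {measure set (d.-tuple R) -> \bar R}).
Variable lam : dcube d -> {linear C -> D}.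
Hypothesis lam_ge0 : forall Q, Q \in DD -> forall c : C, 0 <=v c -> 0 <=v lam Q c.
Hypothesis DD_oo : forall Q, Q \in DD -> (sigma (cube Q) < +oo)%E /\ (omega (cube Q) < +oo)%E.
Hypothesis sigma_Ainf : (Ainf_char DD sigma omega < +oo)%E.
Hypothesis omega_Ainf : (Ainf_char DD omega sigma < +oo)%E.
Local Notation B := (testing_const DD sigma omega lam p q').
Local Notation T_norm := (opnorm sigma omega p%:E q%:E (T_op DD sigma lam)).
Local Notation s := (charged DD sigma omega).

Let sD : {subset s <= DD}. Proof. by move=> Q; rewrite mem_filter => /andP[]. Qed.

Let us : uniq s. Proof. exact: filter_uniq (fset_uniq _). Qed.

Let s0 Q : Q \in s -> 0 < meas sigma (cube Q) /\ 0 < meas omega (cube Q).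
Proof. by rewrite mem_filter => /andP[/andP[]]. Qed.

Let q'_gt1 : 1 < q'. Proof. exact: conjugate_gt1 qq'. Qed.

Lemma bound_const_gt0 : 0 < bound_const p p' q q'.
Proof.
have p'0 : 0 < p' by exact: lt_trans (conjugate_gt1 p_gt1 pp').
have q0 : 0 < q by exact: lt_trans q_gt1.
by rewrite /bound_const !mulr_gt0// powR_gt0// !mulr_gt0// powR_gt0.
Qed.

Lemma testing_const_ge0 : (0 <= B)%E.
Proof. by apply: le_ereal_inf_tmp => _ [c [c0 _] <-]; rewrite lee_fin. Qed.

(** [test_local] for a single cube bounds the pairing by every admissible constant times
    a fixed number. *)
Lemma pairing_le0 (f : d.-tuple R -> C) (g : d.-tuple R -> dual D) Q :
  B = 0%E -> (forall x, 0 <=v f x) -> (forall x, 0 <=v g x) ->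
  (forall Q, Q \in s -> bint sigma (cube Q) f) ->
  (forall Q, Q \in s -> bint omega (cube Q) g) ->
  Q \in s -> pairing sigma omega lam f g Q <= 0.
Proof.
move=> B0 f0 g0 fi gi Qs; rewrite leNgt; apply/negP => a0.
have lsup1 (E : banachLatticeType R) (mu : {measure set (d.-tuple R) -> \bar R})
    (h : d.-tuple R -> E) x : (forall Q, Q \in s -> bint mu (cube Q) h) ->
    (forall x, 0 <=v h x) -> `|local_sup mu h s (pred1 Q) x| <= `|average mu h Q|.
  move=> hi h0; have v0 : 0 <=v average mu h Q by exact: average_ge0 hi _ Qs.
  apply: vnorm_mono; first exact: vbig_ge0.
  apply: vbig_lub => // Q' _ /eqP ->; rewrite indicE.
  by case: (x \in _); rewrite ?scale1r ?scale0r//; exact: vle_refl.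
set X := `|average sigma f Q| * meas sigma (cube Q) `^ p^-1 *
  (`|average omega g Q| * meas omega (cube Q) `^ q'^-1).
have tl c : 0 <= c -> testing_bound DD sigma omega lam p q' c ->
    pairing sigma omega lam f g Q <= c * X.
  move=> c0 tb.
  have := @test_local R d' C D DD sigma omega lam lam_ge0 p q' c c0 tb s us sD DD_oo
    (fun Q Qs => (s0 Qs).1) (fun Q Qs => (s0 Qs).2) f g f0 g0 fi gi Q (pred1 Q)
    _ _ (sD Qs) _ (normr_ge0 (average sigma f Q)) (normr_ge0 (average omega g Q)).
  rewrite -big_filter (filter_pred1_uniq us Qs) big_seq1; apply.
  - by move=> Q' _ /eqP ->; exact: subcube_refl.
  - by move=> x; exact: lsup1.
  - by move=> x; exact: lsup1.
have X0 : 0 <= X by rewrite /X !mulr_ge0// powR_ge0.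
have : ((pairing sigma omega lam f g Q / (X + 1))%:E <= B)%E.
  apply: le_ereal_inf_tmp => _ [c [c0 tb] <-]; rewrite lee_fin.
  rewrite ler_pdivrMr; last by rewrite ltr_wpDl.
  by apply: le_trans (tl _ c0 tb) _; rewrite ler_wpM2l// lerDl.
by rewrite B0 lee_fin leNgt divr_gt0// ltr_wpDl.
Qed.

(** In these cases the product on the right may be 0 * oo = 0, and the operator has to
    vanish. *)
Lemma degenerate_bound :
  [\/ forall x : C, x = 0, forall y : D, y = 0, s = [::] | B = 0%E] ->
  (T_norm <= 0)%E.
Proof.
move=> deg; apply: (duality p_gt1 q_gt1 qq' lam_ge0 DD_oo (lexx 0)).
move=> f g f0 g0 sf sg f1 g1; rewrite big_seq; apply: sumr_le0 => Q Qs.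
case: deg => [C0|D0|sn|B0].
- by rewrite /pairing [bochner_integral_on sigma _ _]C0 !linear0.
- by rewrite /pairing [lam _ _]D0 linear0.
- by move: Qs; rewrite sn.
- apply: pairing_le0 => // Q' /sD/DD_oo[soo ooo].
    apply: (bint_Lp (ltW p_gt1) (measurable_cube Q') soo sf).
    by apply: le_lt_trans f1 _; rewrite ltry.
  apply: (bint_Lp (ltW q'_gt1) (measurable_cube Q') ooo sg).
  by apply: le_lt_trans g1 _; rewrite ltry.
Qed.

Lemma nondegenerate_bound (M1 M2 : R) : 1 <= M1 -> 1 <= M2 ->
  (HLnorm d C p <= M1%:E)%E -> (HLnorm d (dual D) q' <= M2%:E)%E ->
  s != [::] ->
  (T_norm <= (bound_const p p' q q' * (M1 * M2) *
    (fine (Ainf_char DD sigma omega) `^ p^-1 + fine (Ainf_char DD omega sigma) `^ q'^-1))%:E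
    * B)%E.
Proof.
move=> M11 M21 HLC HLD sn.
have [Q0 Q0s] : exists Q, Q \in s by case: (s) sn => // Q r _; exists Q; exact: mem_head.
have [soo0 ooo0] := DD_oo (sD Q0s); have [s00 o00] := s0 Q0s.
have A1 := Ainf_char_ge1 sigma_Ainf (sD Q0s) soo0 s00 ooo0 o00.
have A2 := Ainf_char_ge1 omega_Ainf (sD Q0s) ooo0 o00 soo0 s00.
set a1 := fine (Ainf_char DD sigma omega) in A1 *.
set a2 := fine (Ainf_char DD omega sigma) in A2 *.
have a10 : 0 < a1 by exact: lt_le_trans A1.
have a20 : 0 < a2 by exact: lt_le_trans A2.
have K0 := bound_const_gt0.
set k := _ * _ * _; have k0 : 0 < k.
  have M10 : 0 < M1 by exact: lt_le_trans ltr01 M11.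
  have M20 : 0 < M2 by exact: lt_le_trans ltr01 M21.
  by rewrite /k mulr_gt0 ?addr_gt0 ?powR_gt0// mulr_gt0// mulr_gt0.
have pq' : 1 <= p^-1 + q'^-1.
  rewrite -qq' lerD2r lef_pV2// posrE; first exact: lt_trans q_gt1.
  exact: lt_trans p_gt1.
rewrite -lee_pdivrMl//; apply: le_ereal_inf_tmp => _ [c [c0 tb] <-].
rewrite lee_pdivrMl// -EFinM.
apply: (duality p_gt1 q_gt1 qq' lam_ge0 DD_oo); first by rewrite mulr_ge0// ltW.
move=> f g f0 g0 sf sg f1 g1.
have AS F : F \in s ->
    (\int[omega]_x Ainf_max DD sigma omega F x <= (a1 * meas sigma (cube F))%:E)%E.
  move=> Fs; have [soo ooo] := DD_oo (sD Fs); have [h1 h2] := s0 Fs.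
  exact: (Ainf_char_ub sigma_Ainf (sD Fs) soo h1).
have AO F : F \in s ->
    (\int[sigma]_x Ainf_max DD omega sigma F x <= (a2 * meas omega (cube F))%:E)%E.
  move=> Fs; have [soo ooo] := DD_oo (sD Fs); have [h1 h2] := s0 Fs.
  exact: (Ainf_char_ub omega_Ainf (sD Fs) ooo h2).
exact: (main_sum p_gt1 pp' q_gt1 qq' pq' M11 M21 a10 a20 HLC HLD lam_ge0 c0 tb us sD DD_oo
  (fun Q Qs => (s0 Qs).1) (fun Q Qs => (s0 Qs).2) AS AO f0 g0 sf sg f1 g1).
Qed.

Lemma upper_bound :
  (T_norm <= (bound_const p p' q q')%:E * HLnorm d C p * HLnorm d (dual D) q' *
     (Ainf_char DD sigma omega `^ p^-1 + Ainf_char DD omega sigma `^ q'^-1) * B)%E.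
Proof.
have K0 := bound_const_gt0.
have p_gt0 : 0 < p by exact: lt_trans p_gt1.
have q'_gt0 : 0 < q' by exact: lt_trans q'_gt1.
have HC := HLnorm_ge0 d C p_gt0; have HD := HLnorm_ge0 d (dual D) q'_gt0.
have B0 := testing_const_ge0.
set S := (_ `^ _ + _ `^ _)%E.
have S0 : (0 <= S)%E by rewrite adde_ge0// poweR_ge0.
have [deg|nondeg] := pselect
    [\/ forall x : C, x = 0, forall y : D, y = 0, s = [::] | B = 0%E].
  by apply: le_trans (degenerate_bound deg) _; rewrite !mule_ge0// lee_fin ltW.
have HC1 : (1 <= HLnorm d C p)%E.
  apply: HLnorm_ge1 => //; apply: contrapT => nx; apply: nondeg; apply: Or41 => x.
  by apply/eqP; apply: contrapT => /negP x0; apply: nx; exists x.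
have HD1 : (1 <= HLnorm d (dual D) q')%E.
  apply: HLnorm_ge1 => //; apply: contrapT => nphi; apply: nondeg; apply: Or42 => y.
  have [phi [_ phiy]] := norming_functional y.
  apply/eqP; rewrite -normr_eq0 -phiy; apply/eqP.
  suff -> : phi = 0 by [].
  by apply/eqP; apply: contrapT => /negP phi0; apply: nphi; exists phi.
have sn : s != [::] by apply/eqP => sn; apply: nondeg; exact: Or43.
have Bgt0 : (0 < B)%E by rewrite lt0e B0 andbT; apply/eqP => h; apply: nondeg; exact: Or44.
have a1E : Ainf_char DD sigma omega = (fine (Ainf_char DD sigma omega))%:E.
  by rewrite fineK// ge0_fin_numE// Ainf_char_ge0.
have a2E : Ainf_char DD omega sigma = (fine (Ainf_char DD omega sigma))%:E.
  by rewrite fineK// ge0_fin_numE// Ainf_char_ge0.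
have [Q0 Q0s] : exists Q, Q \in s by case: (s) sn => // Q r _; exists Q; exact: mem_head.
have [soo0 ooo0] := DD_oo (sD Q0s); have [s00 o00] := s0 Q0s.
have A1 := Ainf_char_ge1 sigma_Ainf (sD Q0s) soo0 s00 ooo0 o00.
have SE : S = (fine (Ainf_char DD sigma omega) `^ p^-1 +
    fine (Ainf_char DD omega sigma) `^ q'^-1)%:E by rewrite /S {1}a1E {1}a2E !poweR_EFin.
have Sgt0 : (0 < S)%E.
  by rewrite SE lte_fin ltr_wpDr ?powR_ge0// powR_gt0// (lt_le_trans ltr01).
have K0e : (0 < (bound_const p p' q q')%:E)%E by rewrite lte_fin.
have [HCoo|HCfin] := eqVneq (HLnorm d C p) +oo%E.
  by rewrite HCoo gt0_muley// !gt0_mulye// ?leey// (lt_le_trans lte01).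
have [HDoo|HDfin] := eqVneq (HLnorm d (dual D) q') +oo%E.
  rewrite HDoo gt0_muley ?gt0_mulye ?leey// mule_gt0// (lt_le_trans lte01)//.
have HCE : HLnorm d C p = (fine (HLnorm d C p))%:E by rewrite fineK// ge0_fin_numE// ltey.
have HDE : HLnorm d (dual D) q' = (fine (HLnorm d (dual D) q'))%:E.
  by rewrite fineK// ge0_fin_numE// ltey.
have M1 : 1 <= fine (HLnorm d C p) by rewrite -lee_fin -HCE.
have M2 : 1 <= fine (HLnorm d (dual D) q') by rewrite -lee_fin -HDE.
have := nondegenerate_bound M1 M2 _ _ sn.
rewrite -HCE -HDE => /(_ (lexx _) (lexx _)); rewrite EFinM -SE !EFinM -HCE -HDE.
by rewrite [((bound_const _ _ _ _)%:E * _)%E]muleA.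
Qed.

End upper_bound.

Theorem theorem1p5 (R : realType) (p q q' : R) (p_gt1 : 1 < p)
    (p_le_q : p <= q) (qq' : q^-1 + q'^-1 = 1) :
  exists K : R, 0 < K /\
  forall (d : nat) (d_gt0 : (0 < d)%N)
    (sigma omega : {measure set (d.-tuple R) -> \bar R})
    (sigma_lf : locally_finite sigma) (omega_lf : locally_finite omega)
    (C D : banachLatticeType R)
    (C_HL : HL_property d C) (D_HL : HL_property d (dual D))
    (DD : {fset dcube d}) (lam : dcube d -> {linear C -> D})
    (lam_ge0 : forall Q, Q \in DD -> forall c : C, 0 <=v c -> 0 <=v lam Q c)
    (sigma_Ainf : (Ainf_char DD sigma omega < +oo)%E)
    (omega_Ainf : (Ainf_char DD omega sigma < +oo)%E),
  let B := testing_const DD sigma omega lam p q' in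
  let T_norm := opnorm sigma omega p%:E q%:E (T_op DD sigma lam) in
  (B <= T_norm /\
   T_norm <= K%:E * HLnorm d C p * HLnorm d (dual D) q' *
     (Ainf_char DD sigma omega `^ p^-1 + Ainf_char DD omega sigma `^ q'^-1) *
     B)%E.
Proof.
have q_gt1 : 1 < q by exact: lt_le_trans p_le_q.
have pV : 0 < 1 - p^-1 by rewrite subr_gt0 invf_lt1// (lt_trans ltr01).
pose p' := (1 - p^-1)^-1.
have pp' : p^-1 + p'^-1 = 1 by rewrite invrK addrC subrK.
exists (bound_const p p' q q'); split; first exact: (bound_const_gt0 q' p_gt1 pp' q_gt1).
case=> [//|d'] _ sigma omega sigma_lf omega_lf C D _ _ DD lam lam_ge0 sA oA B T_norm.
have DD_oo Q : Q \in DD -> (sigma (cube Q) < +oo)%E /\ (omega (cube Q) < +oo)%E.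
  by move=> _; split; exact: locally_finite_cube.
by split; [exact: lower_bound|exact: upper_bound].
Qed.
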